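(* Let $h:\mathbb{R}^d\setminus\{0\}\to(0,\infty)$ be a standard majorizing kernel and let $v_0\in F_h(\mathbb{R}^d;\mathbb{C}^d)$. (a) If $\|v_0\|_{F_h}\le2$ then (FNS)$_{v_0}$ has a solution $v\in F_{h,\infty}$ with $\|v\|_{F_{h,\infty}}\le2$. (b) If $\|v_0\|_{F_h}<2$ then the global solution $v$ obtained in part (a) can be taken to have the decay $$|v(\xi,t)|\le C\,\frac{\mu\|v_0\|_{F_h}}{2-\mu\|v_0\|_{F_h}}\,e^{-\kappa|\xi|\sqrt t}\,h(\xi)\qquad\forall(\xi,t),$$ where $C>0$ is a universal constant (depending only on the fixed dimension $d$), $\mu=(8e^{3/4})^\kappa$, and $\kappa>0$ is any number less than $\min\left\{1,\frac{4(\ln2-\ln\|v_0\|_{F_h})}{3(1+4\ln2)}\right\}$. (c) Moreover (when $\|v_0\|_{F_h}<2$), for any $T\in[0,\infty]$, this solution is unique in the class of solutions of (FNS)$_{v_0}$ on $\mathbb{R}^d\times[0,T)$ satisfying $\|v\|_{F_{h,\infty}(\mathbb{R}^d\times[0,T))}=\operatorname{ess\,sup}_{t\in[0,T)}\|v(t)\|_{F_h}<2$.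
   Context: $d\ge3$. A standard majorizing kernel is a measurable function $h:\mathbb{R}^d\setminus\{0\}\to(0,\infty)$ with $(h*h)(\xi)=|\xi|h(\xi)$ for all $\xi\ne0$. $c_0=(2\pi)^{-d/2}$. The majorization space is $$F_h=\Big\{f\in L^1_{\rm loc}(\mathbb{R}^d):\ \operatorname*{ess\,sup}_{\xi\in\mathbb{R}^d}|f(\xi)|h(\xi)^{-1}<\infty\Big\},\qquad\|f\|_{F_h}=\|c_0f/h\|_{L^\infty},$$ $F_h(\mathbb{R}^d;\mathbb{C}^d)$ is its $\mathbb{C}^d$-valued version, and $F_{h,\infty}=L^\infty((0,\infty);F_h)$. Functions are identified when equal a.e., and pointwise bounds are understood accordingly. For $\xi\ne0$, $e_\xi=\xi/|\xi|$, $\pi_{\xi^\perp}a=a-(e_\xi\cdot a)e_\xi$ and $a\odot_\xi b=\frac{-i}{2}\big((e_\xi\cdot b)\pi_{\xi^\perp}a+(e_\xi\cdot a)\pi_{\xi^\perp}b\big)$ for $a,b\in\mathbb{C}^d$ (with $e_\xi\cdot a=\sum_j(e_\xi)_ja_j$). (FNS)$_{v_0}$ (Fourier-transformed Navier-Stokes equations) is $$v(\xi,t)=e^{-t|\xi|^2}v_0(\xi)+c_0\int_0^te^{-s|\xi|^2}|\xi|\int_{\mathbb{R}^d}v(\eta,t-s)\odot_\xi v(\xi-\eta,t-s)\,d\eta\,ds .$$ *)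

(* Defs.v *)
From HB Require Import structures.
From mathcomp Require Import all_boot all_order all_algebra.
From mathcomp Require Import all_classical all_reals all_analysis.
From mathcomp Require Import ess_sup_inf complex.
Set Implicit Arguments.
Unset Strict Implicit.
Unset Printing Implicit Defensive.
Import Order.TTheory GRing.Theory Num.Theory.
Import numFieldNormedType.Exports.
Local Open Scope classical_set_scope.
Local Open Scope ring_scope.

(* The sigma-algebra of 'rV[T]_n is generated by the coordinate maps; for
   T = R it is the Borel sigma-algebra of R^n. *)
Definition measure_rV_display : measure_display -> measure_display.
Proof. exact. Qed.

Section measurable_rV.
Context {d} {T : measurableType d}.
Variable n : nat.

Let coors : 'I_n -> 'rV[T]_n -> T := fun i x => x ord0 i.

Let rV_set0 : g_sigma_preimage coors set0.
Proof. exact: sigma_algebra0. Qed.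

Let rV_setC A : g_sigma_preimage coors A -> g_sigma_preimage coors (~` A).
Proof. exact: sigma_algebraC. Qed.

Let rV_bigcup (F : _^nat) : (forall i, g_sigma_preimage coors (F i)) ->
  g_sigma_preimage coors (\bigcup_i (F i)).
Proof. exact: sigma_algebra_bigcup. Qed.

HB.instance Definition _ := @isMeasurable.Build (measure_rV_display d)
  'rV[T]_n (g_sigma_preimage coors) rV_set0 rV_setC rV_bigcup.

End measurable_rV.

Lemma measurable_coord d (T : measurableType d) n (i : 'I_n) :
  measurable_fun [set: 'rV[T]_n] (fun x => x ord0 i).
Proof.
move=> _ Y mY; rewrite setTI; apply: sub_sigma_algebra => /=.
rewrite -bigcup_seq/=; exists i => /=; first by rewrite mem_index_enum.
by exists Y => //; rewrite setTI.
Qed.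

Lemma measurable_fun_coordP d1 d2 (T1 : measurableType d1)
    (T2 : measurableType d2) n (f : T1 -> 'rV[T2]_n) :
  measurable_fun [set: T1] f <->
  forall i, measurable_fun [set: T1] (fun x => f x ord0 i).
Proof.
split=> [mf i|mf].
  exact: (measurableT_comp (measurable_coord i) mf).
apply: (@measurability _ _ _ _ _ _
  (\big[setU/set0]_(i < n)
     preimage_set_system setT (fun x : 'rV[T2]_n => x ord0 i) measurable)) => //.
move=> _ [A + <-]; rewrite -bigcup_seq/= => -[i _ [B mB <-]].
have := mf i measurableT _ mB.
by rewrite !setTI.
Qed.

Section lebesgue_rV.
Context {R : realType}.

Section cons.
Context {n : nat}.

Definition cons_rV (p : R * 'rV[R]_n) : 'rV[R]_n.+1 :=
  row_mx (const_mx p.1 : 'rV[R]_1) p.2.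

Definition uncons_rV (x : 'rV[R]_n.+1) : R * 'rV[R]_n :=
  (x ord0 ord0, \row_j x ord0 (lift ord0 j)).

Lemma cons_rV0 p : cons_rV p ord0 ord0 = p.1.
Proof.
have -> : (ord0 : 'I_n.+1) = @lshift 1 n ord0 by apply/val_inj.
by rewrite /cons_rV (row_mxEl (const_mx p.1 : 'rV[R]_1) p.2) mxE.
Qed.

Lemma cons_rVS p j : cons_rV p ord0 (lift ord0 j) = p.2 ord0 j.
Proof.
have -> : lift ord0 j = @rshift 1 n j by apply/val_inj.
by rewrite /cons_rV (row_mxEr (const_mx p.1 : 'rV[R]_1) p.2).
Qed.

Lemma cons_rVK : cancel cons_rV uncons_rV.
Proof.
move=> [x y]; rewrite /uncons_rV cons_rV0; congr pair.
by apply/rowP => j; rewrite mxE cons_rVS.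
Qed.

Lemma measurable_cons_rV : measurable_fun setT cons_rV.
Proof.
apply/measurable_fun_coordP => i.
have [j ->|->] := unliftP ord0 i; rewrite /=.
  under eq_fun do rewrite cons_rVS.
  exact: (measurableT_comp (measurable_coord j) measurable_snd).
under eq_fun do rewrite cons_rV0.
exact: measurable_fst.
Qed.

Lemma measurable_uncons_rV : measurable_fun setT uncons_rV.
Proof.
apply/measurable_fun_pairP; split; first exact: measurable_coord.
apply/measurable_fun_coordP => j /=.
under eq_fun do rewrite mxE.
exact: measurable_coord.
Qed.

Variable mu : {sigma_finite_measure set 'rV[R]_n -> \bar R}.

Definition lebesgue_cons_rV : set 'rV[R]_n.+1 -> \bar R :=
  pushforward (lebesgue_measure \x mu)%E cons_rV.

Let lebesgue_cons_rV0 : lebesgue_cons_rV set0 = 0%E.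
Proof. by rewrite /lebesgue_cons_rV /pushforward preimage_set0 measure0. Qed.

Let lebesgue_cons_rV_ge0 A : (0 <= lebesgue_cons_rV A)%E.
Proof. by rewrite /lebesgue_cons_rV /pushforward measure_ge0. Qed.

Let lebesgue_cons_rV_sigma_additive : semi_sigma_additive lebesgue_cons_rV.
Proof.
have := @measure_semi_sigma_additive _ _ _
  (measure_function_pushforward__canonical__measure_function_Measure
    (lebesgue_measure \x mu)%E measurable_cons_rV).
exact.
Qed.

HB.instance Definition _ := isMeasure.Build _ _ _ lebesgue_cons_rV
  lebesgue_cons_rV0 lebesgue_cons_rV_ge0 lebesgue_cons_rV_sigma_additive.

Let lebesgue_cons_rV_sigma_finite : sigma_finite setT lebesgue_cons_rV.
Proof.
have /sigma_finiteP[F [TF ndF Foo]] := sigma_finiteT (@lebesgue_measure R).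
have /sigma_finiteP[G [TG ndG Goo]] := sigma_finiteT mu.
exists (fun k => uncons_rV @^-1` (F k `*` G k)).
  rewrite -preimage_bigcup (_ : \bigcup_k _ = setT) ?preimage_setT//.
  rewrite -setXTT TF TG predeqE => -[x y]; split.
    by move=> [n' _ []/= ? ?]; split; exists n'.
  move=> [/= [i _ Fix] [j _ Gjy]]; exists (maxn i j) => //; split.
  - by move: x Fix; exact/subsetPset/ndF/leq_maxl.
  - by move: y Gjy; exact/subsetPset/ndG/leq_maxr.
move=> k; have [mF Fkoo] := Foo k; have [mG Gkoo] := Goo k; split.
  rewrite -[X in measurable X]setTI; apply: measurable_uncons_rV => //.
  exact: measurableX.
rewrite /lebesgue_cons_rV /pushforward -comp_preimage.
rewrite (_ : uncons_rV \o cons_rV = id); last first.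
  by apply/funext => p /=; rewrite cons_rVK.
by rewrite preimage_id product_measure1E// lte_mul_pinfty// ge0_fin_numE.
Qed.

HB.instance Definition _ := Measure_isSigmaFinite.Build _ _ _
  lebesgue_cons_rV lebesgue_cons_rV_sigma_finite.

End cons.

(* Lebesgue measure on R^n, as the n-fold product of the one-dimensional
   Lebesgue measure; on R^0 it is the Dirac mass. *)
Fixpoint lebesgue_rV (n : nat) : {sigma_finite_measure set 'rV[R]_n -> \bar R} :=
  if n is n'.+1 then lebesgue_cons_rV (lebesgue_rV n')
  else \d_(0 : 'rV[R]_0).

Lemma lebesgue_rV_box n (A : 'I_n -> set R) :
  (forall i, measurable (A i)) ->
  (lebesgue_rV n [set x | forall i, A i (x ord0 i)] =
   \prod_(i < n) lebesgue_measure (A i))%E.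
Proof.
elim: n A => [|n IHn] A mA.
  rewrite big_ord0 /= diracE mem_set//= => -[].
  by [].
rewrite big_ord_recl.
change ((lebesgue_measure \x lebesgue_rV n)%E
  (cons_rV @^-1` [set x | forall i, A i (x ord0 i)]) = 
  lebesgue_measure (A ord0) *
    \prod_(i < n) lebesgue_measure (A (lift ord0 i)))%E.
have E : cons_rV @^-1` [set x | forall i, A i (x ord0 i)] =
    A ord0 `*` [set x : 'rV[R]_n | forall i : 'I_n, A (lift ord0 i) (x ord0 i)].
  apply/seteqP; split => [[x y] /= Axy|[x y] /= [Ax Ay] i].
    split; first by have := Axy ord0; rewrite cons_rV0.
    by move=> i; have := Axy (lift ord0 i); rewrite cons_rVS.
  by have [j ->|->] := unliftP ord0 i; rewrite ?cons_rV0 ?cons_rVS.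
transitivity ((lebesgue_measure \x lebesgue_rV n)%E
    (A ord0 `*` [set x : 'rV[R]_n | forall i : 'I_n, A (lift ord0 i) (x ord0 i)])).
  by congr (product_measure1 _ _ _).
have mB : measurable [set x : 'rV[R]_n | forall i : 'I_n, A (lift ord0 i) (x ord0 i)].
  rewrite [X in measurable X](_ : _ = \bigcap_(i in [set: 'I_n])
      ((fun x : 'rV[R]_n => x ord0 i) @^-1` A (lift ord0 i))); last first.
    by apply/seteqP; split => [x Ax i _|x Ax i]; exact: Ax.
  apply: fin_bigcap_measurable => // i _.
  by rewrite -[X in measurable X]setTI; apply: measurable_coord.
have IH := IHn (fun i => A (lift ord0 i)) (fun i => mA (lift ord0 i)).
etransitivity; first exact: (product_measure1E lebesgue_measure (lebesgue_rV n) (mA ord0) mB).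
by congr (_ * _)%E.
Qed.

End lebesgue_rV.

Section spaces.
Context {R : realType}.
Local Open Scope complex_scope.

(* The library norm of 'rV[R]_d is the sup norm. *)
Definition enorm d (x : 'rV[R]_d) : R := Num.sqrt (\sum_j x ord0 j ^+ 2).

Definition cnorm d (a : 'rV[R[i]]_d) : R :=
  Num.sqrt (\sum_j (complex.Re (a ord0 j) ^+ 2 + complex.Im (a ord0 j) ^+ 2)).

Definition c0 (d : nat) : R := (2 * pi) `^ (- (d%:R / 2)).

Definition Cmeasurable dT (T : measurableType dT) d (D : set T)
    (f : T -> 'rV[R[i]]_d) :=
  forall j, measurable_fun D (fun x => complex.Re (f x ord0 j)) /\
            measurable_fun D (fun x => complex.Im (f x ord0 j)).

Definition Cintegral dT (T : measurableType dT)
    (mu : {measure set T -> \bar R}) d (D : set T) (f : T -> 'rV[R[i]]_d) :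
    'rV[R[i]]_d :=
  \row_j ((\int[mu]_(x in D) complex.Re (f x ord0 j)) +i*
          (\int[mu]_(x in D) complex.Im (f x ord0 j))).

(* h lives on R^d minus the origin: the value h 0 has no influence. Borel
   measurability is no restriction, since h xi = (h * h) xi / |xi| depends only
   on the a.e. class of h. *)
Definition standard_majorizing_kernel d (h : 'rV[R]_d -> R) :=
  [/\ measurable_fun [set~ (0 : 'rV[R]_d)] h,
      forall xi : 'rV[R]_d, xi != 0 -> 0 < h xi &
      forall xi : 'rV[R]_d, xi != 0 ->
        (\int[lebesgue_rV d]_(eta in [set eta | eta != 0%R /\ eta != xi]) (h eta * h (xi - eta))%:E =
         (enorm xi * h xi)%:E)%E].

Definition L1loc d (f : 'rV[R]_d -> 'rV[R[i]]_d) :=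
  Cmeasurable setT f /\
  forall K : set 'rV[R]_d, compact K ->
    (\int[lebesgue_rV d]_(xi in K) (cnorm (f xi))%:E < +oo)%E.

Definition Fh d (h : 'rV[R]_d -> R) (f : 'rV[R]_d -> 'rV[R[i]]_d) :=
  L1loc f /\
  (ess_sup (lebesgue_rV d) (fun xi => (cnorm (f xi) * (h xi)^-1)%:E) < +oo)%E.

Definition Fh_norm d (h : 'rV[R]_d -> R) (f : 'rV[R]_d -> 'rV[R[i]]_d) :
    \bar R :=
  ess_sup (lebesgue_rV d) (fun xi => (c0 d * cnorm (f xi) / h xi)%:E).

Definition time (T : \bar R) : set R := [set t | 0 < t /\ (t%:E < T)%E].

Definition Fh_infty_norm d (h : 'rV[R]_d -> R) (T : \bar R)
    (v : 'rV[R]_d -> R -> 'rV[R[i]]_d) : \bar R :=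
  ess_sup lebesgue_measure ((fun t => Fh_norm h (v^~ t)) \_ (time T)).

(* L^oo((0, T); F_h), as functions of (xi, t); the values outside
   R^d x (0, T) are irrelevant. *)
Definition Fh_infty d (h : 'rV[R]_d -> R) (T : \bar R)
    (v : 'rV[R]_d -> R -> 'rV[R[i]]_d) :=
  [/\ Cmeasurable (setT `*` time T) (fun p : 'rV[R]_d * R => v p.1 p.2),
      {ae lebesgue_measure, forall t, time T t -> Fh h (v^~ t)} &
      (Fh_infty_norm h T v < +oo)%E].

(* Iterated form of "for a.e. (xi, t) in R^d x (0, T)"; by Tonelli it agrees
   with the product-null form when P is measurable. *)
Definition ae_xt d (T : \bar R) (P : 'rV[R]_d -> R -> Prop) :=
  {ae lebesgue_measure, forall t, time T t ->
    {ae lebesgue_rV d, forall xi, P xi t}}.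

Definition dir d (xi : 'rV[R]_d) : 'rV[R]_d := (enorm xi)^-1 *: xi.

Definition cdot d (e : 'rV[R]_d) (a : 'rV[R[i]]_d) : R[i] :=
  \sum_j (e ord0 j)%:C * a ord0 j.

Definition proj_perp d (xi : 'rV[R]_d) (a : 'rV[R[i]]_d) : 'rV[R[i]]_d :=
  a - cdot (dir xi) a *: map_mx (fun r : R => r%:C) (dir xi).

Definition odot d (xi : 'rV[R]_d) (a b : 'rV[R[i]]_d) : 'rV[R[i]]_d :=
  (- 'i / 2%:R) *:
    (cdot (dir xi) b *: proj_perp xi a + cdot (dir xi) a *: proj_perp xi b).

(* Lebesgue integrals of non-integrable functions have junk values here; for v
   in L^oo((0, T); F_h) all of them converge absolutely a.e., as the inner one
   is dominated by a multiple of (h * h) xi = |xi| h xi. *)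
Definition FNS_rhs d (v0 : 'rV[R]_d -> 'rV[R[i]]_d)
    (v : 'rV[R]_d -> R -> 'rV[R[i]]_d) (xi : 'rV[R]_d) (t : R) :
    'rV[R[i]]_d :=
  (expR (- t * enorm xi ^+ 2))%:C *: v0 xi +
  (c0 d)%:C *: Cintegral lebesgue_measure `]0, t[ (fun s : R =>
    (expR (- s * enorm xi ^+ 2) * enorm xi)%:C *:
    Cintegral (lebesgue_rV d) setT (fun eta =>
      odot xi (v eta (t - s)) (v (xi - eta) (t - s)))).

Definition FNS_solution d (v0 : 'rV[R]_d -> 'rV[R[i]]_d) (T : \bar R)
    (v : 'rV[R]_d -> R -> 'rV[R[i]]_d) :=
  ae_xt T (fun xi t => v xi t = FNS_rhs v0 v xi t).

End spaces.

(* Main.v *)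
Require Import Defs.
From mathcomp Require Import all_boot all_order all_algebra.
From mathcomp Require Import all_classical all_reals all_analysis.
From mathcomp Require Import ess_sup_inf measurable_realfun complex.
From mathcomp Require Import ring lra.
Set Implicit Arguments.
Unset Strict Implicit.
Unset Printing Implicit Defensive.
Import Order.TTheory GRing.Theory Num.Theory.
Import numFieldNormedType.Exports.
Local Open Scope classical_set_scope.
Local Open Scope ring_scope.
Import ComplexField.Normc.

(** The bilinear form satisfies [|a odot b| <= |a| |b| / 2], so that for fields
    bounded by [M h] (after multiplication by [c0]) the integral term is at most
    [M ^ 2 / 2 * (1 - p) * h], where [p = exp (- t |xi| ^ 2)]: this is where
    [h * h = |xi| h] enters, cancelling the time integral of
    [|xi| ^ 2 exp (- s |xi| ^ 2)].  Hence [2 p h + 2 (1 - p) h = 2 h], and the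
    ball of radius 2 is preserved.  On that ball the right-hand side is only
    Lipschitz with constant 2, so no contraction argument applies.  Instead the
    Picard iterates, started from 0, are dominated by the scalar iterates
    [majorant n] of the same equation with data [2 h] and with [|xi| / 2] times
    the convolution square as nonlinearity.  The scalar iterates increase and
    stay below [2 h]; the increments of the Picard iterates are bounded by those
    of the scalar ones ([rhs_diff], [picard_step]), so they are summable.  Their
    limit solves the equation because, by monotone convergence, the limit of the
    scalar iterates is a fixed point ([majorant_lim_fixed], [picard_lim_fixed]).
    The limit inherits every bound [Y] that is a supersolution of the scalar
    equation ([picard_supersolution]).

    The decay is such a bound.  For the exponent [k = 0] the supersolution [2 h]
    tolerates data up to [2 h]; for [k = 1] a supersolution
    [A exp (- |xi| sqrt t) h] tolerates data up to [2 h / (8 exp (3 / 4))].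
    The geometric mean of the two with weights [1 - k] and [k] is, by the
    weighted arithmetic-geometric inequality, a supersolution for data up to
    [2 h / mu] ([decay_supersolution]); shrinking the data by a factor
    [lam = mu a / 2 <= 1] shrinks it by [lam].  This gives the decay with the
    amplitude [mu a], which is at most twice [mu a / (2 - mu a)].

    For uniqueness put [lam = M / 2 < 1], where [M] bounds the data and a given
    solution.  Expanding both the solution and the [n]-th iterate in powers of
    the data, they differ only in terms with at least [n + 1] factors, each of
    which gains a power of [lam] over the case [M = 2].  The analytic form of
    this count is that the two differ by at most
    [lam ^ (n + 1) * (2 h - majorant n)], which is propagated by the same
    difference estimate ([picard_lim_unique]).

    Membership in the majorization space requires [h] to be locally integrable:
    integrating the identity [h * h = |xi| h] over a bounded set on which the
    right-hand side is bounded shows that [h] times a smoothed indicator of that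
    set is integrable, and the smoothed indicator is bounded below on bounded
    sets ([kernel_integrable_box]). *)

(** * Euclidean norms and the bilinear form *)

Section euclidean.
Context {R : realType} {I : finType}.
Implicit Types f g : I -> R.

Definition norm2 f := Num.sqrt (\sum_i f i ^+ 2).

Lemma norm2_ge0 f : 0 <= norm2 f. Proof. exact: sqrtr_ge0. Qed.

Lemma sumsq_ge0 f : 0 <= \sum_i f i ^+ 2.
Proof. by apply: sumr_ge0 => i _; exact: sqr_ge0. Qed.

Lemma norm2_sqr f : norm2 f ^+ 2 = \sum_i f i ^+ 2.
Proof. by rewrite sqr_sqrtr// sumsq_ge0. Qed.

Lemma norm2_eq0 f : norm2 f = 0 -> forall i, f i = 0.
Proof.
move=> f0 i; apply/eqP; rewrite -sqrf_eq0; move/eqP: f0.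
rewrite -sqrf_eq0 norm2_sqr psumr_eq0 => [/allP|j _]; last exact: sqr_ge0.
by move=> /(_ i); rewrite mem_index_enum => /(_ isT).
Qed.

Lemma cauchy_schwarz f g : \sum_i f i * g i <= norm2 f * norm2 g.
Proof.
have [f0|f0] := eqVneq (norm2 f) 0.
  by rewrite f0 mul0r big1// => i _; rewrite (norm2_eq0 f0) mul0r.
have [g0|g0] := eqVneq (norm2 g) 0.
  by rewrite g0 mulr0 big1// => i _; rewrite (norm2_eq0 g0) mulr0.
have fp : 0 < norm2 f by rewrite lt_neqAle eq_sym f0 norm2_ge0.
have gp : 0 < norm2 g by rewrite lt_neqAle eq_sym g0 norm2_ge0.
have : 0 <= \sum_i (norm2 g * f i - norm2 f * g i) ^+ 2 by exact: sumsq_ge0.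
have -> : \sum_i (norm2 g * f i - norm2 f * g i) ^+ 2 =
    norm2 g ^+ 2 * (\sum_i f i ^+ 2) + norm2 f ^+ 2 * (\sum_i g i ^+ 2)
    - (2 * norm2 f * norm2 g) * (\sum_i f i * g i).
  by rewrite !mulr_sumr -big_split/= -sumrB; apply: eq_bigr => i _; ring.
rewrite -!norm2_sqr => h.
have {h} : 0 <= (2 * (norm2 f * norm2 g)) * (norm2 f * norm2 g - \sum_i f i * g i).
  by apply: le_trans h _; rewrite le_eqVlt; apply/orP; left; apply/eqP; ring.
by rewrite pmulr_rge0 ?subr_ge0// mulr_gt0// mulr_gt0.
Qed.

Lemma le_norm2 f g : (forall i, 0 <= f i <= g i) -> norm2 f <= norm2 g.
Proof.
move=> fg; rewrite ler_wsqrtr// ler_sum// => i _.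
by have /andP[f0 fgi] := fg i; rewrite ler_pXn2r ?nnegrE// (le_trans f0).
Qed.

Lemma norm2D f g : norm2 (fun i => f i + g i) <= norm2 f + norm2 g.
Proof.
rewrite -(@ler_pXn2r _ 2)// ?nnegrE ?addr_ge0 ?norm2_ge0//.
rewrite sqrrD norm2_sqr.
have -> : \sum_i (f i + g i) ^+ 2 =
    \sum_i f i ^+ 2 + (\sum_i f i * g i) *+ 2 + \sum_i g i ^+ 2.
  by rewrite -sumrMnl -!big_split/=; apply: eq_bigr => i _; ring.
by rewrite !norm2_sqr lerD2r lerD2l lerMn2r cauchy_schwarz orbT.
Qed.

Lemma norm2Z (c : R) f : norm2 (fun i => c * f i) = `|c| * norm2 f.
Proof.
rewrite /norm2; under eq_bigr do rewrite exprMn.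
by rewrite -mulr_sumr sqrtrM ?sqr_ge0// sqrtr_sqr.
Qed.

Lemma eq_norm2 f g : f =1 g -> norm2 f = norm2 g.
Proof. by move=> fg; congr Num.sqrt; apply: eq_bigr => i _; rewrite fg. Qed.

Lemma ler_norm2 f i : `|f i| <= norm2 f.
Proof.
rewrite -sqrtr_sqr ler_wsqrtr// (bigD1 i)//= lerDl.
by apply: sumr_ge0 => j _; exact: sqr_ge0.
Qed.

End euclidean.

(* Rearrangements over abstract structures: rewriting with the same identities on
   complex vectors would unfold the arithmetic of complex numbers. *)
Lemma add_regroup (V : zmodType) (p q r s : V) :
  (p + q) + (r + s) - s = r + q + p.
Proof. by rewrite addrA addrK addrC (addrC p) addrA. Qed.

Lemma sub_split (V : zmodType) (p q r : V) : p - r = (p - q) + (q - r).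
Proof. by rewrite addrA subrK. Qed.

Lemma scale_regroup (K : nzRingType) (V : lmodType K) (k l m : K) (p q r : V) :
  m *: (p + q) + (k + l) *: r = m *: p + k *: r + (m *: q + l *: r).
Proof. by rewrite scalerDr scalerDl addrACA. Qed.

Lemma sub_scale_regroup (K : nzRingType) (V : lmodType K) (k l : K) (p q r : V) :
  p + q - (k + l) *: r = p - k *: r + (q - l *: r).
Proof. by rewrite scalerDl opprD addrACA. Qed.

Section vectors.
Context {R : realType} {d : nat}.
Implicit Types (x y xi : 'rV[R]_d) (a b : 'rV[R[i]]_d).
Local Open Scope complex_scope.

Lemma enormE x : enorm x = norm2 (fun j => x ord0 j). Proof. by []. Qed.

Lemma enorm_ge0 x : 0 <= enorm x. Proof. exact: norm2_ge0. Qed.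

Lemma enorm_sqr x : enorm x ^+ 2 = \sum_j x ord0 j ^+ 2.
Proof. exact: norm2_sqr. Qed.

Lemma enorm0 : enorm (0 : 'rV[R]_d) = 0.
Proof. by rewrite /enorm big1 ?sqrtr0// => j _; rewrite mxE expr0n. Qed.

Lemma enorm_eq0 x : (enorm x == 0) = (x == 0).
Proof.
apply/eqP/eqP => [x0|->]; last exact: enorm0.
by apply/rowP => j; rewrite mxE; exact: (norm2_eq0 x0).
Qed.

Lemma enorm_split x y : enorm x <= enorm y + enorm (x - y).
Proof.
rewrite !enormE; apply: le_trans (norm2D _ _); rewrite le_eqVlt; apply/orP.
by left; apply/eqP/eq_norm2 => j; rewrite !mxE; ring.
Qed.

Lemma normc_ge0 (z : R[i]) : 0 <= normc z.
Proof. by case: z => u v; exact: sqrtr_ge0. Qed.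

Lemma normc_sqr (z : R[i]) :
  normc z ^+ 2 = complex.Re z ^+ 2 + complex.Im z ^+ 2.
Proof. by case: z => u v; rewrite /normc sqr_sqrtr// addr_ge0 ?sqr_ge0. Qed.

Lemma cnormE a : cnorm a = norm2 (fun j => normc (a ord0 j)).
Proof. by congr Num.sqrt; apply: eq_bigr => j _; rewrite normc_sqr. Qed.

Lemma cnorm_ge0 a : 0 <= cnorm a. Proof. exact: sqrtr_ge0. Qed.

Lemma cnorm_sqr a : cnorm a ^+ 2 = \sum_j complex.Re (a ord0 j) ^+ 2 +
  \sum_j complex.Im (a ord0 j) ^+ 2.
Proof.
rewrite -big_split/= sqr_sqrtr//.
by apply: sumr_ge0 => j _; rewrite addr_ge0// sqr_ge0.
Qed.

Lemma cnorm0 : cnorm (0 : 'rV[R[i]]_d) = 0.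
Proof. by rewrite /cnorm big1 ?sqrtr0// => j _; rewrite mxE/= expr0n addr0. Qed.

Lemma cnorm_eq0 a : cnorm a = 0 -> a = 0.
Proof.
rewrite cnormE => a0; apply/rowP => j; rewrite mxE.
by apply: eq0_normc; exact: (norm2_eq0 a0).
Qed.

Lemma cnormD a b : cnorm (a + b) <= cnorm a + cnorm b.
Proof.
rewrite !cnormE; apply: le_trans (norm2D _ _); apply: le_norm2 => j.
by rewrite normc_ge0 mxE le_normcD.
Qed.

Lemma cnormZ (z : R[i]) a : cnorm (z *: a) = normc z * cnorm a.
Proof.
rewrite !cnormE -[X in X * _]ger0_norm ?normc_ge0// -norm2Z.
by apply: eq_norm2 => j; rewrite mxE normcM.
Qed.

Lemma normcR (r : R) : normc r%:C = `|r|.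
Proof. by rewrite /= expr0n/= addr0 sqrtr_sqr. Qed.

Lemma cnormZR (r : R) a : 0 <= r -> cnorm (r%:C *: a) = r * cnorm a.
Proof. by move=> r0; rewrite cnormZ normcR ger0_norm. Qed.

Lemma cnormN a : cnorm (- a) = cnorm a.
Proof.
by rewrite -scaleN1r cnormZ -(rmorphN1 (@real_complex R)) normcR normrN1 mul1r.
Qed.

Lemma cnormB a b : cnorm (a - b) = cnorm (b - a).
Proof. by rewrite -opprB cnormN. Qed.

Lemma cnorm_triangle b a c : cnorm (a - c) <= cnorm (a - b) + cnorm (b - c).
Proof. by rewrite (sub_split a b c) cnormD. Qed.

Lemma cnorm_triangle_common b a c : cnorm (a - c) <= cnorm (a - b) + cnorm (c - b).
Proof. by rewrite (cnormB c b) cnorm_triangle. Qed.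

Lemma ler_Re_cnorm a j : `|complex.Re (a ord0 j)| <= cnorm a.
Proof.
rewrite cnormE; apply: le_trans (ler_norm2 _ j).
rewrite (ger0_norm (normc_ge0 _)).
by rewrite -(@ler_pXn2r _ 2)// ?nnegrE ?normc_ge0// normc_sqr real_normK ?num_real// lerDl sqr_ge0.
Qed.

Lemma ler_Im_cnorm a j : `|complex.Im (a ord0 j)| <= cnorm a.
Proof.
rewrite cnormE; apply: le_trans (ler_norm2 _ j).
rewrite (ger0_norm (normc_ge0 _)).
by rewrite -(@ler_pXn2r _ 2)// ?nnegrE ?normc_ge0// normc_sqr real_normK ?num_real// lerDr sqr_ge0.
Qed.

Lemma ReM_real (r : R) (z : R[i]) : complex.Re (r%:C * z) = r * complex.Re z.
Proof. by case: z => u v /=; rewrite mul0r subr0. Qed.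

Lemma ImM_real (r : R) (z : R[i]) : complex.Im (r%:C * z) = r * complex.Im z.
Proof. by case: z => u v /=; rewrite mul0r addr0. Qed.

Lemma Re_sum I (s : seq I) (F : I -> R[i]) :
  complex.Re (\sum_(j <- s) F j) = \sum_(j <- s) complex.Re (F j).
Proof. by elim/big_rec2: _ => //= j x [u v] _ <-; case: (F j). Qed.

Lemma Im_sum I (s : seq I) (F : I -> R[i]) :
  complex.Im (\sum_(j <- s) F j) = \sum_(j <- s) complex.Im (F j).
Proof. by elim/big_rec2: _ => //= j x [u v] _ <-; case: (F j). Qed.

Lemma sum_dir_sqr xi : \sum_j dir xi ord0 j ^+ 2 <= 1.
Proof.
under eq_bigr do rewrite mxE exprMn.
rewrite -mulr_sumr -enorm_sqr; have [->|x0] := eqVneq xi 0.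
  by rewrite enorm0 expr0n mulr0.
by rewrite -exprMn mulVf ?enorm_eq0// expr1n.
Qed.

(** Stated for [|e| <= 1] to include the zero frequency, whose direction is the
    zero vector. *)
Lemma bessel_real (e u : 'I_d -> R) : \sum_j e j ^+ 2 <= 1 ->
  (\sum_j e j * u j) ^+ 2 + \sum_j (u j - (\sum_j e j * u j) * e j) ^+ 2
  <= \sum_j u j ^+ 2.
Proof.
move=> e1.
have expand s : \sum_j (u j - s * e j) ^+ 2 =
    \sum_j u j ^+ 2 - (2 * s) * (\sum_j e j * u j) + s ^+ 2 * \sum_j e j ^+ 2.
  by rewrite !mulr_sumr -sumrB -big_split/=; apply: eq_bigr => j _; ring.
rewrite expand; set s := \sum_j e j * u j.
by have := sqr_ge0 s; nra.
Qed.

Lemma cdot_proj_perp_sqr xi a :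
  normc (cdot (dir xi) a) ^+ 2 + cnorm (proj_perp xi a) ^+ 2 <= cnorm a ^+ 2.
Proof.
rewrite !cnorm_sqr normc_sqr /cdot Re_sum Im_sum.
have br := bessel_real (fun j => complex.Re (a ord0 j)) (sum_dir_sqr xi).
have bi := bessel_real (fun j => complex.Im (a ord0 j)) (sum_dir_sqr xi).
rewrite addrACA; apply: le_trans (lerD br bi).
rewrite le_eqVlt; apply/orP; left; apply/eqP; congr (_ + _ + (_ + _)).
- by congr (_ ^+ 2); apply: eq_bigr => j _; rewrite ReM_real.
- apply: eq_bigr => j _; rewrite !mxE raddfB/= -/(cdot _ _).
  rewrite mulrC ReM_real /cdot Re_sum mulrC; congr ((_ - _ * _) ^+ 2).
  by apply: eq_bigr => k _; rewrite ReM_real mxE.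
- by congr (_ ^+ 2); apply: eq_bigr => j _; rewrite ImM_real.
- apply: eq_bigr => j _; rewrite !mxE raddfB/= -/(cdot _ _).
  rewrite mulrC ImM_real /cdot Im_sum mulrC; congr ((_ - _ * _) ^+ 2).
  by apply: eq_bigr => k _; rewrite ImM_real mxE.
Qed.

(** Cauchy-Schwarz for the splittings of [a] and [b] into longitudinal and
    transversal parts, whose squared norms add up. *)
Lemma cnorm_odot xi a b : cnorm (odot xi a b) <= 2^-1 * (cnorm a * cnorm b).
Proof.
rewrite /odot cnormZ.
have -> : normc (- 'i / 2%:R : R[i]) = 2^-1.
  rewrite normcM normcV -(rmorph_nat (@real_complex R)) normcR/=.
  by rewrite oppr0 expr0n/= sqrrN expr1n add0r sqrtr1 mul1r ger0_norm.
rewrite ler_pM2l ?invr_gt0//; apply: le_trans (cnormD _ _) _.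
rewrite !cnormZ.
have := cdot_proj_perp_sqr xi a; have := cdot_proj_perp_sqr xi b.
move: (normc_ge0 (cdot (dir xi) a)) (normc_ge0 (cdot (dir xi) b)).
move: (cnorm_ge0 a) (cnorm_ge0 b).
move: (cnorm_ge0 (proj_perp xi a)) (cnorm_ge0 (proj_perp xi b)).
move: (normc (cdot (dir xi) a)) (normc (cdot (dir xi) b)).
move: (cnorm a) (cnorm b) (cnorm (proj_perp xi a)) (cnorm (proj_perp xi b)).
move=> A B p q s t p0 q0 A0 B0 s0 t0 hB hA.
rewrite -(@ler_pXn2r _ 2)// ?nnegrE ?addr_ge0 ?mulr_ge0//.
rewrite exprMn; apply: (@le_trans _ _ ((s ^+ 2 + p ^+ 2) * (t ^+ 2 + q ^+ 2))).
  by have := sqr_ge0 (s * t - p * q); nra.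
by apply: ler_pM => //; rewrite addr_ge0 ?sqr_ge0.
Qed.

Lemma cdotD (e : 'rV[R]_d) a b : cdot e (a + b) = cdot e a + cdot e b.
Proof. by rewrite /cdot -big_split/=; apply: eq_bigr => j _; rewrite mxE mulrDr. Qed.

Lemma cdot0 (e : 'rV[R]_d) : cdot e 0 = 0.
Proof. by rewrite /cdot big1// => j _; rewrite mxE mulr0. Qed.

Lemma odot0 xi : odot xi 0 0 = 0.
Proof. by rewrite /odot cdot0 !scale0r addr0 scaler0. Qed.

Lemma proj_perpD xi a b : proj_perp xi (a + b) = proj_perp xi a + proj_perp xi b.
Proof. by rewrite /proj_perp cdotD; exact: sub_scale_regroup. Qed.

Lemma odotDl xi a b c : odot xi (a + b) c = odot xi a c + odot xi b c.
Proof.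
rewrite /odot -scalerDr proj_perpD cdotD; congr (_ *: _).
exact: scale_regroup.
Qed.

Lemma odotC xi a b : odot xi a b = odot xi b a.
Proof. by rewrite /odot addrC. Qed.

Lemma odotDr xi a b c : odot xi a (b + c) = odot xi a b + odot xi a c.
Proof. by rewrite odotC odotDl !(odotC xi a). Qed.

Lemma odot_square_diff xi a1 a2 b1 b2 :
  odot xi a1 a2 - odot xi b1 b2 =
  odot xi b1 (a2 - b2) + odot xi (a1 - b1) b2 + odot xi (a1 - b1) (a2 - b2).
Proof.
rewrite -{1}(subrK b1 a1) -{1}(subrK b2 a2).
move: (a1 - b1) (a2 - b2) => u1 u2.
rewrite (odotDl xi u1 b1) (odotDr xi u1 u2) (odotDr xi b1 u2).
exact: add_regroup.
Qed.

(** Only [b1], [b2] and the differences occur on the right: in a comparison of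
    two fields, one is measured by its size and the other by its distance to
    the first. *)
Lemma cnorm_odot_diff xi a1 a2 b1 b2 :
  cnorm (odot xi a1 a2 - odot xi b1 b2) <=
  2^-1 * (cnorm b1 * cnorm (a2 - b2) + cnorm (a1 - b1) * cnorm b2 +
          cnorm (a1 - b1) * cnorm (a2 - b2)).
Proof.
rewrite odot_square_diff !mulrDr.
by apply: le_trans (cnormD _ _) (lerD (le_trans (cnormD _ _) (lerD _ _)) _);
  exact: cnorm_odot.
Qed.

End vectors.

(** * Lebesgue measure on row vectors *)

Section lebesgue_geometry.
Context {R : realType}.

Lemma measurable_subC (c : R) : 
  measurable_fun setT ((fun x => c - x) : measurableTypeR R -> measurableTypeR R).
Proof. exact: measurable_funB. Qed.

Lemma lebesgue_measure_subC (c : R) (A : set R) : measurable A ->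
  lebesgue_measure ((fun x => c - x) @^-1` A) = lebesgue_measure A.
Proof.
move=> mA; 
apply/esym; apply: (@lebesgue_measure_unique R
  (measure_function_pushforward__canonical__measure_function_Measure
    lebesgue_measure (measurable_subC c))) => // _ [[a b]] _ <-.
rewrite /= /pushforward.
have -> : (fun x => c - x) @^-1` `]a, b] = `[c - b, c - a[%classic.
  by apply/seteqP; split => x /=; rewrite !in_itv/=; lra.
rewrite !lebesgue_measure_itv/= !lte_fin ltrD2l ltrN2; case: ifP => // _.
by rewrite -!EFinB; congr (_%:E); ring.
Qed.

Context {n : nat}.
Local Notation X := ('rV[R]_n).

Lemma measurable_rVB d (T : measurableType d) (f g : T -> X) :
  measurable_fun setT f -> measurable_fun setT g ->
  measurable_fun setT (fun t => f t - g t).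
Proof.
move=> /measurable_fun_coordP mf /measurable_fun_coordP mg.
apply/measurable_fun_coordP => i; under eq_fun do rewrite !mxE.
by apply: measurable_funB; [exact: mf|exact: mg].
Qed.

Lemma measurable_rV_subC (c : X) : measurable_fun setT (fun x : X => c - x).
Proof. by apply: measurable_rVB; [exact: measurable_cst|exact: measurable_id]. Qed.

Lemma measurable_enorm : measurable_fun setT (@enorm R n).
Proof.
apply: (measurableT_comp (continuous_measurable_fun (@sqrt_continuous R))).
apply: measurable_sum => i; apply: measurable_funX; exact: measurable_coord.
Qed.

Lemma measurable_rV1 (x : X) : measurable [set x].
Proof.
rewrite (_ : [set x] = \bigcap_(i in [set: 'I_n])
    ((fun y : X => y ord0 i) @^-1` [set x ord0 i])).
  apply: fin_bigcap_measurable => // i _.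
  by rewrite -[X in measurable X]setTI; apply: measurable_coord.
apply/seteqP; split => [_ -> //|y yx /=].
by apply/rowP => i; exact: yx.
Qed.

End lebesgue_geometry.

(** Induction on the dimension: a reflection acts coordinatewise, so it
    preserves the measure of rectangles, which determine the product measure. *)
Lemma lebesgue_rV_subC {R : realType} n (c : 'rV[R]_n) (A : set 'rV[R]_n) :
  measurable A ->
  lebesgue_rV n ((fun x => c - x) @^-1` A) = lebesgue_rV n A.
Proof.
elim: n c A => [|n IH] c A mA.
  congr (_ _); apply/seteqP; split => x /=; rewrite !(thinmx0 x) !(thinmx0 (_ - _))//.
rewrite -[LHS]/((lebesgue_measure \x lebesgue_rV n)%E
  (cons_rV @^-1` ((fun x => c - x) @^-1` A))).
rewrite -[RHS]/((lebesgue_measure \x lebesgue_rV n)%E (cons_rV @^-1` A)).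
pose c' : 'rV[R]_n := \row_j c ord0 (lift ord0 j).
pose phi (p : measurableTypeR R * 'rV[R]_n) : measurableTypeR R * 'rV[R]_n :=
  (c ord0 ord0 - p.1, c' - p.2).
have mphi : measurable_fun setT phi.
  apply/measurable_fun_pairP; split => /=.
    exact: (measurableT_comp (measurable_subC _) measurable_fst).
  by apply: measurable_rVB => //; exact: measurable_cst.
have -> : cons_rV @^-1` ((fun x => c - x) @^-1` A) = phi @^-1` (cons_rV @^-1` A).
  apply/funext => p; rewrite /preimage/=; congr (A _).
  apply/rowP => i.
  transitivity (c ord0 i - cons_rV p ord0 i); first by rewrite !mxE.
  have [j ->|->] := unliftP ord0 i.
    by rewrite 2!cons_rVS !mxE.
  by rewrite !cons_rV0.
have mB : measurable (cons_rV @^-1` A).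
  by rewrite -[X in measurable X]setTI; exact: measurable_cons_rV.
apply/esym; apply: (product_measure_unique
  (m' := measure_function_pushforward__canonical__measure_function_Measure
    (lebesgue_measure \x lebesgue_rV n)%E mphi)) => // B C mB' mC.
rewrite /= /pushforward.
rewrite (_ : phi @^-1` (B `*` C) =
  ((fun x => c ord0 ord0 - x) @^-1` B) `*` ((fun x => c' - x) @^-1` C))//.
have mB1 : measurable ((fun x : measurableTypeR R => c ord0 ord0 - x) @^-1` B).
  by rewrite -[X in measurable X]setTI; exact: measurable_subC.
have mC1 : measurable ((fun x : 'rV[R]_n => c' - x) @^-1` C).
  rewrite -[X in measurable X]setTI; exact: measurable_rV_subC.
transitivity (lebesgue_measure ((fun x : measurableTypeR R => c ord0 ord0 - x)%R @^-1` B) *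
   lebesgue_rV n ((fun x : 'rV[R]_n => c' - x)%R @^-1` C))%E.
  exact: product_measure1E.
by rewrite IH// lebesgue_measure_subC.
Qed.

Section lebesgue_rV_lemmas.
Context {R : realType} {n : nat}.
Local Notation X := ('rV[R]_n).
Local Notation L := (@lebesgue_rV R n).

Lemma lebesgue_rV1 (x : X) : (0 < n)%N -> L [set x] = 0%E.
Proof.
case: n x => // m x _.
have -> : [set x] = [set y : 'rV[R]_m.+1 | forall i, [set x ord0 i] (y ord0 i)].
  by apply/seteqP; split => [_ -> //|y yx /=]; apply/rowP => i; exact: yx.
have -> := lebesgue_rV_box (A := fun i => [set x ord0 i]) (fun i => measurable_set1 _).
by rewrite big_ord_recl lebesgue_measure_set1 mul0e.
Qed.

Lemma lebesgue_rVT_gt0 : (0 < L setT)%E.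
Proof.
have -> : [set: X] = [set y | forall i, setT (y ord0 i)].
  by apply/seteqP; split.
have -> := lebesgue_rV_box (A := fun=> setT) (fun=> @measurableT _ (measurableTypeR R)).
by elim/big_ind: _ => // [x y x0 y0|i _];
  [exact: mule_gt0|rewrite -set_itvNyy lebesgue_measure_itv/= ltry].
Qed.

Lemma ae_neq0 : (0 < n)%N -> {ae L, forall x, x != 0}.
Proof.
move=> n0; exists [set 0]; split; [exact: measurable_rV1|exact: lebesgue_rV1|].
by move=> x /= /negP; rewrite negbK => /eqP.
Qed.

Lemma ae_subC (c : X) (P : X -> Prop) :
  {ae L, forall x, P x} -> {ae L, forall x, P (c - x)}.
Proof.
move=> [N [mN N0 PN]]; exists ((fun x => c - x) @^-1` N); split.
- rewrite -[X in measurable X]setTI; exact: measurable_rV_subC.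
- by rewrite -[RHS]N0 lebesgue_rV_subC.
- by move=> x /= Px; exact: PN.
Qed.

End lebesgue_rV_lemmas.

Lemma ae_time_subC (R : realType) (c : R) (P : R -> Prop) :
  {ae lebesgue_measure, forall x, P x} ->
  {ae lebesgue_measure, forall x, P (c - x)}.
Proof.
move=> [N [mN N0 PN]]; exists ((fun x => c - x) @^-1` N); split.
- by rewrite -[X in measurable X]setTI; exact: measurable_subC.
- by rewrite lebesgue_measure_subC.
- by move=> x /= Px; exact: PN.
Qed.

Section parametric_integrals.
Context d1 d2 (T1 : measurableType d1) (T2 : measurableType d2) {R : realType}.
Variable m2 : {sigma_finite_measure set T2 -> \bar R}.

Lemma measurable_param_integral (D : T1 -> set T2) (f : T1 * T2 -> \bar R) :
  measurable [set p : T1 * T2 | D p.1 p.2] ->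
  measurable_fun setT f ->
  measurable_fun setT (fun x => \int[m2]_(y in D x) f (x, y))%E.
Proof.
move=> mD mf; pose S := [set p : T1 * T2 | D p.1 p.2].
pose g := f \_ S.
have mg : measurable_fun setT g by apply/(measurable_restrictT _ mD); exact: measurable_funTS.
rewrite (_ : (fun _ => _) = (fun x => \int[m2]_y g^\+ (x, y) - \int[m2]_y g^\- (x, y))%E).
  apply: emeasurable_funB.
    apply: (measurable_fun_fubini_tonelli_F (m2 := m2)) => //.
    exact: measurable_funepos.
  apply: (measurable_fun_fubini_tonelli_F (m2 := m2)) => //.
  exact: measurable_funeneg.
apply/funext => x; rewrite integral_mkcond integralE.
have gE y : ((fun y => f (x, y)) \_ (D x)) y = g (x, y).
  rewrite /g !patchE; have [Dxy|nDxy] := pselect (D x y).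
    by rewrite (mem_set Dxy) (mem_set (Dxy : S (x, y))).
  by rewrite (memNset nDxy) (memNset (nDxy : ~ S (x, y))).
congr (_ - _)%E; apply: eq_integral => y _.
  by rewrite !funeposE gE.
by rewrite !funenegE gE.
Qed.

Lemma measurable_param_Rintegral (D : T1 -> set T2) (f : T1 * T2 -> R) :
  measurable [set p : T1 * T2 | D p.1 p.2] ->
  measurable_fun setT f ->
  measurable_fun setT (fun x => \int[m2]_(y in D x) f (x, y)).
Proof.
move=> mD mf; apply: measurableT_comp; first exact: fine_measurable.
by apply: (measurable_param_integral (f := EFin \o f)) => //; exact/measurable_EFinP.
Qed.

End parametric_integrals.

(** * Measurable and integrable vector fields *)

Section complex_measurability.
Context {R : realType} d0 (T : measurableType d0).
Local Open Scope complex_scope.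

Definition cmeas (f : T -> R[i]) :=
  measurable_fun setT (fun x => complex.Re (f x)) /\
  measurable_fun setT (fun x => complex.Im (f x)).

Lemma cmeas_cst (z : R[i]) : cmeas (fun=> z).
Proof. by split; exact: measurable_cst. Qed.

Lemma cmeas_real (f : T -> R) : measurable_fun setT f -> cmeas (fun x => (f x)%:C).
Proof. by move=> mf; split => //=; exact: measurable_cst. Qed.

Lemma cmeasD f g : cmeas f -> cmeas g -> cmeas (fun x => f x + g x).
Proof.
move=> [mf1 mf2] [mg1 mg2]; split.
  under eq_fun do rewrite raddfD/=; exact: measurable_funD.
under eq_fun do rewrite raddfD/=; exact: measurable_funD.
Qed.

Lemma cmeasB f g : cmeas f -> cmeas g -> cmeas (fun x => f x - g x).
Proof.
move=> [mf1 mf2] [mg1 mg2]; split.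
  under eq_fun do rewrite raddfB/=; exact: measurable_funB.
under eq_fun do rewrite raddfB/=; exact: measurable_funB.
Qed.

Lemma ReM (z w : R[i]) : complex.Re (z * w) =
  complex.Re z * complex.Re w - complex.Im z * complex.Im w.
Proof. by case: z; case: w. Qed.

Lemma ImM (z w : R[i]) : complex.Im (z * w) =
  complex.Re z * complex.Im w + complex.Im z * complex.Re w.
Proof. by case: z; case: w. Qed.

Lemma cmeasM f g : cmeas f -> cmeas g -> cmeas (fun x => f x * g x).
Proof.
move=> [mf1 mf2] [mg1 mg2]; split.
  by under eq_fun do rewrite ReM; apply: measurable_funB; exact: measurable_funM.
by under eq_fun do rewrite ImM; apply: measurable_funD; exact: measurable_funM.
Qed.

Lemma cmeas_sum n (f : 'I_n -> T -> R[i]) : (forall j, cmeas (f j)) ->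
  cmeas (fun x => \sum_j f j x).
Proof.
move=> mf; split.
  by under eq_fun do rewrite Re_sum; apply: measurable_sum => j; case: (mf j).
by under eq_fun do rewrite Im_sum; apply: measurable_sum => j; case: (mf j).
Qed.

Context {d : nat}.
Implicit Types f g : T -> 'rV[R[i]]_d.

Lemma CmeasurableP f :
  Cmeasurable setT f <-> forall j, cmeas (fun x => f x ord0 j).
Proof. by []. Qed.

Lemma CmeasurableD f g : Cmeasurable setT f -> Cmeasurable setT g ->
  Cmeasurable setT (fun x => f x + g x).
Proof.
move=> /CmeasurableP mf /CmeasurableP mg; apply/CmeasurableP => j.
rewrite (_ : (fun x => _) = (fun x => f x ord0 j + g x ord0 j)).
  exact: cmeasD.
by apply/funext => x; rewrite mxE.
Qed.

Lemma CmeasurableB f g : Cmeasurable setT f -> Cmeasurable setT g ->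
  Cmeasurable setT (fun x => f x - g x).
Proof.
move=> /CmeasurableP mf /CmeasurableP mg; apply/CmeasurableP => j.
rewrite (_ : (fun x => _) = (fun x => f x ord0 j - g x ord0 j)).
  exact: cmeasB.
by apply/funext => x; rewrite !mxE.
Qed.

Lemma CmeasurableZ (k : T -> R[i]) f : cmeas k -> Cmeasurable setT f ->
  Cmeasurable setT (fun x => k x *: f x).
Proof.
move=> mk /CmeasurableP mf; apply/CmeasurableP => j.
rewrite (_ : (fun x => _) = (fun x => k x * f x ord0 j)).
  exact: cmeasM.
by apply/funext => x; rewrite mxE.
Qed.

Lemma CmeasurableZR (k : T -> R) f : measurable_fun setT k -> Cmeasurable setT f ->
  Cmeasurable setT (fun x => (k x)%:C *: f x).
Proof. by move=> mk; apply: CmeasurableZ; exact: cmeas_real. Qed.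

Lemma measurable_cnorm (D : set T) f : measurable D ->
  Cmeasurable D f -> measurable_fun D (fun x => cnorm (f x)).
Proof.
move=> mD mf.
apply: (measurableT_comp (continuous_measurable_fun (@sqrt_continuous R))).
apply: measurable_sum => j; have [mre mim] := mf j.
by apply: measurable_funD; exact: measurable_funX.
Qed.

(* The inverse of the norm is written as a real power, whose measurability
   includes the origin. *)
Lemma measurable_dir (xi : T -> 'rV[R]_d) j : measurable_fun setT xi ->
  measurable_fun setT (fun x => dir (xi x) ord0 j).
Proof.
move=> mxi.
rewrite (_ : (fun x => _) =
    (fun x => powR (enorm (xi x)) (-1) * xi x ord0 j)); last first.
  by apply/funext => x; rewrite mxE powR_inv1// enorm_ge0.
apply: measurable_funM; last exact: (measurableT_comp (measurable_coord j)).
apply: (measurableT_comp (measurable_powR (-1))).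
exact: (measurableT_comp measurable_enorm).
Qed.

Lemma cmeas_cdot (xi : T -> 'rV[R]_d) f : measurable_fun setT xi ->
  Cmeasurable setT f -> cmeas (fun x => cdot (dir (xi x)) (f x)).
Proof.
move=> mxi mf; apply: cmeas_sum => j; apply: cmeasM; last exact: mf.
exact/cmeas_real/measurable_dir.
Qed.

Lemma Cmeasurable_proj_perp (xi : T -> 'rV[R]_d) f : measurable_fun setT xi ->
  Cmeasurable setT f -> Cmeasurable setT (fun x => proj_perp (xi x) (f x)).
Proof.
move=> mxi mf; apply: CmeasurableB => //; apply: CmeasurableZ.
  exact: cmeas_cdot.
apply/CmeasurableP => j; under eq_fun do rewrite mxE.
exact/cmeas_real/measurable_dir.
Qed.

Lemma Cmeasurable_odot (xi : T -> 'rV[R]_d) f g : measurable_fun setT xi ->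
  Cmeasurable setT f -> Cmeasurable setT g ->
  Cmeasurable setT (fun x => odot (xi x) (f x) (g x)).
Proof.
move=> mxi mf mg; apply: CmeasurableZ; first exact: cmeas_cst.
apply: CmeasurableD; apply: CmeasurableZ;
  by [exact: cmeas_cdot|exact: Cmeasurable_proj_perp].
Qed.

End complex_measurability.

Lemma Cmeasurable_comp (R : realType) d0 d1 (T : measurableType d0)
    (T' : measurableType d1) (phi : T' -> T) d (f : T -> 'rV[R[i]]_d) :
  measurable_fun setT phi -> Cmeasurable setT f ->
  Cmeasurable setT (fun x => f (phi x)).
Proof.
move=> mphi mf j; have [m1 m2] := mf j.
by split; [exact: (measurableT_comp m1)|exact: (measurableT_comp m2)].
Qed.

(** The comparison [a * int f + b * int g <= b * int k] of nonnegative integrals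
    stands for a bound of [int f] by [int k - int g] that remains meaningful when
    the integrals of [g] and [k] are infinite. *)
Lemma ge0_integral_combination (R : realType) d0 (T : measurableType d0)
    (mu : {measure set T -> \bar R}) (D : set T) (f g k : T -> \bar R) (a b : R) :
  measurable D -> measurable_fun D f -> measurable_fun D g -> measurable_fun D k ->
  (forall x, D x -> 0 <= f x)%E -> (forall x, D x -> 0 <= g x)%E ->
  (forall x, D x -> 0 <= k x)%E -> 0 <= a -> 0 <= b ->
  (forall x, D x -> a%:E * f x + b%:E * g x <= b%:E * k x)%E ->
  (a%:E * \int[mu]_(x in D) f x + b%:E * \int[mu]_(x in D) g x <=
   b%:E * \int[mu]_(x in D) k x)%E.
Proof.
move=> mD mf mg mk f0 g0 k0 a0 b0 fgk.
have mZ (r : R) u : measurable_fun D u -> measurable_fun D (fun x => r%:E * u x)%E.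
  by move=> mu'; apply: emeasurable_funM => //; exact: measurable_cst.
have Z0 (r : R) u : 0 <= r -> (forall x, D x -> 0 <= u x)%E ->
    (forall x, D x -> 0 <= r%:E * u x)%E.
  by move=> r0 u0 x Dx; apply: mule_ge0; [rewrite lee_fin|exact: u0].
rewrite -(ge0_integralZl mu mD mf f0 (a0 : (0 <= a%:E)%E)).
rewrite -(ge0_integralZl mu mD mg g0 (b0 : (0 <= b%:E)%E)).
rewrite -(ge0_integralZl mu mD mk k0 (b0 : (0 <= b%:E)%E)).
rewrite -(ge0_integralD mu mD (Z0 _ _ a0 f0) (mZ _ _ mf) (Z0 _ _ b0 g0) (mZ _ _ mg)).
apply: ge0_le_integral => //; [|by apply: emeasurable_funD; exact: mZ|exact: mZ].
by move=> x Dx; apply: adde_ge0; [exact: Z0 Dx|exact: Z0 Dx].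
Qed.

Section vector_integral.
Context {R : realType} d0 (T : measurableType d0).
Variables (mu : {measure set T -> \bar R}) (D : set T) (mD : measurable D).
Context {d : nat}.
Implicit Types f g : T -> 'rV[R[i]]_d.

Definition Cintegrable f := Cmeasurable D f /\
  (\int[mu]_(x in D) (cnorm (f x))%:E < +oo)%E.

Lemma Rintegral_sum I (s : seq I) (F : I -> T -> R) :
  (forall i, mu.-integrable D (EFin \o F i)) ->
  mu.-integrable D (EFin \o (fun x => \sum_(i <- s) F i x)) /\
  \int[mu]_(x in D) (\sum_(i <- s) F i x) = \sum_(i <- s) \int[mu]_(x in D) F i x.
Proof.
move=> iF; elim: s => [|i s [IHi IHs]].
  under [X in EFin \o X]eq_fun do rewrite big_nil.
  under [X in Rintegral _ _ X]eq_fun do rewrite big_nil.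
  by rewrite big_nil Rintegral_cst// mul0r; split => //; exact: integrable0.
under [X in EFin \o X]eq_fun do rewrite big_cons.
under [X in Rintegral _ _ X]eq_fun do rewrite big_cons.
rewrite big_cons RintegralD// IHs; split => //.
exact: (integrableD mD (iF i) IHi).
Qed.

Lemma integrableZ_EFin (r : R) (u : T -> R) : mu.-integrable D (EFin \o u) ->
  mu.-integrable D (EFin \o (fun x => r * u x)).
Proof.
move=> /(integrableZl mD r); exact: eq_integrable.
Qed.

Lemma Cintegrable_Re f j : Cintegrable f ->
  mu.-integrable D (EFin \o (fun x => complex.Re (f x ord0 j))).
Proof.
move=> [mf foo]; apply: (@le_integrable _ _ _ _ D mD _ (EFin \o (fun x => cnorm (f x)))).
- by apply/measurable_EFinP; case: (mf j).
- move=> x Dx /=; rewrite lee_fin (ger0_norm (cnorm_ge0 _)); exact: ler_Re_cnorm.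
- apply/integrableP; split; first exact/measurable_EFinP/measurable_cnorm.
  by under eq_integral do rewrite /= (ger0_norm (cnorm_ge0 _)).
Qed.

Lemma Cintegrable_Im f j : Cintegrable f ->
  mu.-integrable D (EFin \o (fun x => complex.Im (f x ord0 j))).
Proof.
move=> [mf foo]; apply: (@le_integrable _ _ _ _ D mD _ (EFin \o (fun x => cnorm (f x)))).
- by apply/measurable_EFinP; case: (mf j).
- move=> x Dx /=; rewrite lee_fin (ger0_norm (cnorm_ge0 _)); exact: ler_Im_cnorm.
- apply/integrableP; split; first exact/measurable_EFinP/measurable_cnorm.
  by under eq_integral do rewrite /= (ger0_norm (cnorm_ge0 _)).
Qed.

Lemma CintegralB f g : Cintegrable f -> Cintegrable g ->
  Cintegral mu D (fun x => f x - g x) = Cintegral mu D f - Cintegral mu D g.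
Proof.
move=> fi gi; apply/rowP => j; rewrite !mxE.
have entryB x : (f x - g x) ord0 j = f x ord0 j - g x ord0 j by rewrite !mxE.
under [X in Rintegral _ _ X]eq_fun do rewrite entryB raddfB/=.
rewrite RintegralB//; [|exact: Cintegrable_Re|exact: Cintegrable_Re].
under [X in (_ +i* Rintegral _ _ X)%C]eq_fun do rewrite entryB raddfB/=.
by rewrite RintegralB//; exact: Cintegrable_Im.
Qed.

Lemma cauchy_schwarz_cnorm (a b : 'rV[R[i]]_d) :
  \sum_j (complex.Re (a ord0 j) * complex.Re (b ord0 j) +
          complex.Im (a ord0 j) * complex.Im (b ord0 j)) <= cnorm a * cnorm b.
Proof.
rewrite !cnormE; apply: le_trans (cauchy_schwarz _ _).
apply: ler_sum => j _; apply: le_trans (ler_norm _) _.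
rewrite -(@ler_pXn2r _ 2)// ?nnegrE ?mulr_ge0 ?normc_ge0//.
rewrite exprMn !normc_sqr real_normK ?num_real//.
move: (complex.Re _) (complex.Im _) (complex.Re _) (complex.Im _) => p q r s.
by have := sqr_ge0 (p * s - q * r); nra.
Qed.

(** By duality: the scalar product of the integral with itself is the integral
    of its scalar product with the integrand, to which Cauchy-Schwarz applies. *)
Lemma cnorm_Cintegral f : Cmeasurable D f ->
  ((cnorm (Cintegral mu D f))%:E <= \int[mu]_(x in D) (cnorm (f x))%:E)%E.
Proof.
move=> mf; have [fi|] := ltP (\int[mu]_(x in D) (cnorm (f x))%:E)%E +oo%E; last first.
  by rewrite leye_eq => /eqP ->; rewrite leey.
have If : Cintegrable f by [].
set v := Cintegral mu D f; have int0 : (0 <= \int[mu]_(x in D) (cnorm (f x))%:E)%E.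
  by apply: integral_ge0 => x _; rewrite lee_fin cnorm_ge0.
have [v0|v0] := eqVneq (cnorm v) 0; first by rewrite v0.
have vp : 0 < cnorm v by rewrite lt_neqAle eq_sym v0 cnorm_ge0.
have cnormi : mu.-integrable D (EFin \o (fun x => cnorm (f x))).
  apply/integrableP; split; first exact/measurable_EFinP/measurable_cnorm.
  by under eq_integral do rewrite /= (ger0_norm (cnorm_ge0 _)).
pose F j x := complex.Re (v ord0 j) * complex.Re (f x ord0 j) +
              complex.Im (v ord0 j) * complex.Im (f x ord0 j).
have iF j : mu.-integrable D (EFin \o F j).
  apply: (integrableD mD (f := EFin \o _) (g := EFin \o _)).
    by apply: integrableZ_EFin; exact: Cintegrable_Re.
  by apply: integrableZ_EFin; exact: Cintegrable_Im.
have [iS] := Rintegral_sum (index_enum 'I_d) iF.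
have -> : \sum_(j <- index_enum 'I_d) \int[mu]_(x in D) F j x = cnorm v ^+ 2.
  rewrite cnorm_sqr -big_split/=; apply: eq_bigr => j _.
  rewrite RintegralD//; last 2 first.
  - by apply: integrableZ_EFin; exact: Cintegrable_Re.
  - by apply: integrableZ_EFin; exact: Cintegrable_Im.
  rewrite !RintegralZl//; [|exact: Cintegrable_Im|exact: Cintegrable_Re].
  by rewrite !mxE/= !expr2.
move=> E; have : cnorm v ^+ 2 <= cnorm v * \int[mu]_(x in D) cnorm (f x).
  rewrite -E -RintegralZl//; apply: le_Rintegral => //.
    exact: integrableZ_EFin.
  by move=> x Dx; exact: cauchy_schwarz_cnorm.
rewrite expr2 ler_pM2l// -lee_fin /Rintegral fineK//.
by rewrite ge0_fin_numE.
Qed.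

Lemma eq_Cintegral f g : {in D, f =1 g} -> Cintegral mu D f = Cintegral mu D g.
Proof.
move=> fg; apply/rowP => j; rewrite !mxE.
by congr (_ +i* _)%C; apply: eq_Rintegral => x Dx; rewrite fg.
Qed.

Lemma ae_eq_Cintegral f g : Cmeasurable D f -> Cmeasurable D g ->
  {ae mu, forall x, D x -> f x = g x} -> Cintegral mu D f = Cintegral mu D g.
Proof.
move=> mf mg fg; apply/rowP => j; rewrite !mxE.
congr (_ +i* _)%C; congr fine; apply: ae_eq_integral => //.
- by apply/measurable_EFinP; case: (mf j).
- by apply/measurable_EFinP; case: (mg j).
- by apply: filterS fg => x + Dx => /(_ Dx) ->.
- by apply/measurable_EFinP; case: (mf j).
- by apply/measurable_EFinP; case: (mg j).
- by apply: filterS fg => x + Dx => /(_ Dx) ->.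
Qed.

End vector_integral.

Lemma Cmeasurable_param_integral (R : realType) d1 d2 (T1 : measurableType d1)
    (T2 : measurableType d2) (m2 : {sigma_finite_measure set T2 -> \bar R})
    (D : T1 -> set T2) d (f : T1 * T2 -> 'rV[R[i]]_d) :
  measurable [set p : T1 * T2 | D p.1 p.2] ->
  Cmeasurable setT f ->
  Cmeasurable setT (fun x => Cintegral m2 (D x) (fun y => f (x, y))).
Proof.
move=> mD mf j; have [m1 m2'] := mf j; split.
- under eq_fun do rewrite mxE/=.
  exact: (@measurable_param_Rintegral _ _ _ _ _ _ _ (fun p => complex.Re (f p ord0 j))).
- under eq_fun do rewrite mxE/=.
  exact: (@measurable_param_Rintegral _ _ _ _ _ _ _ (fun p => complex.Im (f p ord0 j))).
Qed.

(** * The integral term and its scalar majorant *)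

Section duhamel.
Context {R : realType} {d : nat}.
Local Notation X := ('rV[R]_d).
Local Notation L := (@lebesgue_rV R d).
Local Notation leb := (@lebesgue_measure R).
Implicit Types (xi eta : X) (s t tau : R) (U W : X -> R -> R).
Implicit Types (v w : X -> R -> 'rV[R[i]]_d).
Local Open Scope complex_scope.

Definition heat xi t : R := expR (- t * enorm xi ^+ 2).
Definition damp xi s : R := heat xi s * enorm xi.

Definition selfconv U xi tau : \bar R :=
  (\int[L]_eta (U eta tau * U (xi - eta) tau)%:E)%E.

(** The scalar counterpart of the integral term of the equation; the factor 1/2 is
    that of the bound on [odot]. *)
Definition interaction U xi t : \bar R :=
  (\int[leb]_(s in `]0%R, t[) ((damp xi s / 2)%:E * selfconv U xi (t - s)))%E.

(* Measurability is required at all times, including the nonpositive ones, at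
   which the time integral is over an empty interval. *)
Definition jmeas U := measurable_fun setT (fun p : X * measurableTypeR R => U p.1 p.2).
Definition jCmeas v := Cmeasurable setT (fun p : X * measurableTypeR R => v p.1 p.2).

Definition inner v xi tau : 'rV[R[i]]_d :=
  Cintegral L setT (fun eta => odot xi (v eta tau) (v (xi - eta) tau)).

Lemma FNS_rhsE (v0 : X -> 'rV[R[i]]_d) v xi t : FNS_rhs v0 v xi t = (heat xi t)%:C *: v0 xi +
  (c0 d)%:C *: Cintegral leb `]0, t[ (fun s =>
     (damp xi s)%:C *: inner v xi (t - s)).
Proof. by []. Qed.

Lemma heat_gt0 xi t : 0 < heat xi t. Proof. exact: expR_gt0. Qed.

Lemma damp_ge0 xi t : 0 <= damp xi t.
Proof. by rewrite mulr_ge0 ?enorm_ge0// ltW// heat_gt0. Qed.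

Lemma damp0 t : damp 0 t = 0. Proof. by rewrite /damp enorm0 mulr0. Qed.

Lemma heat_le1 xi t : 0 <= t -> heat xi t <= 1.
Proof. by move=> t0; rewrite /heat -expR0 ler_expR mulNr oppr_le0 mulr_ge0// sqr_ge0. Qed.

Lemma c0_gt0 : 0 < c0 d :> R.
Proof. by rewrite powR_gt0// mulr_gt0// pi_gt0. Qed.

Lemma measurable_heat : measurable_fun setT (fun p : X * measurableTypeR R => heat p.1 p.2).
Proof.
apply: (measurableT_comp (@measurable_expR R)).
apply: measurable_funM; first exact: (measurable_funN measurable_snd).
by apply: measurable_funX; exact: (measurableT_comp measurable_enorm measurable_fst).
Qed.

Lemma measurable_damp : measurable_fun setT (fun p : X * measurableTypeR R => damp p.1 p.2).
Proof.
apply: measurable_funM; first exact: measurable_heat.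
exact: (measurableT_comp measurable_enorm measurable_fst).
Qed.

Lemma jmeas_comp U d' (T : measurableType d') (x : T -> X) (u : T -> measurableTypeR R) :
  jmeas U -> measurable_fun setT x -> measurable_fun setT u ->
  measurable_fun setT (fun p => U (x p) (u p)).
Proof.
move=> mU mx mu; have mxu : measurable_fun setT (fun p => (x p, u p)).
  exact/measurable_fun_pairP.
exact: (measurableT_comp mU mxu).
Qed.

Lemma jmeas_ecomp (F : X -> R -> \bar R) d' (T : measurableType d')
    (x : T -> X) (u : T -> measurableTypeR R) :
  measurable_fun setT (fun p : X * measurableTypeR R => F p.1 p.2) ->
  measurable_fun setT x -> measurable_fun setT u ->
  measurable_fun setT (fun p => F (x p) (u p)).
Proof.
move=> mU mx mu; have mxu : measurable_fun setT (fun p => (x p, u p)).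
  exact/measurable_fun_pairP.
exact: (measurableT_comp mU mxu).
Qed.

Lemma jCmeas_comp v d' (T : measurableType d') (x : T -> X) (u : T -> measurableTypeR R) :
  jCmeas v -> measurable_fun setT x -> measurable_fun setT u ->
  Cmeasurable setT (fun p => v (x p) (u p)).
Proof.
move=> mv mx mu; apply: (Cmeasurable_comp (phi := fun p => (x p, u p))) mv.
exact/measurable_fun_pairP.
Qed.

Lemma jmeas_selfconv U : jmeas U ->
  measurable_fun setT (fun p : X * measurableTypeR R => selfconv U p.1 p.2).
Proof.
move=> mU; pose f (q : (X * measurableTypeR R) * X) :=
  (U q.2 q.1.2 * U (q.1.1 - q.2) q.1.2)%:E.
apply: (@measurable_param_integral _ _ _ _ _ L (fun=> setT) f).
  by rewrite (_ : [set _ | _] = setT)//; exact/seteqP.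
apply/measurable_EFinP/measurable_funM; apply: (jmeas_comp mU) => //.
- exact: (measurableT_comp measurable_snd measurable_fst).
- apply: measurable_rVB => //.
  exact: (measurableT_comp measurable_fst measurable_fst).
- exact: (measurableT_comp measurable_snd measurable_fst).
Qed.

Lemma jCmeas_inner v : jCmeas v -> jCmeas (inner v).
Proof.
move=> mv; pose f (q : (X * measurableTypeR R) * X) :=
  odot q.1.1 (v q.2 q.1.2) (v (q.1.1 - q.2) q.1.2).
apply: (@Cmeasurable_param_integral _ _ _ _ _ L (fun=> setT) _ f).
  by rewrite (_ : [set _ | _] = setT)//; exact/seteqP.
have m11 : measurable_fun setT (fun q : (X * measurableTypeR R) * X => q.1.1).
  exact: (measurableT_comp measurable_fst measurable_fst).
have m12 : measurable_fun setT (fun q : (X * measurableTypeR R) * X => q.1.2).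
  exact: (measurableT_comp measurable_snd measurable_fst).
apply: Cmeasurable_odot => //; apply: (jCmeas_comp mv) => //.
exact: measurable_rVB.
Qed.

Let during (p : X * measurableTypeR R) : set (measurableTypeR R) :=
  `]0, p.2[%classic.

Let duration_set := [set q : (X * measurableTypeR R) * measurableTypeR R |
  during q.1 q.2].

Let measurable_duration_set : measurable duration_set.
Proof.
have m1 : measurable_fun setT (fun q : (X * measurableTypeR R) * measurableTypeR R => q.1.2).
  exact: (measurableT_comp measurable_snd measurable_fst).
have mS : measurable_fun setT
    (fun q : (X * measurableTypeR R) * measurableTypeR R => (0 < q.2) && (q.2 < q.1.2)).
  by apply: measurable_and; apply: measurable_fun_ltr => //; exact: measurable_cst.
have mt : measurable [set true] by [].
have := mS measurableT [set true] mt.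
by rewrite setTI; congr measurable; apply/seteqP; split => q /=; rewrite in_itv.
Qed.

Let m_lag : measurable_fun setT
  (fun q : (X * measurableTypeR R) * measurableTypeR R => (q.1.2 - q.2 : measurableTypeR R)).
Proof.
apply: measurable_funB => //.
exact: (measurableT_comp measurable_snd measurable_fst).
Qed.

Let m_freq : measurable_fun setT
  (fun q : (X * measurableTypeR R) * measurableTypeR R => q.1.1).
Proof. exact: (measurableT_comp measurable_fst measurable_fst). Qed.

Let m_damp : measurable_fun setT
  (fun q : (X * measurableTypeR R) * measurableTypeR R => damp q.1.1 q.2).
Proof. exact: (jmeas_comp measurable_damp). Qed.

Lemma measurable_interaction U : jmeas U ->
  measurable_fun setT (fun p : X * measurableTypeR R => interaction U p.1 p.2).
Proof.
move=> mU.
pose f (q : (X * measurableTypeR R) * measurableTypeR R) :=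
  ((damp q.1.1 q.2 / 2)%:E * selfconv U q.1.1 (q.1.2 - q.2))%E.
have mf : measurable_fun setT f.
  apply: emeasurable_funM; last exact: (jmeas_ecomp (jmeas_selfconv mU)).
  by apply/measurable_EFinP; apply: measurable_funM => //; exact: measurable_cst.
exact: (measurable_param_integral (D := during)
  lebesgue_measure measurable_duration_set mf).
Qed.

Lemma jCmeas_rhs (v0 : X -> 'rV[R[i]]_d) v :
  Cmeasurable setT v0 -> jCmeas v -> jCmeas (FNS_rhs v0 v).
Proof.
move=> mv0 mv; apply: CmeasurableD.
  apply: CmeasurableZR; first exact: measurable_heat.
  exact: (Cmeasurable_comp measurable_fst mv0).
apply: CmeasurableZ; first exact: cmeas_cst.
pose f (q : (X * measurableTypeR R) * measurableTypeR R) :=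
  (damp q.1.1 q.2)%:C *: inner v q.1.1 (q.1.2 - q.2).
have mf : Cmeasurable setT f.
  by apply: CmeasurableZR => //; exact: (jCmeas_comp (jCmeas_inner mv)).
exact: (Cmeasurable_param_integral (D := during)
  lebesgue_measure measurable_duration_set mf).
Qed.

Lemma measurable_damp1 xi (D : set R) :
  measurable_fun (D : set (measurableTypeR R)) (fun s => damp xi s).
Proof.
by apply: measurable_funTS; apply: (jmeas_comp measurable_damp) => //; exact: measurable_cst.
Qed.

Lemma measurable_lagged_conv U xi t : jmeas U ->
  measurable_fun setT (fun s : measurableTypeR R => selfconv U xi (t - s)).
Proof.
move=> mU; apply: (jmeas_ecomp (jmeas_selfconv mU)); first exact: measurable_cst.
exact: measurable_subC.
Qed.

Lemma measurable_interaction_integrand U xi t (D : set R) : jmeas U ->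
  measurable_fun (D : set (measurableTypeR R))
    (fun s => ((damp xi s / 2)%:E * selfconv U xi (t - s))%E).
Proof.
move=> mU; apply: emeasurable_funM.
  by apply/measurable_EFinP/measurable_funM; [exact: measurable_damp1|exact: measurable_cst].
apply: measurable_funTS; exact: measurable_lagged_conv.
Qed.

Lemma interaction_at0 U t : interaction U 0 t = 0%E.
Proof. by rewrite /interaction integral0_eq// => s _; rewrite damp0 mul0r mul0e. Qed.

Lemma selfconv_ge0 U xi tau : (forall eta, 0 <= U eta tau) -> (0 <= selfconv U xi tau)%E.
Proof. by move=> U0; apply: integral_ge0 => eta _; rewrite lee_fin mulr_ge0. Qed.

Lemma in_lag s t : `]0, t[%classic s -> 0 < t - s < t.
Proof. by rewrite /= in_itv/=; lra. Qed.

Lemma interaction_ge0 U xi t : (forall eta tau, 0 < tau < t -> 0 <= U eta tau) ->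
  (0 <= interaction U xi t)%E.
Proof.
move=> U0; apply: integral_ge0 => s /in_lag st.
apply: mule_ge0; first by rewrite lee_fin divr_ge0// damp_ge0.
by apply: selfconv_ge0 => eta; exact: U0.
Qed.

Lemma measurable_conv_integrand U xi tau : jmeas U ->
  measurable_fun setT (fun eta => U eta tau * U (xi - eta) tau).
Proof.
move=> mU; apply: measurable_funM; apply: (jmeas_comp mU);
  by [exact: measurable_cst|exact: measurable_rV_subC|exact: measurable_id].
Qed.

Lemma interaction_le U W xi t : jmeas U -> jmeas W ->
  (forall eta tau, 0 < tau < t -> 0 <= U eta tau <= W eta tau) ->
  (interaction U xi t <= interaction W xi t)%E.
Proof.
move=> mU mW UW; apply: ge0_le_integral => //=.
- move=> s /in_lag st; apply: mule_ge0; first by rewrite lee_fin divr_ge0// damp_ge0.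
  by apply: selfconv_ge0 => eta; have /andP[] := UW eta _ st.
- exact: measurable_interaction_integrand.
- exact: measurable_interaction_integrand.
move=> s /in_lag st; apply: lee_wpmul2l; first by rewrite lee_fin divr_ge0// damp_ge0.
apply: ge0_le_integral => //.
- move=> eta _; rewrite lee_fin mulr_ge0//; first by have /andP[] := UW eta _ st.
  by have /andP[] := UW (xi - eta) _ st.
- by apply/measurable_EFinP; exact: measurable_conv_integrand.
- by apply/measurable_EFinP; exact: measurable_conv_integrand.
move=> eta _; rewrite lee_fin.
have /andP[? ?] := UW eta _ st; have /andP[? ?] := UW (xi - eta) _ st.
exact: ler_pM.
Qed.

Lemma integral_exp (y t : R) : 0 < t ->
  (\int[leb]_(s in `]0%R, t[) (y * expR (- s * y))%:E = (1 - expR (- t * y))%:E)%E.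
Proof.
move=> t0; have := exponential_prob_itv0c y t0.
rewrite /exponential_prob => E.
transitivity (1 - (expR (- y * t))%:E)%E; last by rewrite mulNr mulrC -mulNr.
rewrite -E [RHS]integral_itv_bndoo; last first.
  by apply/measurable_EFinP/measurable_funTS; exact: measurable_exponential_pdf.
apply: eq_integral => s; rewrite inE/= in_itv/= => /andP[s0 _].
by rewrite exponential_pdfE ?ltW// !mulNr (mulrC s).
Qed.

Lemma conv_scale (H : X -> R) (g : R -> R) xi tau : measurable_fun setT H ->
  (forall eta, 0 <= H eta) ->
  selfconv (fun eta tau => g tau * H eta) xi tau =
  ((g tau ^+ 2)%:E * \int[L]_eta (H eta * H (xi - eta))%:E)%E.
Proof.
move=> mH H0; rewrite /selfconv -ge0_integralZl//.
- by apply: eq_integral => eta _; rewrite -EFinM; congr EFin; ring.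
- apply/measurable_EFinP/measurable_funM => //.
  exact: (measurableT_comp mH (measurable_rV_subC _)).
- by move=> eta _; rewrite lee_fin mulr_ge0.
- by rewrite lee_fin sqr_ge0.
Qed.

End duhamel.

(** * The difference estimate *)

(** The pointwise inequality behind the difference estimate, with
    [a = |w eta|], [a' = |w (xi - eta)|] and [e], [e'] the sizes of [v - w] there.
    It uses [x x' - u u' = u (x' - u') + (x - u) u' + (x - u) (x' - u')]; the last
    product carries [eps ^ 2], which [eps <= lam] turns into [lam * eps]. *)
Lemma quadratic_gain (R : realFieldType) (lam eps c n a a' e e' u u' x x' : R) :
  0 <= eps -> eps <= lam -> 0 <= c -> 0 <= a -> 0 <= a' -> 0 <= e -> 0 <= e' ->
  u <= x -> u' <= x' -> c * a <= lam * u -> c * a' <= lam * u' ->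
  c * e + eps * u <= eps * x -> c * e' + eps * u' <= eps * x' ->
  n <= 2^-1 * (a * e' + e * a' + e * e') ->
  c ^+ 2 * n + lam * eps / 2 * (u * u') <= lam * eps / 2 * (x * x').
Proof.
move=> eps0 el c0 a0 a'0 e0 e'0 ux ux' au au' ex ex' hn.
have xu : 0 <= x - u by rewrite subr_ge0.
have xu' : 0 <= eps * (x' - u') by rewrite mulr_ge0// subr_ge0.
have {}ex : c * e <= eps * (x - u) by rewrite mulrBr lerBrDr.
have {}ex' : c * e' <= eps * (x' - u') by rewrite mulrBr lerBrDr.
have b1 := ler_pM (mulr_ge0 c0 a0) (mulr_ge0 c0 e'0) au ex'.
have b2 := ler_pM (mulr_ge0 c0 e0) (mulr_ge0 c0 a'0) ex au'.
have b3 := ler_pM (mulr_ge0 c0 e0) (mulr_ge0 c0 e'0)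
  (le_trans ex (ler_wpM2r xu el)) ex'.
have b := lerD (lerD b1 b2) b3.
have := ler_wpM2l (sqr_ge0 c) hn.
have : 0 <= (2^-1 : R) by [].
move=> /ler_wpM2l /(_ _ _ b).
set l := 2^-1 * (c * a * _ + _ + _); set r := 2^-1 * (lam * u * _ + _ + _) => lr.
have -> : c ^+ 2 * (2^-1 * (a * e' + e * a' + e * e')) = l by rewrite /l; ring.
move=> h; rewrite -lerBrDr (le_trans h)// (le_trans lr)//.
by rewrite le_eqVlt; apply/orP; left; apply/eqP; rewrite /r; ring.
Qed.

Section difference_estimate.
Context {R : realType} {d : nat}.
Local Notation X := ('rV[R]_d).
Local Notation L := (@lebesgue_rV R d).
Local Notation leb := (@lebesgue_measure R).
Local Open Scope complex_scope.

Implicit Types (xi eta : X) (s t tau : R).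

(** A majorizing kernel extended to the whole space.  With the value 0 at the
    origin, the points excluded from the convolution contribute nothing. *)
Definition conv_kernel (H : X -> R) :=
  [/\ measurable_fun setT H, H 0 = 0, forall xi, 0 <= H xi &
      forall xi, xi != 0 ->
        (\int[L]_eta (H eta * H (xi - eta))%:E = (enorm xi * H xi)%:E)%E].

Variables (H : X -> R) (kH : conv_kernel H).

Let mH : measurable_fun setT H. Proof. by case: kH. Qed.
Let H0 : H 0 = 0. Proof. by case: kH. Qed.
Let H_ge0 xi : 0 <= H xi. Proof. by case: kH. Qed.
Let hconv xi : xi != 0 ->
  (\int[L]_eta (H eta * H (xi - eta))%:E = (enorm xi * H xi)%:E)%E.
Proof. by case: kH => _ _ _; apply. Qed.

Lemma jmeas_kernel (M : R) : jmeas (fun eta _ => M * H eta).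
Proof.
apply: measurable_funM; first exact: measurable_cst.
exact: (measurableT_comp mH measurable_fst).
Qed.

Lemma selfconv_kernel (M : R) xi tau : xi != 0 ->
  selfconv (fun eta _ => M * H eta) xi tau = (M ^+ 2 * (enorm xi * H xi))%:E.
Proof. by move=> xi0; rewrite (conv_scale (fun=> M))// hconv. Qed.

Lemma integral_damp xi (c t : R) : 0 < t -> 0 <= c ->
  (\int[leb]_(s in `]0%R, t[) (c * (damp xi s * enorm xi))%:E =
   (c * (1 - heat xi t))%:E)%E.
Proof.
move=> t0 c0; rewrite EFinM -integral_exp// -ge0_integralZl//.
- by apply: eq_integral => s _; rewrite -EFinM /damp /heat; congr EFin; ring.
- apply/measurable_EFinP/measurable_funM => //.
  apply: (measurableT_comp (@measurable_expR R)); exact: measurable_funM.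
- by move=> s _; rewrite lee_fin mulr_ge0 ?sqr_ge0// ltW// expR_gt0.
Qed.

(** The convolution identity turns the spatial integral into [|xi| * H xi], and
    the remaining time integral is that of an exponential density. *)
Lemma interaction_kernel (M : R) xi t : 0 < t ->
  interaction (fun eta _ => M * H eta) xi t = (M ^+ 2 / 2 * (1 - heat xi t) * H xi)%:E.
Proof.
move=> t0; have [->|xi0] := eqVneq xi 0; first by rewrite interaction_at0 H0 mulr0.
transitivity (\int[leb]_(s in `]0%R, t[)
    (M ^+ 2 / 2 * H xi * (damp xi s * enorm xi))%:E)%E.
  apply: eq_integral => s _; rewrite selfconv_kernel// -EFinM; congr EFin; ring.
rewrite integral_damp//; last by rewrite mulr_ge0// divr_ge0// sqr_ge0.
by congr EFin; ring.
Qed.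

Lemma interaction_kernel_le (U : X -> R -> R) (M : R) xi t : 0 < t -> 0 <= M -> jmeas U ->
  (forall eta tau, 0 < tau < t -> 0 <= U eta tau <= M * H eta) ->
  (interaction U xi t <= (M ^+ 2 / 2 * (1 - heat xi t) * H xi)%:E)%E.
Proof.
move=> t0 M0 mU UM; rewrite -interaction_kernel//.
by apply: interaction_le => //; exact: jmeas_kernel.
Qed.

(* At the zero frequency the spatial integral may diverge, but it is multiplied
   by [damp 0 s = 0]. *)
Lemma FNS_rhs_at0 (v0 : X -> 'rV[R[i]]_d) (u1 u2 : X -> R -> 'rV[R[i]]_d) t :
  FNS_rhs v0 u1 0 t = FNS_rhs v0 u2 0 t.
Proof.
have frozen (u : X -> R -> 'rV[R[i]]_d) :
    (fun s => (damp (0 : X) s)%:C *: inner u 0 (t - s)) = fun=> 0.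
  by apply/funext => s; apply: cnorm_eq0; rewrite cnormZR damp0 ?mul0r.
have frozen_rhs (u : X -> R -> 'rV[R[i]]_d) : FNS_rhs v0 u 0 t =
    (heat (0 : X) t)%:C *: v0 0 + (c0 d)%:C *: Cintegral leb `]0, t[ (fun=> 0).
  by rewrite FNS_rhsE (frozen u).
by transitivity ((heat (0 : X) t)%:C *: v0 0 + (c0 d)%:C *: Cintegral leb `]0, t[ (fun=> 0));
  [exact: frozen_rhs|apply/esym; exact: frozen_rhs].
Qed.

Variables (v w : X -> R -> 'rV[R[i]]_d) (mv : jCmeas v) (mw : jCmeas w).

Lemma Cmeasurable_inner_integrand (u : X -> R -> 'rV[R[i]]_d) xi tau : jCmeas u ->
  Cmeasurable setT (fun eta => odot xi (u eta tau) (u (xi - eta) tau)).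
Proof.
move=> mu; apply: Cmeasurable_odot; first exact: measurable_cst.
  by apply: (jCmeas_comp mu) => //; exact: measurable_cst.
by apply: (jCmeas_comp mu); [exact: measurable_rV_subC|exact: measurable_cst].
Qed.

Lemma cnorm_odot_kernel (u : X -> R -> 'rV[R[i]]_d) (K : R) xi eta tau :
  (forall eta, cnorm (u eta tau) <= K * H eta) ->
  cnorm (odot xi (u eta tau) (u (xi - eta) tau)) <=
  K ^+ 2 / 2 * (H eta * H (xi - eta)).
Proof.
move=> uK; apply: le_trans (cnorm_odot _ _ _) _.
have := ler_pM (cnorm_ge0 _) (cnorm_ge0 _) (uK eta) (uK (xi - eta)).
move: (_ * _) => a; move: (H _) (H _) => p q; nra.
Qed.

Lemma integral_cnorm_odot (u : X -> R -> 'rV[R[i]]_d) (K : R) xi tau : jCmeas u ->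
  xi != 0 -> (forall eta, cnorm (u eta tau) <= K * H eta) ->
  (\int[L]_eta (cnorm (odot xi (u eta tau) (u (xi - eta) tau)))%:E <=
   (K ^+ 2 / 2 * (enorm xi * H xi))%:E)%E.
Proof.
move=> mu xi0 uK; rewrite EFinM -hconv// -ge0_integralZl//; last 3 first.
- apply/measurable_EFinP/measurable_funM => //.
  exact: (measurableT_comp mH (measurable_rV_subC _)).
- by move=> eta _; rewrite lee_fin mulr_ge0.
- by rewrite lee_fin divr_ge0// sqr_ge0.
apply: ge0_le_integral => //.
- by move=> eta _; rewrite lee_fin cnorm_ge0.
- apply/measurable_EFinP; apply: measurable_cnorm => //.
  exact: Cmeasurable_inner_integrand.
- apply/measurable_EFinP; apply: measurable_funM; first exact: measurable_cst.
  by apply: measurable_funM => //; exact: (measurableT_comp mH (measurable_rV_subC _)).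
- by move=> eta _; rewrite lee_fin; exact: cnorm_odot_kernel.
Qed.

Lemma Cintegrable_inner (u : X -> R -> 'rV[R[i]]_d) (K : R) xi tau : jCmeas u ->
  xi != 0 -> (forall eta, cnorm (u eta tau) <= K * H eta) ->
  Cintegrable L setT (fun eta => odot xi (u eta tau) (u (xi - eta) tau)).
Proof.
move=> mu xi0 uK; split; first exact: Cmeasurable_inner_integrand.
by apply: le_lt_trans (ltry _); exact: (integral_cnorm_odot mu xi0 uK).
Qed.

Lemma cnorm_inner (u : X -> R -> 'rV[R[i]]_d) (K : R) xi tau : jCmeas u ->
  xi != 0 -> (forall eta, cnorm (u eta tau) <= K * H eta) ->
  cnorm (inner u xi tau) <= K ^+ 2 / 2 * (enorm xi * H xi).
Proof.
move=> mu xi0 uK; rewrite -lee_fin.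
apply: le_trans (integral_cnorm_odot mu xi0 uK).
by apply: cnorm_Cintegral => //; exact: Cmeasurable_inner_integrand.
Qed.

Lemma Cmeasurable_damped_inner (u : X -> R -> 'rV[R[i]]_d) xi t : jCmeas u ->
  Cmeasurable setT (fun s : measurableTypeR R => (damp xi s)%:C *: inner u xi (t - s)).
Proof.
move=> mu; apply: CmeasurableZR; first exact: measurable_damp1.
apply: (jCmeas_comp (jCmeas_inner mu)); first exact: measurable_cst.
exact: measurable_subC.
Qed.

Lemma Cmeasurable_sub d' (T : measurableType d') (D : set T) (f : T -> 'rV[R[i]]_d) :
  Cmeasurable setT f -> Cmeasurable D f.
Proof. by move=> mf j; have [? ?] := mf j; split; exact: measurable_funTS. Qed.

Lemma Cintegrable_damped_inner (u : X -> R -> 'rV[R[i]]_d) (K : R) xi t : jCmeas u ->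
  xi != 0 -> 0 < t ->
  (forall eta tau, 0 < tau < t -> cnorm (u eta tau) <= K * H eta) ->
  Cintegrable leb `]0, t[ (fun s => (damp xi s)%:C *: inner u xi (t - s)).
Proof.
move=> mu xi0 t0 uK; have mG := Cmeasurable_damped_inner xi t mu.
split; first exact: Cmeasurable_sub.
apply: le_lt_trans (ltry (K ^+ 2 / 2 * H xi * (1 - heat xi t))).
rewrite -integral_damp//; last by rewrite mulr_ge0// divr_ge0// sqr_ge0.
apply: ge0_le_integral => //.
- by move=> s _; rewrite lee_fin cnorm_ge0.
- apply/measurable_EFinP; apply: measurable_funTS.
  exact: (measurable_cnorm measurableT mG).
- apply/measurable_EFinP; apply: measurable_funM; first exact: measurable_cst.
  by apply: measurable_funM; [exact: measurable_damp1|exact: measurable_cst].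
move=> s /in_lag st; rewrite lee_fin cnormZR ?damp_ge0//.
have := cnorm_inner mu xi0 (fun eta => uK eta _ st); have := damp_ge0 xi s.
move: (cnorm _) (damp _ _) => a b b0 h.
by apply: le_trans (ler_wpM2l b0 h) _; rewrite le_eqVlt; apply/orP; left; apply/eqP; ring.
Qed.

Variables (U W : X -> R -> R) (mU : jmeas U) (mW : jmeas W).
Variables (lam eps K t : R) (t0 : 0 < t) (eps0 : 0 <= eps) (epslam : eps <= lam).
Variable (v0 : X -> 'rV[R[i]]_d).
Hypotheses
  (vK : forall eta tau, 0 < tau < t -> cnorm (v eta tau) <= K * H eta)
  (wK : forall eta tau, 0 < tau < t -> cnorm (w eta tau) <= K * H eta)
  (UW : forall eta tau, 0 < tau < t -> 0 <= U eta tau <= W eta tau)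
  (wU : forall eta tau, 0 < tau < t -> c0 d * cnorm (w eta tau) <= lam * U eta tau)
  (vw : forall eta tau, 0 < tau < t ->
     c0 d * cnorm (v eta tau - w eta tau) + eps * U eta tau <= eps * W eta tau).

Let odot_diff xi eta tau : 0 < tau < t ->
  c0 d ^+ 2 * cnorm (odot xi (v eta tau) (v (xi - eta) tau) -
               odot xi (w eta tau) (w (xi - eta) tau)) +
  lam * eps / 2 * (U eta tau * U (xi - eta) tau) <=
  lam * eps / 2 * (W eta tau * W (xi - eta) tau).
Proof.
move=> tt.
have /andP[_ ux] := UW eta tt; have /andP[_ ux'] := UW (xi - eta) tt.
apply: (quadratic_gain eps0 epslam (ltW c0_gt0) (cnorm_ge0 _) (cnorm_ge0 _)
  (cnorm_ge0 _) (cnorm_ge0 _) ux ux' (wU eta tt) (wU (xi - eta) tt)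
  (vw eta tt) (vw (xi - eta) tt)).
exact: cnorm_odot_diff.
Qed.

Let lameps0 : 0 <= lam * eps.
Proof. by rewrite mulr_ge0// (le_trans eps0). Qed.

Let inner_diff xi tau : xi != 0 -> 0 < tau < t ->
  ((c0 d ^+ 2 * cnorm (inner v xi tau - inner w xi tau))%:E +
   (lam * eps / 2)%:E * selfconv U xi tau <= (lam * eps / 2)%:E * selfconv W xi tau)%E.
Proof.
move=> xi0 tt.
have iv := Cintegrable_inner mv xi0 (fun eta => vK eta tt).
have iw := Cintegrable_inner mw xi0 (fun eta => wK eta tt).
rewrite /inner -(CintegralB measurableT iv iw).
set f := fun eta => _ - _.
have mf : Cmeasurable setT f by apply: CmeasurableB; exact: Cmeasurable_inner_integrand.
have mcf := measurable_cnorm measurableT mf.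
have mUU := measurable_conv_integrand xi tau mU.
have mWW := measurable_conv_integrand xi tau mW.
apply: (@le_trans _ _ ((c0 d ^+ 2)%:E * \int[L]_eta (cnorm (f eta))%:E +
   (lam * eps / 2)%:E * selfconv U xi tau)%E).
  rewrite leeD2r// EFinM; apply: lee_wpmul2l; first by rewrite lee_fin sqr_ge0.
  exact: cnorm_Cintegral.
have U0 eta : 0 <= U eta tau by have /andP[] := UW eta tt.
have W0 eta : 0 <= W eta tau by have /andP[+ +] := UW eta tt; exact: le_trans.
apply: ge0_integral_combination => //.
- exact/measurable_EFinP.
- exact/measurable_EFinP.
- exact/measurable_EFinP.
- by move=> eta _; rewrite lee_fin cnorm_ge0.
- by move=> eta _; rewrite lee_fin mulr_ge0.
- by move=> eta _; rewrite lee_fin mulr_ge0.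
- exact: sqr_ge0.
- by rewrite divr_ge0.
by move=> eta _; rewrite -!EFinM -EFinD lee_fin; exact: odot_diff.
Qed.

(** The right-hand side of the equation does to the pair [(v, w)] what the scalar
    equation does to the pair of majorants [(W, U)].  With [lam = eps = 1] this
    propagates the domination of the increments of the Picard iterates; with
    [eps = lam ^+ n.+1] it propagates the smallness used for uniqueness. *)
Lemma rhs_diff xi :
  ((c0 d * cnorm (FNS_rhs v0 v xi t - FNS_rhs v0 w xi t))%:E +
   (lam * eps)%:E * interaction U xi t <= (lam * eps)%:E * interaction W xi t)%E.
Proof.
have [->|xi0] := eqVneq xi 0.
  rewrite (_ : FNS_rhs v0 v 0 t - FNS_rhs v0 w 0 t = 0).
    by rewrite !interaction_at0 !mule0 adde0 cnorm0 mulr0.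
  by apply/eqP; rewrite subr_eq0; apply/eqP; exact: FNS_rhs_at0.
rewrite !FNS_rhsE opprD addrACA subrr add0r -scalerBr cnormZR; last exact/ltW/c0_gt0.
have iv := Cintegrable_damped_inner mv xi0 t0 vK.
have iw := Cintegrable_damped_inner mw xi0 t0 wK.
have mI : measurable (`]0, t[%classic : set (measurableTypeR R)) by [].
rewrite -(CintegralB mI iv iw) mulrA -expr2.
set f := fun s => _ - _.
have mf : Cmeasurable (setT : set (measurableTypeR R)) f.
  by apply: CmeasurableB; exact: Cmeasurable_damped_inner.
have mcf := measurable_cnorm measurableT mf.
apply: (@le_trans _ _ ((c0 d ^+ 2)%:E * (\int[leb]_(s in `]0%R, t[) (cnorm (f s))%:E) +
   (lam * eps)%:E * interaction U xi t)%E).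
  rewrite leeD2r// EFinM; apply: lee_wpmul2l; first by rewrite lee_fin sqr_ge0.
  by apply: cnorm_Cintegral => //; exact: Cmeasurable_sub.
have convU0 s : `]0, t[%classic s -> (0 <= selfconv U xi (t - s))%E.
  by move=> /in_lag st; apply: selfconv_ge0 => eta; have /andP[] := UW eta st.
have convW0 s : `]0, t[%classic s -> (0 <= selfconv W xi (t - s))%E.
  move=> /in_lag st; apply: selfconv_ge0 => eta; have /andP[+ +] := UW eta st.
  exact: le_trans.
have dm0 s : (0 <= (damp xi s / 2)%:E)%E by rewrite lee_fin divr_ge0// damp_ge0.
have mQU := @measurable_interaction_integrand _ _ U xi t `]0, t[%classic mU.
have mQW := @measurable_interaction_integrand _ _ W xi t `]0, t[%classic mW.
have mcf' : measurable_fun (`]0%R, t[%classic : set (measurableTypeR R))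
  (fun s => (cnorm (f s))%:E).
  by apply/measurable_EFinP; exact: measurable_funTS.
apply: ge0_integral_combination => //.
- by move=> s _; rewrite lee_fin cnorm_ge0.
- by move=> s st; apply: mule_ge0; [exact: dm0|exact: convU0].
- by move=> s st; apply: mule_ge0; [exact: dm0|exact: convW0].
- exact: sqr_ge0.
move=> s st; rewrite /f -scalerBr cnormZR ?damp_ge0//.
have tt := in_lag st.
have dp := damp_ge0 xi s.
have /(lee_wpmul2l (_ : 0 <= (damp xi s)%:E)%E) := inner_diff xi0 tt.
rewrite lee_fin => /(_ dp); rewrite ge0_muleDr; last 2 first.
- by rewrite lee_fin mulr_ge0 ?sqr_ge0 ?cnorm_ge0.
- by apply: mule_ge0; [rewrite lee_fin divr_ge0|exact: convU0].
rewrite !muleA -!EFinM.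
rewrite (_ : damp xi s * (c0 d ^+ 2 * cnorm (inner v xi (t - s) - inner w xi (t - s))) =
   c0 d ^+ 2 * (damp xi s * cnorm (inner v xi (t - s) - inner w xi (t - s)))); last by ring.
by rewrite (_ : damp xi s * (lam * eps / 2) = lam * eps * (damp xi s / 2))//; ring.
Qed.

End difference_estimate.

(** * Local integrability of a majorizing kernel *)

Lemma prode_const (R : realType) n (x : R) : (\prod_(i < n) x%:E = (x ^+ n)%:E)%E.
Proof.
elim: n => [|n IH]; first by rewrite big_ord0 expr0.
by rewrite big_ord_recl IH exprS.
Qed.

Section local_integrability.
Context {R : realType} {d : nat}.
Local Notation X := ('rV[R]_d).
Local Notation L := (@lebesgue_rV R d).
Implicit Types (xi eta : X) (n : nat) (M : R).

Definition box M : set X := [set x | forall i, `[- M, M]%classic (x ord0 i)].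

Lemma measurable_box M : measurable (box M).
Proof.
rewrite (_ : box M = \bigcap_(i in [set: 'I_d])
    ((fun y : X => y ord0 i) @^-1` `[- M, M]%classic)).
  apply: fin_bigcap_measurable => // i _.
  by rewrite -[X in measurable X]setTI; apply: measurable_coord.
by apply/seteqP; split => [x xB i _|x xB i]; exact: xB.
Qed.

Lemma lebesgue_rV_set_box M : 0 <= M -> L (box M) = ((M + M) ^+ d)%:E.
Proof.
move=> M0.
have -> := lebesgue_rV_box (A := fun=> `[- M, M]%classic) (fun=> measurable_itv _).
rewrite -prode_const; apply: eq_bigr => i _.
rewrite lebesgue_measure_itv/= lte_fin; case: ltP => h; first by rewrite -EFinB opprK.
by congr EFin; lra.
Qed.

Lemma compact_sub_box (K : set X) : compact K -> exists2 M, 0 <= M & K `<=` box M.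
Proof.
move=> cK.
have bd (i : 'I_d) : exists M, forall x, K x -> `|x ord0 i| <= M.
  have : compact ((fun x : X => x ord0 i) @` K).
    by apply: continuous_compact => //; apply: continuous_subspaceT; exact: coord_continuous.
  move=> /compact_bounded [M [_ hM]]; exists (M + 1) => x Kx.
  by apply: (hM (M + 1)); [rewrite ltrDl|exists x].
have {}bd := choice bd; case: bd => M hM.
exists (\sum_i `|M i|); first exact: sumr_ge0.
move=> x Kx i; rewrite /= in_itv/= -ler_norml.
apply: le_trans (hM i x Kx) _; apply: le_trans (ler_norm _) _.
by rewrite (bigD1 i)//= lerDl sumr_ge0.
Qed.

Variables (H : X -> R) (kH : conv_kernel H) (d0 : (0 < d)%N).
Hypothesis H_gt0 : forall xi, xi != 0 -> 0 < H xi.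

Let mH : measurable_fun setT H. Proof. by case: kH. Qed.
Let H_ge0 xi : 0 <= H xi. Proof. by case: kH. Qed.

Let m_lt (f g : X -> R) : measurable_fun setT f -> measurable_fun setT g ->
  measurable [set x | f x < g x].
Proof.
move=> mf mg; have mt : measurable [set true] by [].
by have := measurable_fun_ltr mf mg measurableT mt; rewrite setTI.
Qed.

Let m_le (f g : X -> R) : measurable_fun setT f -> measurable_fun setT g ->
  measurable [set x | f x <= g x].
Proof.
move=> mf mg; have mt : measurable [set true] by [].
by have := measurable_fun_ler mf mg measurableT mt; rewrite setTI.
Qed.

(* A bounded set on which [|xi| * H xi], that is [H * H], is at most [k]. *)
Let level k : set X := (box 1 `&` [set xi | enorm xi * H xi <= k%:R]) `\` [set 0].

Let m_level k : measurable (level k).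
Proof.
apply: measurableD; last exact: measurable_rV1.
apply: measurableI; first exact: measurable_box.
by apply: m_le => //; apply: measurable_funM => //; exact: measurable_enorm.
Qed.

(* The sets [level k] exhaust the unit box up to the origin, because [H] is
   finite. *)
Let level_gt0 : exists k, (0 < L (level k))%E.
Proof.
apply: contrapT => /forallNP h.
have lev0 k : L.-negligible (level k).
  apply/negligibleP => //; apply/eqP; rewrite eq_le measure_ge0 andbT leNgt.
  exact/negP/h.
have neg : L.-negligible (box 1).
  apply: (@negligibleS _ _ _ _ ([set 0] `|` \bigcup_k level k)); last first.
    apply: negligibleU; last exact: negligible_bigcup.
    by apply/negligibleP; [exact: measurable_rV1|exact: lebesgue_rV1].
  move=> x xB; have [->|x0] := eqVneq x 0; [by left|right].
  exists (Num.trunc (enorm x * H x)).+1 => //; split; last by move=> /= /eqP; apply/negP.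
  split => //=; apply: ltW; rewrite (truncnS_gt _)//.
have := etrans (esym (lebesgue_rV_set_box (@ler01 R)))
  (measure_negligible (measurable_box 1) neg).
move=> /eqP; rewrite eqe expf_eq0 => /andP[_].
by rewrite paddr_eq0// oner_eq0.
Qed.

Let thin M k : set X := box M `&` [set xi | H xi < k.+1%:R^-1].

Let m_thin M k : measurable (thin M k).
Proof. by apply: measurableI; [exact: measurable_box|exact: m_lt]. Qed.

(* The sets [thin M k] decrease to the empty set, up to the origin, because [H] is
   positive. *)
Let thin_small M (c : \bar R) : 0 <= M -> (0 < c)%E -> exists k, (L (thin M k) < c)%E.
Proof.
move=> M0 cp; apply: contrapT => /forallNP h.
have cv : L (thin M k) @[k --> \oo] --> L (\bigcap_k thin M k).
  apply: nonincreasing_cvg_mu => //.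
  - apply: (@le_lt_trans _ _ (L (box M))).
      by apply: le_measure; rewrite ?inE//; [exact: measurable_box|exact: subIsetl].
    by rewrite lebesgue_rV_set_box// ltry.
  - exact: bigcap_measurable.
  - move=> m n mn; apply/subsetPset => x [xB /= hx]; split => //=.
    by apply: lt_le_trans hx _; rewrite lef_pV2 ?posrE// ler_nat ltnS.
have L0 : L (\bigcap_k thin M k) = 0%E.
  apply/eqP; rewrite eq_le measure_ge0 andbT.
  rewrite -(lebesgue_rV1 (0 : X) d0); apply: le_measure.
  - by rewrite inE; exact: bigcap_measurable.
  - by rewrite inE; exact: measurable_rV1.
  move=> x xS; apply: contrapT => /eqP x0.
  have := H_gt0 x0; have [_ /= hx] := xS (Num.trunc (H x)^-1) I => Hx.
  have := truncnS_gt (H x)^-1; rewrite -[ltRHS]invrK ltf_pV2 ?posrE ?invr_gt0//.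
  by move=> /lt_trans /(_ hx); rewrite ltxx.
suff : (c <= 0)%E by rewrite leNgt cp.
rewrite -L0 -(cvg_lim _ cv)//; apply: lime_ge; first by apply/cvg_ex; eexists; exact: cv.
by apply: nearW => k; rewrite leNgt; exact/negP/h.
Qed.

Let translate_thin (S : set X) eta : measurable S ->
  measurable [set xi | S (xi - eta)] /\ L [set xi | S (xi - eta)] = L S.
Proof.
move=> mS.
have mN : measurable [set z | S (0 - z)].
  by rewrite -[X in measurable X]setTI; exact: measurable_rV_subC.
have -> : [set xi | S (xi - eta)] = (fun xi => eta - xi) @^-1` [set z | S (0 - z)].
  by apply/funext => x; rewrite /preimage/= sub0r opprB.
split; first by rewrite -[X in measurable X]setTI; exact: measurable_rV_subC.
by rewrite lebesgue_rV_subC//; exact: (lebesgue_rV_subC 0).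
Qed.

Let smear (G : set X) eta := (\int[L]_xi (\1_G xi * H (xi - eta))%:E)%E.

(* For [eta] in the box, the translate by [eta] of a thin set is too small to
   cover [G], and off that translate [H (xi - eta)] is at least [eps]. *)
Let smear_ge (G : set X) (M eps : R) k eta : measurable G -> G `<=` box 1 ->
  box M eta -> eps = k.+1%:R^-1 ->
  (eps%:E * L (G `\` [set xi : X | thin (M + 1)%R k (xi - eta)%R]) <= smear G eta)%E.
Proof.
move=> mG GB etaM epsE; have eps0 : 0 <= eps by rewrite epsE.
have [mN _] := translate_thin eta (m_thin (M + 1) k).
set N := [set xi | _] in mN *.
have mGN : measurable (G `\` N) by exact: measurableD.
have <- : (\int[L]_xi (\1_(G `\` N) xi)%:E = L (G `\` N))%E.
  by rewrite integral_indic// setIT.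
rewrite -ge0_integralZl//; last exact/measurable_EFinP/measurable_indic.
apply: ge0_le_integral => //.
- by move=> x _; rewrite -EFinM lee_fin mulr_ge0.
- apply/measurable_EFinP/measurable_funM; [exact: measurable_cst|exact: measurable_indic].
- apply/measurable_EFinP/measurable_funM; first exact: measurable_indic.
  apply: (measurableT_comp mH); apply: measurable_rVB => //; exact: measurable_cst.
move=> x _; rewrite -EFinM lee_fin !indicE.
have [|xN] := boolP (x \in G `\` N); last by rewrite mulr0 mulr_ge0.
rewrite inE => -[Gx nN]; rewrite (mem_set Gx) mulr1 mul1r leNgt; apply/negP => hlt.
apply: nN; split; last by rewrite /= -epsE.
move=> i; have := GB x Gx i; have := etaM i; rewrite /= !mxE !in_itv/=; lra.
Qed.

(* Tonelli: the integral is that of [H * H] over [G]. *)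
Let smear_fin (G : set X) (k : R) : measurable G -> 0 <= k -> (L G < +oo)%E ->
  (forall xi, G xi -> xi != 0 /\ enorm xi * H xi <= k) ->
  (\int[L]_eta ((H eta)%:E * smear G eta) < +oo)%E.
Proof.
move=> mG k0 Gfin Gk.
pose F (p : X * X) := (\1_G p.1 * (H p.2 * H (p.1 - p.2)))%:E.
have mG1 : measurable_fun setT (\1_G : X -> R) by exact: measurable_indic.
have mF : measurable_fun setT F.
  apply/measurable_EFinP/measurable_funM; first exact: (measurableT_comp mG1 measurable_fst).
  apply: measurable_funM; first exact: (measurableT_comp mH measurable_snd).
  exact: (measurableT_comp mH (measurable_rVB measurable_fst measurable_snd)).
have F0 p : (0 <= F p)%E by rewrite lee_fin !mulr_ge0.
have -> : (\int[L]_eta ((H eta)%:E * smear G eta) = \int[L]_eta \int[L]_xi F (xi, eta))%E.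
  apply: eq_integral => eta _; rewrite /smear -ge0_integralZl//.
  - by apply: eq_integral => xi _; rewrite /F/= -EFinM; congr EFin; ring.
  - apply/measurable_EFinP/measurable_funM => //.
    by apply: (measurableT_comp mH); apply: measurable_rVB => //; exact: measurable_cst.
  - by move=> xi _; rewrite lee_fin mulr_ge0.
  - by rewrite lee_fin.
rewrite -(fubini_tonelli F mF F0).
apply: (@le_lt_trans _ _ (k%:E * L G)%E); last first.
  by rewrite lte_mul_pinfty ?lee_fin// ge0_fin_numE.
have <- : (\int[L]_xi (\1_G xi)%:E = L G)%E by rewrite integral_indic// setIT.
rewrite -ge0_integralZl//; last exact/measurable_EFinP.
apply: ge0_le_integral => //.
- by move=> xi _; apply: integral_ge0.
- exact: (measurable_fun_fubini_tonelli_F (m2 := L) F).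
- by apply/measurable_EFinP/measurable_funM => //; exact: measurable_cst.
move=> xi _; rewrite -EFinM /F/= indicE.
have [|xG] := boolP (xi \in G); last first.
  by under eq_integral do rewrite mul0r; rewrite integral0 mulr0.
rewrite inE => /Gk [xi0 xik]; under eq_integral do rewrite mul1r.
by case: kH => _ _ _ /(_ xi xi0) ->; rewrite mulr1 lee_fin.
Qed.

(** On the box the function [smear G] is bounded below by a positive constant
    [eps * c], while [H * smear G] is integrable. *)
Lemma kernel_integrable_box M : 0 <= M -> (\int[L]_(xi in box M) (H xi)%:E < +oo)%E.
Proof.
move=> M0; have [k kp] := level_gt0; set G := level k in kp.
have mG : measurable G by exact: m_level.
have GB : G `<=` box 1 by move=> x [[]].
have Gfin : (L G < +oo)%E.
  apply: (@le_lt_trans _ _ (L (box 1))); last by rewrite lebesgue_rV_set_box// ltry.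
  by apply: le_measure; rewrite ?inE//; exact: measurable_box.
have [j jc] := thin_small (addr_ge0 M0 ler01) kp.
set S := thin (M + 1) j in jc.
have Sfin : L S \is a fin_num by rewrite ge0_fin_numE// (lt_trans jc).
have Gf : L G \is a fin_num by rewrite ge0_fin_numE.
pose eps : R := j.+1%:R^-1; have eps0 : 0 < eps by rewrite invr_gt0.
pose c := fine (L G) - fine (L S).
have c0 : 0 < c by rewrite subr_gt0 -lte_fin !fineK.
have lower eta : box M eta -> ((eps * c)%:E <= smear G eta)%E.
  move=> etaM; apply: le_trans (smear_ge mG GB etaM (erefl eps)).
  have [mN LN] := translate_thin eta (m_thin (M + 1) j).
  rewrite EFinM; apply: lee_wpmul2l; first by rewrite lee_fin ltW.
  set N := [set xi | _] in mN LN *.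
  have GE : (L G = L (G `\` N) + L (G `&` N))%E by exact: measureDI.
  have qS : (L (G `&` N) <= L S)%E.
    by rewrite -LN; apply: le_measure; rewrite ?inE//; exact: measurableI.
  have pG : (L (G `\` N) <= L G)%E by apply: le_measure; rewrite ?inE//; exact: measurableD.
  have p0 : (0 <= L (G `\` N))%E by exact: measure_ge0.
  have q0 : (0 <= L (G `&` N))%E by exact: measure_ge0.
  move: (L (G `\` N)) (L (G `&` N)) GE qS pG p0 q0.
  move=> p q GE qS pG p0 q0; rewrite /c.
  have pf : p \is a fin_num by rewrite (ge0_fin_numE p0); exact: le_lt_trans pG Gfin.
  have qf : q \is a fin_num.
    by rewrite (ge0_fin_numE q0); exact: le_lt_trans qS (lt_trans jc Gfin).
  rewrite -(fineK pf) lee_fin.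
  move: GE qS; rewrite -(fineK Gf) -(fineK Sfin) -(fineK pf) -(fineK qf) -EFinD.
  by move=> [->]; rewrite lee_fin/=; lra.
have HM0 : (0 <= \int[L]_(xi in box M) (H xi)%:E)%E.
  by apply: integral_ge0 => xi _; rewrite lee_fin.
have msm : measurable_fun setT (smear G).
  pose F (p : X * X) := (\1_G p.2 * H (p.2 - p.1))%:E.
  apply: (measurable_fun_fubini_tonelli_F (m2 := L) F) => [|p].
    apply/measurable_EFinP/measurable_funM.
      exact: (measurableT_comp (measurable_indic mG) measurable_snd).
    exact: (measurableT_comp mH (measurable_rVB measurable_snd measurable_fst)).
  by rewrite lee_fin mulr_ge0.
have sm0 eta : (0 <= smear G eta)%E.
  by apply: integral_ge0 => xi _; rewrite lee_fin mulr_ge0.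
have ub : ((eps * c)%:E * \int[L]_(xi in box M) (H xi)%:E < +oo)%E.
  have ec0 : (0 <= (eps * c)%:E)%E by rewrite lee_fin mulr_ge0// ltW.
  have mHM : measurable_fun (box M) (fun xi => (H xi)%:E).
    by apply/measurable_EFinP; exact: measurable_funTS.
  have HM x : box M x -> (0 <= (H x)%:E)%E by rewrite lee_fin.
  rewrite -(ge0_integralZl L (measurable_box M) mHM HM ec0).
  have fin : (\int[L]_eta ((H eta)%:E * smear G eta) < +oo)%E.
    apply: (smear_fin (k := k%:R)) => // xi [[_ h] xi0]; split => //.
    exact/eqP.
  apply: le_lt_trans fin.
  apply: (@le_trans _ _ (\int[L]_(eta in box M) ((H eta)%:E * smear G eta))%E).
    apply: ge0_le_integral => //; first exact: measurable_box.
    - by move=> x _; apply: mule_ge0; rewrite ?lee_fin.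
    - by apply: emeasurable_funM => //; exact: measurable_cst.
    - by apply: emeasurable_funM => //; exact: measurable_funTS.
    by move=> x xM; rewrite muleC; apply: lee_wpmul2l; [rewrite lee_fin|exact: lower].
  apply: ge0_subset_integral => //; first exact: measurable_box.
    by apply: emeasurable_funM => //; exact/measurable_EFinP.
  by move=> x _; apply: mule_ge0; rewrite ?lee_fin.
rewrite ltey; apply/eqP => HMoo; move: ub; rewrite HMoo gt0_muley ?ltxx//.
by rewrite lte_fin mulr_gt0.
Qed.

Lemma kernel_L1loc (f : X -> 'rV[R[i]]_d) (C : R) :
  Cmeasurable setT f -> (forall xi, cnorm (f xi) <= C * H xi) -> L1loc f.
Proof.
move=> mf fC; split => // K /compact_sub_box[M M0 KM].
apply: (@le_lt_trans _ _ (\int[L]_(xi in box M) (cnorm (f xi))%:E)%E).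
  (* Both integrals are suprema over simple functions, and the family for [K] is
     contained in that for the box. *)
  have nonneg (D : set X) x : (0 <= ((fun xi => (cnorm (f xi))%:E) \_ D) x)%E.
    by rewrite patchE; case: ifP => //; rewrite lee_fin cnorm_ge0.
  rewrite integral_mkcond [leRHS]integral_mkcond !ge0_integralTE//.
  apply: le_ereal_sup => _ /= [g gK <-]; exists g => // x; apply: le_trans (gK x) _.
  rewrite !patchE; case: ifPn => [|_]; last by case: ifP; rewrite ?lee_fin ?cnorm_ge0.
  by rewrite inE => /KM xM; rewrite mem_set.
apply: (@le_lt_trans _ _ (\int[L]_(xi in box M) ((Num.max C 0)%:E * (H xi)%:E))%E).
  apply: ge0_le_integral => //; first exact: measurable_box.
  - by move=> x _; rewrite lee_fin cnorm_ge0.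
  - apply/measurable_EFinP; apply: measurable_funTS; exact: measurable_cnorm.
  - apply: measurable_funTS; apply/measurable_EFinP/measurable_funM => //; exact: measurable_cst.
  move=> x _; rewrite -EFinM lee_fin; apply: le_trans (fC x) _.
  by rewrite ler_wpM2r// le_max lexx.
have mHM : measurable_fun (box M) (fun xi => (H xi)%:E).
  by apply/measurable_EFinP; exact: measurable_funTS.
have HM x : box M x -> (0 <= (H x)%:E)%E by rewrite lee_fin.
have C0 : (0 <= (Num.max C 0)%:E)%E by rewrite lee_fin le_max lexx orbT.
rewrite (ge0_integralZl L (measurable_box M) mHM HM C0).
apply: lte_mul_pinfty; rewrite ?lee_fin ?le_max ?lexx ?orbT//.
exact: kernel_integrable_box.
Qed.

End local_integrability.

(** * The Picard iteration *)

Section limits.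
Context {R : realType}.

Lemma cvg_finite_sum (I : Type) (s : seq I) (f : I -> nat -> R) (l : I -> R) :
  (forall i, f i n @[n --> \oo] --> l i) ->
  \sum_(i <- s) f i n @[n --> \oo] --> \sum_(i <- s) l i.
Proof.
move=> fl; elim: s => [|i s IH].
  by under eq_fun do rewrite big_nil; rewrite big_nil; exact: cvg_cst.
by under eq_fun do rewrite big_cons; rewrite big_cons; exact: cvgD.
Qed.

Lemma cvg_cnorm d (a : nat -> 'rV[R[i]]_d) (l : 'rV[R[i]]_d) :
  (forall j, complex.Re (a n ord0 j) @[n --> \oo] --> complex.Re (l ord0 j)) ->
  (forall j, complex.Im (a n ord0 j) @[n --> \oo] --> complex.Im (l ord0 j)) ->
  cnorm (a n) @[n --> \oo] --> cnorm l.
Proof.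
move=> re im; pose S n := \sum_j (complex.Re (a n ord0 j) ^+ 2 + complex.Im (a n ord0 j) ^+ 2).
have Sl : S n @[n --> \oo] -->
    \sum_j (complex.Re (l ord0 j) ^+ 2 + complex.Im (l ord0 j) ^+ 2).
  apply: cvg_finite_sum => j; rewrite !expr2; under eq_fun do rewrite !expr2.
  by apply: cvgD; apply: cvgM.
exact: (cvg_comp _ _ Sl (@sqrt_continuous R _)).
Qed.

(** [x + y] is nondecreasing and bounded, hence convergent, like [y] itself. *)
Lemma cvgn_majorized (x y : nat -> R) (M : R) :
  (forall n, `|x n.+1 - x n| + y n <= y n.+1) -> (forall n, y n <= M) -> cvgn x.
Proof.
move=> xy yM.
have step n : `|x n.+1 - x n| <= y n.+1 - y n by rewrite lerBrDr.
have y_nd : nondecreasing_seq y.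
  by apply/nondecreasing_seqP => n; rewrite -subr_ge0; exact: le_trans (step n).
have y_cvg : cvgn y.
  apply: nondecreasing_is_cvgn => //.
  by exists M => _ [n _ <-].
have xy_nd : nondecreasing_seq (fun n => x n + y n).
  apply/nondecreasing_seqP => n; have := step n; rewrite ler_norml => /andP[+ _].
  lra.
have xB n : x n - x 0%N <= y n - y 0%N.
  elim: n => [|n IH]; first by rewrite !subrr.
  have := step n; rewrite ler_norml => /andP[_]; lra.
have xy_cvg : cvgn (fun n => x n + y n).
  apply: nondecreasing_is_cvgn => //; exists (x 0%N + M + (M - y 0%N)).
  by move=> _ [n _ <-]; have := xB n; have := yM n; lra.
rewrite (_ : x = (fun n => x n + y n) - y); first exact: is_cvgB.
by apply/funext => n; rewrite fctE addrK.
Qed.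

End limits.

Lemma add_scale0 (K : nzRingType) (V : lmodType K) (k : K) (x : V) :
  x + k *: 0 = x.
Proof. by rewrite scaler0 addr0. Qed.

Section duhamel_nonpositive_times.
Context {R : realType} {d : nat}.
Local Open Scope complex_scope.

Lemma interaction_nonpos U (xi : 'rV[R]_d) t : t <= 0 -> interaction U xi t = 0%E.
Proof. by move=> t0; rewrite /interaction set_itv_ge ?integral_set0// bnd_simp -leNgt. Qed.

Lemma FNS_rhs_nonpos v0 v (xi : 'rV[R]_d) t : t <= 0 ->
  FNS_rhs v0 v xi t = (heat xi t)%:C *: v0 xi.
Proof.
move=> t0; rewrite FNS_rhsE.
have -> : Cintegral lebesgue_measure `]0, t[ (fun s =>
     (damp xi s)%:C *: inner v xi (t - s)) = 0.
  rewrite set_itv_ge ?bnd_simp -?leNgt//; apply/rowP => j.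
  by rewrite [LHS]mxE [RHS]mxE !Rintegral_set0.
exact: add_scale0.
Qed.

End duhamel_nonpositive_times.

Section picard.
Context {R : realType} {d : nat}.
Local Notation X := ('rV[R]_d).
Local Notation leb := (@lebesgue_measure R).
Implicit Types (xi eta : X) (t tau : R) (n : nat).
Variables (H : X -> R) (kH : conv_kernel H).
Local Open Scope complex_scope.

Let H_ge0 xi : 0 <= H xi. Proof. by case: kH. Qed.
Let mH : measurable_fun setT H. Proof. by case: kH. Qed.

Let c0p : 0 < c0 d :> R. Proof. exact: c0_gt0. Qed.

Lemma cnorm_le_c0 (a : 'rV[R[i]]_d) (K x : R) :
  c0 d * cnorm a <= K * x -> cnorm a <= K / c0 d * x.
Proof. by move=> h; rewrite mulrAC ler_pdivlMr// mulrC. Qed.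

Lemma jmeas_heatH (M : R) : jmeas (fun xi t => M * heat xi t * H xi).
Proof.
apply: measurable_funM; last exact: (measurableT_comp mH measurable_fst).
by apply: measurable_funM; [exact: measurable_cst|exact: measurable_heat].
Qed.

Variables (v0 : X -> 'rV[R[i]]_d) (mv0 : Cmeasurable setT v0).

Lemma FNS_rhs_zero xi t : FNS_rhs v0 (fun _ _ => 0) xi t = (heat xi t)%:C *: v0 xi.
Proof.
rewrite FNS_rhsE; have -> : (fun s => (damp xi s)%:C *: inner (fun _ _ => 0) xi (t - s)) =
    fun=> (0 : 'rV[R[i]]_d).
  apply/funext => s; apply: cnorm_eq0; rewrite cnormZR ?damp_ge0//.
  rewrite (_ : inner _ _ _ = 0) ?cnorm0 ?mulr0//.
  apply/rowP => j; rewrite [LHS]mxE [RHS]mxE.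
  under eq_Rintegral do rewrite odot0 mxE.
  under [X in (_ +i* X)%C]eq_Rintegral do rewrite odot0 mxE.
  by rewrite /Rintegral !integral0.
have -> : Cintegral leb `]0, t[ (fun=> (0 : 'rV[R[i]]_d)) = 0.
  apply/rowP => j; rewrite [LHS]mxE [RHS]mxE.
  under eq_Rintegral do rewrite mxE.
  under [X in (_ +i* X)%C]eq_Rintegral do rewrite mxE.
  by rewrite /Rintegral !integral0.
exact: add_scale0.
Qed.

(** The difference estimate against the zero field. *)
Lemma rhs_bound (v : X -> R -> 'rV[R[i]]_d) (W : X -> R -> R) (lam K t : R) xi :
  jCmeas v -> jmeas W -> 0 < t -> 0 <= lam ->
  (forall eta tau, 0 < tau < t -> 0 <= W eta tau <= K * H eta) ->
  (forall eta tau, 0 < tau < t -> c0 d * cnorm (v eta tau) <= lam * W eta tau) ->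
  ((c0 d * cnorm (FNS_rhs v0 v xi t))%:E <=
   (heat xi t * (c0 d * cnorm (v0 xi)))%:E + (lam * lam)%:E * interaction W xi t)%E.
Proof.
move=> mv mW t0 lam0 WK vW.
have m0 : jCmeas (fun _ _ => 0 : 'rV[R[i]]_d).
  by move=> j; split; exact: measurable_cst.
have mU0 : jmeas (fun (_ : X) (_ : R) => 0 : R) by exact: measurable_cst.
have vK eta tau : 0 < tau < t -> cnorm (v eta tau) <= lam * K / c0 d * H eta.
  move=> tt; apply: cnorm_le_c0; apply: le_trans (vW _ _ tt) _.
  by rewrite -mulrA ler_wpM2l//; have /andP[] := WK eta tau tt.
have zK eta tau : 0 < tau < t -> cnorm (0 : 'rV[R[i]]_d) <= lam * K / c0 d * H eta.
  by move=> tt; rewrite cnorm0; apply: le_trans (vK eta tau tt); exact: cnorm_ge0.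
have h := rhs_diff kH mv m0 mU0 mW t0 lam0 (lexx lam) v0 vK zK.
have {}h : ((c0 d * cnorm (FNS_rhs v0 v xi t - FNS_rhs v0 (fun _ _ => 0%R) xi t))%:E +
   (lam * lam)%:E * interaction (fun _ _ => 0%R) xi t <= (lam * lam)%:E * interaction W xi t)%E.
  apply: h => eta tau tt.
  - by rewrite lexx; have /andP[] := WK eta tau tt.
  - by rewrite cnorm0 !mulr0.
  - by rewrite subr0 mulr0 addr0; exact: vW.
have Q0 : (0 <= (lam * lam)%:E * interaction (fun _ _ => 0%R) xi t)%E.
  by apply: mule_ge0; [rewrite lee_fin mulr_ge0|exact: interaction_ge0].
have {Q0}h := le_trans (leeDl _ Q0) h.
apply: le_trans (leeD (lexx _) h); rewrite -EFinD lee_fin FNS_rhs_zero.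
rewrite -[X in X * (c0 d * _)]mul1r.
set g := (heat xi t)%:C *: v0 xi.
have -> : 1 * heat xi t * (c0 d * cnorm (v0 xi)) = c0 d * cnorm g.
  by rewrite /g cnormZR ?(ltW (heat_gt0 _ _))//; ring.
rewrite -mulrDr ler_pM2l//; set r := FNS_rhs _ _ _ _.
rewrite -[X in cnorm X <= _](subrK g r) addrC; exact: cnormD.
Qed.

Hypothesis v0H : forall xi, c0 d * cnorm (v0 xi) <= 2 * H xi.

(** The scalar iterates for the data [2 * H], the largest that keep them below
    [2 * H]. *)
Fixpoint majorant n xi t : R := if n is m.+1
  then 2 * heat xi t * H xi + fine (interaction (majorant m) xi t) else 0.

Fixpoint picard n xi t : 'rV[R[i]]_d := if n is m.+1
  then FNS_rhs v0 (picard m) xi t else 0.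

Lemma jmeas_majorant n : jmeas (majorant n).
Proof.
elim: n => [|n IH]; first exact: measurable_cst.
apply: measurable_funD; first exact: jmeas_heatH.
by apply: measurableT_comp; [exact: fine_measurable|exact: measurable_interaction].
Qed.

Lemma jCmeas_picard n : jCmeas (picard n).
Proof.
elim: n => [|n IH]; first by move=> j; split; exact: measurable_cst.
exact: jCmeas_rhs.
Qed.

Lemma interaction_le_kernel U xi t : 0 < t -> jmeas U ->
  (forall eta tau, 0 < tau < t -> 0 <= U eta tau <= 2 * H eta) ->
  (0 <= interaction U xi t <= (2 * (1 - heat xi t) * H xi)%:E)%E.
Proof.
move=> t0 mU UH; apply/andP; split.
  by apply: interaction_ge0 => eta tau tt; have /andP[] := UH eta tau tt.
apply: le_trans (interaction_kernel_le kH xi t0 _ mU UH) _ => //.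
by rewrite (_ : 2 ^+ 2 / 2 = 2 :> R)//; field.
Qed.

Lemma majorant_bound n xi t : 0 < t -> 0 <= majorant n xi t <= 2 * H xi.
Proof.
elim: n xi t => [|n IH] xi t t0 /=; first by rewrite lexx mulr_ge0.
have UH eta tau : 0 < tau < t -> 0 <= majorant n eta tau <= 2 * H eta.
  by move=> /andP[tau0 _]; exact: IH.
have /andP[q0 q1] := interaction_le_kernel xi t0 (jmeas_majorant n) UH.
have qf : interaction (majorant n) xi t \is a fin_num.
  by rewrite ge0_fin_numE// (le_lt_trans q1)// ltry.
apply/andP; split.
  by rewrite addr_ge0 ?fine_ge0// !mulr_ge0// ltW// heat_gt0.
by have := q1; rewrite -(fineK qf) lee_fin; lra.
Qed.

Lemma interaction_majorant_fin n xi t : interaction (majorant n) xi t \is a fin_num.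
Proof.
have [t0|t0] := leP t 0; first by rewrite interaction_nonpos.
have UH eta tau : 0 < tau < t -> 0 <= majorant n eta tau <= 2 * H eta.
  by move=> /andP[tau0 _]; exact: majorant_bound.
have /andP[q0 q1] := interaction_le_kernel xi t0 (jmeas_majorant n) UH.
by rewrite ge0_fin_numE// (le_lt_trans q1)// ltry.
Qed.

Lemma EFin_majorantS n xi t :
  (majorant n.+1 xi t)%:E = ((2 * heat xi t * H xi)%:E + interaction (majorant n) xi t)%E.
Proof. by rewrite /= EFinD fineK// interaction_majorant_fin. Qed.

Lemma majorant_nonpos n xi t : t <= 0 -> majorant n.+1 xi t = 2 * heat xi t * H xi.
Proof. by move=> t0 /=; rewrite interaction_nonpos// addr0. Qed.

Lemma picard_nonpos n xi t : t <= 0 -> picard n.+1 xi t = (heat xi t)%:C *: v0 xi.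
Proof. exact: FNS_rhs_nonpos. Qed.

(** Data smaller by a factor [lam] make the source smaller by [lam] and the
    interaction by [lam * lam <= lam]. *)
Lemma picard_le (lam : R) n xi t : 0 <= lam -> lam <= 1 ->
  (forall xi, c0 d * cnorm (v0 xi) <= 2 * lam * H xi) -> 0 < t ->
  c0 d * cnorm (picard n xi t) <= lam * majorant n xi t.
Proof.
move=> lam0 lam1 v0lam; elim: n xi t => [|n IH] xi t t0.
  by rewrite /= cnorm0 !mulr0.
rewrite -lee_fin [leRHS]EFinM EFin_majorantS.
have h : ((c0 d * cnorm (picard n.+1 xi t))%:E <=
   (heat xi t * (c0 d * cnorm (v0 xi)))%:E + (lam * lam)%:E * interaction (majorant n) xi t)%E.
  apply: (rhs_bound (K := 2)) => //; [exact: jCmeas_picard|exact: jmeas_majorant| |].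
    by move=> eta tau /andP[tau0 _]; exact: majorant_bound.
  by move=> eta tau /andP[tau0 _]; exact: IH.
apply: le_trans h _; rewrite -(fineK (interaction_majorant_fin n xi t)).
rewrite -EFinM -!EFinD -EFinM lee_fin mulrDr; apply: lerD.
  have := ler_wpM2l (ltW (heat_gt0 xi t)) (v0lam xi).
  by move=> /le_trans; apply; rewrite le_eqVlt; apply/orP; left; apply/eqP; ring.
rewrite -[leRHS]mul1r mulrA; apply: ler_wpM2r.
  apply: fine_ge0; apply: interaction_ge0 => eta tau /andP[tau0 _].
  by have /andP[] := majorant_bound n eta tau0.
by rewrite mul1r ler_piMl.
Qed.

Lemma picard_le1 n xi t : 0 < t ->
  c0 d * cnorm (picard n xi t) <= majorant n xi t.
Proof.
by move=> t0; rewrite -[leRHS]mul1r; apply: picard_le => // x; rewrite mulr1.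
Qed.

Lemma picard_leH n xi t : 0 < t -> cnorm (picard n xi t) <= 2 / c0 d * H xi.
Proof.
move=> t0; apply: cnorm_le_c0; apply: le_trans (picard_le1 n xi t0) _.
by have /andP[] := majorant_bound n xi t0.
Qed.

(** The increments of the Picard iterates are dominated by those of the majorants;
    telescoping gives convergence and, in [picard_lim_tail], the rate. *)
Lemma picard_step n xi t :
  c0 d * cnorm (picard n.+1 xi t - picard n xi t) + majorant n xi t
  <= majorant n.+1 xi t.
Proof.
have base xi' t' : c0 d * cnorm (picard 1 xi' t' - picard 0 xi' t') +
    majorant 0 xi' t' <= majorant 1 xi' t'.
  have -> : picard 1 xi' t' = (heat xi' t')%:C *: v0 xi' by exact: FNS_rhs_zero.
  rewrite subr0 addr0 cnormZR; last exact/ltW/heat_gt0.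
  rewrite mulrCA; apply: le_trans (ler_wpM2l (ltW (heat_gt0 xi' t')) (v0H xi')) _.
  rewrite /= mulrCA mulrA lerDl fine_ge0//.
  exact: interaction_ge0.
elim: n xi t => [|n IH] xi t; first exact: base.
have [t0|t0] := leP t 0.
  rewrite [majorant n.+2 _ _](majorant_nonpos n.+1 xi t0) (majorant_nonpos n xi t0).
  by rewrite (picard_nonpos n.+1 xi t0) (picard_nonpos n xi t0) subrr cnorm0 mulr0 add0r.
have h : ((c0 d * cnorm (picard n.+2 xi t - picard n.+1 xi t))%:E +
   (1 * 1)%:E * interaction (majorant n) xi t <= (1 * 1)%:E * interaction (majorant n.+1) xi t)%E.
  apply: (rhs_diff kH (jCmeas_picard n.+1) (jCmeas_picard n) (jmeas_majorant n)
    (jmeas_majorant n.+1) t0 ler01 (lexx 1) v0 (K := 2 / c0 d)).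
  - by move=> eta tau /andP[tau0 _]; exact: picard_leH.
  - by move=> eta tau /andP[tau0 _]; exact: picard_leH.
  - move=> eta tau /andP[tau0 _]; apply/andP; split.
      by have /andP[] := majorant_bound n eta tau0.
    have := IH eta tau; apply: le_trans; rewrite lerDr.
    by rewrite mulr_ge0 ?cnorm_ge0// ltW.
  - by move=> eta tau /andP[tau0 _]; rewrite mul1r; exact: picard_le1.
  - by move=> eta tau /andP[tau0 _]; rewrite !mul1r; exact: IH.
rewrite -lee_fin EFinD !EFin_majorantS addeCA; apply: leeD => //.
by rewrite mulr1 !mul1e in h.
Qed.

Lemma majorant_nd xi t : nondecreasing_seq (fun n => majorant n xi t).
Proof.
apply/nondecreasing_seqP => n; apply: le_trans (picard_step n xi t).
by rewrite lerDr mulr_ge0 ?cnorm_ge0// ltW.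
Qed.

(* The extra summand [heat xi t] accounts for the nonpositive times, at which the
   heat factor is at least 1. *)
Lemma majorant_ub n xi t : majorant n xi t <= 2 * (1 + heat xi t) * H xi.
Proof.
have [t0|t0] := leP t 0.
  case: n => [|n]; first by rewrite !mulr_ge0// addr_ge0// ltW// heat_gt0.
  by rewrite majorant_nonpos// ler_wpM2r// ler_wpM2l// lerDr.
have /andP[_ h] := majorant_bound n xi t0; apply: le_trans h _.
by rewrite ler_wpM2r// ler_peMr// lerDl ltW// heat_gt0.
Qed.

Lemma cvg_majorant xi t : cvgn (fun n => majorant n xi t).
Proof.
apply: nondecreasing_is_cvgn; first exact: majorant_nd.
by exists (2 * (1 + heat xi t) * H xi) => _ [n _ <-]; exact: majorant_ub.
Qed.

Lemma cvg_picard_coord (f : 'rV[R[i]]_d -> R) xi t :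
  (forall a b, `|f a - f b| <= cnorm (a - b)) ->
  cvgn (fun n => f (picard n xi t)).
Proof.
move=> f1; apply: (@cvgn_majorized _ _ (fun n => majorant n xi t / c0 d)
  (2 * (1 + heat xi t) * H xi / c0 d)) => n.
  rewrite ler_pdivlMr// mulrDl divfK ?gt_eqF//.
  apply: le_trans (picard_step n xi t); rewrite lerD2r mulrC ler_wpM2l//.
  exact: ltW.
by rewrite ler_pM2r ?invr_gt0//; exact: majorant_ub.
Qed.

Lemma Re_coord_lip j (a b : 'rV[R[i]]_d) :
  `|complex.Re (a ord0 j) - complex.Re (b ord0 j)| <= cnorm (a - b).
Proof. by have := ler_Re_cnorm (a - b) j; rewrite [(a - b) _ _]mxE [(- b) _ _]mxE raddfB. Qed.

Lemma Im_coord_lip j (a b : 'rV[R[i]]_d) :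
  `|complex.Im (a ord0 j) - complex.Im (b ord0 j)| <= cnorm (a - b).
Proof. by have := ler_Im_cnorm (a - b) j; rewrite [(a - b) _ _]mxE [(- b) _ _]mxE raddfB. Qed.

Definition majorant_lim xi t : R := limn (fun n => majorant n xi t).

Definition picard_lim xi t : 'rV[R[i]]_d :=
  \row_j (limn (fun n => complex.Re (picard n xi t ord0 j)) +i*
          limn (fun n => complex.Im (picard n xi t ord0 j))).

Lemma cvg_picard_Re xi t j : complex.Re (picard n xi t ord0 j) @[n --> \oo] -->
  complex.Re (picard_lim xi t ord0 j).
Proof.
rewrite mxE/=; apply: (@cvg_picard_coord (fun a => complex.Re (a ord0 j))).
exact: Re_coord_lip.
Qed.

Lemma cvg_picard_Im xi t j : complex.Im (picard n xi t ord0 j) @[n --> \oo] -->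
  complex.Im (picard_lim xi t ord0 j).
Proof.
rewrite mxE/=; apply: (@cvg_picard_coord (fun a => complex.Im (a ord0 j))).
exact: Im_coord_lip.
Qed.

Lemma jmeas_majorant_lim : jmeas majorant_lim.
Proof.
apply: (@measurable_fun_cvg _ _ _ _
  (fun n (p : X * measurableTypeR R) => majorant n p.1 p.2)).
  by move=> n; exact: jmeas_majorant.
by move=> p _; exact: cvg_majorant.
Qed.

Lemma jCmeas_picard_lim : jCmeas picard_lim.
Proof.
move=> j; split.
  apply: (@measurable_fun_cvg _ _ _ _
    (fun n (p : X * measurableTypeR R) => complex.Re (picard n p.1 p.2 ord0 j))).
    by move=> n; have [] := jCmeas_picard n j.
  by move=> p _; exact: cvg_picard_Re.
apply: (@measurable_fun_cvg _ _ _ _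
  (fun n (p : X * measurableTypeR R) => complex.Im (picard n p.1 p.2 ord0 j))).
  by move=> n; have [] := jCmeas_picard n j.
by move=> p _; exact: cvg_picard_Im.
Qed.

Lemma majorant_le_lim n xi t : majorant n xi t <= majorant_lim xi t.
Proof. by apply: nondecreasing_cvgn_le; [exact: majorant_nd|exact: cvg_majorant]. Qed.

Lemma majorant_lim_bound xi t : 0 < t -> 0 <= majorant_lim xi t <= 2 * H xi.
Proof.
move=> t0; rewrite (le_trans _ (majorant_le_lim 0 xi t))//=.
apply: limr_le; first exact: cvg_majorant.
by apply: nearW => n; have /andP[] := majorant_bound n xi t0.
Qed.

Lemma picard_lim_le xi t (Y : R) :
  (forall n, c0 d * cnorm (picard n xi t) <= Y) -> c0 d * cnorm (picard_lim xi t) <= Y.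
Proof.
move=> h; have : c0 d * cnorm (picard n xi t) @[n --> \oo] --> c0 d * cnorm (picard_lim xi t).
  apply: cvgM; first exact: cvg_cst.
  by apply: cvg_cnorm => j; [exact: cvg_picard_Re|exact: cvg_picard_Im].
by move=> /cvgr_to_le; apply; exact: nearW.
Qed.

Lemma picard_tail n m xi t : (n <= m)%N ->
  c0 d * cnorm (picard m xi t - picard n xi t) + majorant n xi t <= majorant m xi t.
Proof.
elim: m => [|m IH]; first by rewrite leqn0 => /eqP ->; rewrite subrr cnorm0 mulr0 add0r.
rewrite leq_eqVlt => /predU1P[->|]; first by rewrite subrr cnorm0 mulr0 add0r.
rewrite ltnS => /IH {}IH; have h := picard_step m xi t.
have : c0 d * cnorm (picard m.+1 xi t - picard n xi t) <=
    c0 d * cnorm (picard m.+1 xi t - picard m xi t) + c0 d * cnorm (picard m xi t - picard n xi t).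
  rewrite -mulrDr ler_pM2l//.
  exact: cnorm_triangle.
lra.
Qed.

Lemma picard_lim_tail n xi t :
  c0 d * cnorm (picard_lim xi t - picard n xi t) + majorant n xi t <= majorant_lim xi t.
Proof.
have cv : c0 d * cnorm (picard m xi t - picard n xi t) + majorant n xi t
    @[m --> \oo] --> c0 d * cnorm (picard_lim xi t - picard n xi t) + majorant n xi t.
  apply: cvgD; last exact: cvg_cst.
  apply: cvgM; first exact: cvg_cst.
  have entryB (a b : 'rV[R[i]]_d) j : (a - b) ord0 j = a ord0 j - b ord0 j by rewrite !mxE.
  apply: cvg_cnorm => j; rewrite entryB raddfB/=; under eq_fun do rewrite entryB raddfB/=.
    by apply: cvgB; [exact: cvg_picard_Re|exact: cvg_cst].
  by apply: cvgB; [exact: cvg_picard_Im|exact: cvg_cst].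
apply: (cvgr_to_le cv); exists n => // m /= nm.
by apply: le_trans (picard_tail xi t nm) _; exact: majorant_le_lim.
Qed.

End picard.

(** * Fixed point and uniqueness *)

Lemma scaled_triangle (R : numDomainType) (c x y z A B : R) : 0 <= c ->
  z <= x + y -> c * x <= A -> c * y <= B -> c * z <= A + B.
Proof.
move=> c0 zxy xA yB; apply: le_trans (ler_wpM2l c0 zxy) _.
by rewrite mulrDr lerD.
Qed.

Section picard_fixed_point.
Context {R : realType} {d : nat}.
Local Notation X := ('rV[R]_d).
Local Notation L := (@lebesgue_rV R d).
Local Notation leb := (@lebesgue_measure R).
Implicit Types (xi eta : X) (t tau : R) (n : nat).
Variables (H : X -> R) (kH : conv_kernel H).
Variables (v0 : X -> 'rV[R[i]]_d) (mv0 : Cmeasurable setT v0).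
Hypothesis v0H : forall xi, c0 d * cnorm (v0 xi) <= 2 * H xi.
Local Open Scope complex_scope.

Let c0p : 0 < c0 d :> R. Proof. exact: c0_gt0. Qed.

Local Notation Ub := (majorant H).
Local Notation Uoo := (majorant_lim H).
Local Notation vb := (picard v0).
Local Notation voo := (picard_lim v0).

Let mU n : jmeas (Ub n). Proof. exact: jmeas_majorant. Qed.
Let U_ge0 n eta tau : 0 < tau -> 0 <= Ub n eta tau.
Proof. by move=> tau0; have /andP[] := majorant_bound kH n eta tau0. Qed.
Let U_nd eta tau : nondecreasing_seq (fun n => Ub n eta tau).
Proof. exact: (majorant_nd kH mv0 v0H). Qed.
Let U_cvg eta tau : Ub n eta tau @[n --> \oo] --> Uoo eta tau.
Proof. exact: (cvg_majorant kH mv0 v0H). Qed.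

Lemma cvg_selfconv_majorant xi tau : 0 < tau ->
  selfconv (Ub n) xi tau @[n --> \oo] --> selfconv Uoo xi tau.
Proof.
move=> tau0; pose g n eta := (Ub n eta tau * Ub n (xi - eta) tau)%:E.
have -> : selfconv Uoo xi tau = (\int[L]_eta (fun eta => limn (g^~ eta)) eta)%E.
  apply: eq_integral => eta _; apply/esym/cvg_lim => //.
  by apply: cvg_EFin; [exact: nearW|apply: cvgM; exact: U_cvg].
apply: (@cvg_monotone_convergence _ _ _ L setT measurableT g).
- by move=> n; apply/measurable_EFinP; exact: measurable_conv_integrand.
- by move=> n eta _; rewrite lee_fin mulr_ge0// U_ge0.
- by move=> eta _ n m nm; rewrite lee_fin ler_pM ?U_ge0//; exact: U_nd.
Qed.

Lemma selfconv_majorant_nd xi tau : 0 < tau ->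
  {homo (fun n => selfconv (Ub n) xi tau) : n m / (n <= m)%N >-> (n <= m)%E}.
Proof.
move=> tau0 n m nm; apply: ge0_le_integral => //.
- by move=> eta _; rewrite lee_fin mulr_ge0// U_ge0.
- by apply/measurable_EFinP; exact: measurable_conv_integrand.
- by apply/measurable_EFinP; exact: measurable_conv_integrand.
- by move=> eta _; rewrite lee_fin ler_pM ?U_ge0//; exact: U_nd.
Qed.

Lemma cvg_interaction_majorant xi t : 0 < t ->
  interaction (Ub n) xi t @[n --> \oo] --> interaction Uoo xi t.
Proof.
move=> t0; pose g n s := ((damp xi s / 2)%:E * selfconv (Ub n) xi (t - s))%E.
have dm0 s : (0 <= (damp xi s / 2)%:E)%E by rewrite lee_fin divr_ge0// damp_ge0.
have mI : measurable (`]0, t[%classic : set (measurableTypeR R)) by [].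
have -> : interaction Uoo xi t = (\int[leb]_(s in `]0%R, t[) (fun s => limn (g^~ s)) s)%E.
  apply: eq_integral => s; rewrite inE => /in_lag/andP[st _].
  apply/esym/cvg_lim => //; apply: cvgeZl => //.
  exact: cvg_selfconv_majorant.
apply: (@cvg_monotone_convergence _ _ _ leb _ mI g).
- by move=> n; apply: measurable_interaction_integrand.
- move=> n s /in_lag/andP[st _]; apply: mule_ge0; first exact: dm0.
  by apply: selfconv_ge0 => eta; exact: U_ge0.
- move=> s /in_lag/andP[st _] n m nm; apply: lee_wpmul2l; first exact: dm0.
  exact: selfconv_majorant_nd.
Qed.

(** Monotone convergence, in frequency and then in time. *)
Lemma majorant_lim_fixed xi t : 0 < t ->
  (Uoo xi t)%:E = ((2 * heat xi t * H xi)%:E + interaction Uoo xi t)%E.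
Proof.
move=> t0.
have h1 : (Ub n.+1 xi t)%:E @[n --> \oo] --> (Uoo xi t)%:E.
  apply: cvg_EFin; first exact: nearW.
  by rewrite (cvg_shiftS (fun n => Ub n xi t)); exact: U_cvg.
have h2 : (Ub n.+1 xi t)%:E @[n --> \oo] --> ((2 * heat xi t * H xi)%:E + interaction Uoo xi t)%E.
  under eq_fun do rewrite EFin_majorantS//.
  apply: cvgeD; [|exact: cvg_cst|exact: cvg_interaction_majorant].
  by rewrite fin_num_adde_defr.
exact: (cvg_unique _ h1 h2).
Qed.

(** Both [voo] and [FNS_rhs v0 voo] are within [Uoo - Ub n.+1] of the iterate
    [vb n.+1], the latter by the difference estimate and because [Uoo] is a fixed
    point of the scalar equation. *)
Lemma picard_lim_fixed xi t : 0 < t -> voo xi t = FNS_rhs v0 voo xi t.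
Proof.
move=> t0; have Ulim := majorant_lim_bound kH mv0 v0H.
have voo_le eta tau : 0 < tau -> c0 d * cnorm (voo eta tau) <= Uoo eta tau.
  move=> tau0; apply: (picard_lim_le kH mv0 v0H) => n.
  apply: le_trans (picard_le1 kH mv0 v0H n eta tau0) _.
  exact: (majorant_le_lim kH mv0 v0H).
have close n : c0 d * cnorm (voo xi t - FNS_rhs v0 voo xi t) <=
    (Uoo xi t - Ub n.+1 xi t) + (Uoo xi t - Ub n.+1 xi t).
  have h : ((c0 d * cnorm (FNS_rhs v0 voo xi t - FNS_rhs v0 (vb n) xi t))%:E +
     (1 * 1)%:E * interaction (Ub n) xi t <= (1 * 1)%:E * interaction Uoo xi t)%E.
    apply: (rhs_diff kH (jCmeas_picard_lim kH mv0 v0H) (jCmeas_picard mv0 n)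
      (mU n) (jmeas_majorant_lim kH mv0 v0H) t0 ler01 (lexx 1) v0 (K := 2 / c0 d)).
    - move=> eta tau /andP[tau0 _]; apply: cnorm_le_c0.
      by apply: le_trans (voo_le _ _ tau0) _; have /andP[] := Ulim eta tau tau0.
    - by move=> eta tau /andP[tau0 _]; exact: (picard_leH kH mv0 v0H).
    - move=> eta tau /andP[tau0 _]; apply/andP; split; first exact: U_ge0.
      exact: (majorant_le_lim kH mv0 v0H).
    - by move=> eta tau /andP[tau0 _]; rewrite mul1r; exact: (picard_le1 kH mv0 v0H).
    - by move=> eta tau /andP[tau0 _]; rewrite !mul1r; exact: (picard_lim_tail kH mv0 v0H).
  have h1 : c0 d * cnorm (FNS_rhs v0 voo xi t - vb n.+1 xi t) <= Uoo xi t - Ub n.+1 xi t.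
    rewrite lerBrDr -lee_fin EFinD EFin_majorantS// majorant_lim_fixed// addeCA.
    by apply: leeD => //; rewrite mulr1 !mul1e in h.
  have h2 := picard_lim_tail kH mv0 v0H n.+1 xi t.
  rewrite -lerBrDr in h2.
  have h3 := cnorm_triangle_common (vb n.+1 xi t) (voo xi t) (FNS_rhs v0 voo xi t).
  exact: scaled_triangle (ltW c0p) h3 h2 h1.
have gap0 : Uoo xi t - Ub n.+1 xi t @[n --> \oo] --> (0 : R).
  rewrite -(subrr (Uoo xi t)); apply: cvgB; first exact: cvg_cst.
  by rewrite (cvg_shiftS (fun n => Ub n xi t)); exact: U_cvg.
have lim0 : (Uoo xi t - Ub n.+1 xi t) + (Uoo xi t - Ub n.+1 xi t) @[n --> \oo] --> (0 : R).
  by rewrite -(addr0 0); exact: cvgD.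
have : c0 d * cnorm (voo xi t - FNS_rhs v0 voo xi t) <= 0.
  by apply: (cvgr_to_ge lim0); exact: nearW.
rewrite pmulr_rle0// => h; apply/eqP; rewrite -subr_eq0; apply/eqP/cnorm_eq0/eqP.
by rewrite eq_le h cnorm_ge0.
Qed.

Lemma picard_supersolution (a K : R) (Y : X -> R -> R) : jmeas Y ->
  (forall xi, c0 d * cnorm (v0 xi) <= a * H xi) ->
  (forall xi t, 0 < t -> 0 <= Y xi t <= K * H xi) ->
  (forall xi t, 0 < t -> ((a * heat xi t * H xi)%:E + interaction Y xi t <= (Y xi t)%:E)%E) ->
  forall xi t, 0 < t -> c0 d * cnorm (voo xi t) <= Y xi t.
Proof.
move=> mY v0a YK superY xi t t0; apply: (picard_lim_le kH mv0 v0H) => n.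
elim: n xi t t0 => [|n IH] xi t t0.
  by rewrite /= cnorm0 mulr0; have /andP[] := YK xi t t0.
have h : ((c0 d * cnorm (vb n.+1 xi t))%:E <=
   (heat xi t * (c0 d * cnorm (v0 xi)))%:E + (1 * 1)%:E * interaction Y xi t)%E.
  apply: (rhs_bound kH v0 (K := K)) => //; first exact: jCmeas_picard.
    by move=> eta tau /andP[tau0 _]; exact: YK.
  by move=> eta tau /andP[tau0 _]; rewrite mul1r; exact: IH.
rewrite -lee_fin; apply: le_trans h _; rewrite mulr1 mul1e.
apply: le_trans (superY xi t t0); apply: leeD => //; rewrite lee_fin.
by rewrite (mulrC a) -mulrA ler_wpM2l// ltW// heat_gt0.
Qed.

(** [a * p + a ^+ 2 / 2 * (1 - p) <= a] for [a <= 2]: the constant multiple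
    [a * H] is a supersolution. *)
Lemma picard_lim_le_const (a : R) : 0 <= a -> a <= 2 ->
  (forall xi, c0 d * cnorm (v0 xi) <= a * H xi) ->
  forall xi t, 0 < t -> c0 d * cnorm (voo xi t) <= a * H xi.
Proof.
move=> a0 a2 v0a; apply: (@picard_supersolution a a (fun xi _ => a * H xi)) => //.
- exact: jmeas_kernel.
- by move=> xi t t0; rewrite lexx andbT mulr_ge0//; case: kH.
move=> xi t t0; rewrite interaction_kernel// -EFinD lee_fin.
have H0 : 0 <= H xi by case: kH.
have := heat_le1 xi (ltW t0); have := heat_gt0 xi t.
move: (heat xi t) => p p0 p1; rewrite -mulrDl ler_wpM2r//.
have : 0 <= a * (2 - a) * (1 - p) by rewrite !mulr_ge0// subr_ge0.
nra.
Qed.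

(** A solution [w] of size [2 * lam * H] is within [lam ^+ n.+1 * (2 * H - Ub n)]
    of the [n]-th iterate.  For [n = 0] this is the size of [w]; the induction step
    is the difference estimate with [eps = lam ^+ n.+1] and [W = 2 * H], in which
    the second factor [lam] comes from the size of the iterate. *)
Lemma picard_lim_unique (lam T : R) (w : X -> R -> 'rV[R[i]]_d) :
  0 <= lam -> lam < 1 -> jCmeas w ->
  (forall xi, c0 d * cnorm (v0 xi) <= 2 * lam * H xi) ->
  (forall xi t, 0 < t <= T -> c0 d * cnorm (w xi t) <= 2 * lam * H xi) ->
  (forall xi t, 0 < t <= T -> w xi t = FNS_rhs v0 w xi t) ->
  forall xi t, 0 < t <= T -> w xi t = voo xi t.
Proof.
move=> lam0 lam1 mw v0lam wlam wE.
have H_ge0 xi : 0 <= H xi by case: kH.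
have dist n xi t : 0 < t <= T -> c0 d * cnorm (w xi t - vb n xi t) +
    lam ^+ n.+1 * Ub n xi t <= lam ^+ n.+1 * (2 * H xi).
  elim: n xi t => [|n IH] xi t tT.
    by rewrite /= subr0 mulr0 addr0 expr1 mulrA (mulrC lam); exact: wlam.
  have /andP[t0 tT'] := tT.
  have sub tau : 0 < tau < t -> 0 < tau <= T.
    by move=> /andP[-> h]; rewrite (le_trans (ltW h)).
  have h : ((c0 d * cnorm (FNS_rhs v0 w xi t - FNS_rhs v0 (vb n) xi t))%:E +
      (lam * lam ^+ n.+1)%:E * interaction (Ub n) xi t <=
      (lam * lam ^+ n.+1)%:E * interaction (fun eta _ => 2 * H eta)%R xi t)%E.
    apply: (rhs_diff kH mw (jCmeas_picard mv0 n) (mU n) (jmeas_kernel kH 2) t0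
       _ _ v0 (K := 2 / c0 d)).
    - exact: exprn_ge0.
    - by rewrite exprS ler_piMr// exprn_ile1// ltW.
    - move=> eta tau /sub tt; apply: cnorm_le_c0; apply: le_trans (wlam _ _ tt) _.
      by rewrite ler_wpM2r// ler_piMr// ltW.
    - by move=> eta tau /andP[tau0 _]; exact: (picard_leH kH mv0 v0H).
    - by move=> eta tau /andP[tau0 _]; exact: majorant_bound.
    - move=> eta tau /andP[tau0 _].
      exact: (picard_le kH mv0 n eta lam0 (ltW lam1) v0lam tau0).
    - by move=> eta tau /sub tt; exact: IH.
  have qf := interaction_majorant_fin kH n xi t.
  move: h; rewrite interaction_kernel// -(fineK qf) -exprS -!EFinM -EFinD lee_fin -wE//= => h.
  rewrite mulrDr addrCA.
  have : lam ^+ n.+2 * (2 * heat xi t * H xi) + lam ^+ n.+2 *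
      (2 ^+ 2 / 2 * (1 - heat xi t) * H xi) = lam ^+ n.+2 * (2 * H xi) by field.
  lra.
move=> xi t tT; have /andP[t0 _] := tT.
have close n : c0 d * cnorm (w xi t - voo xi t) <=
    lam ^+ n.+1 * (2 * H xi) + (Uoo xi t - Ub n xi t).
  have h1 := dist n xi t tT.
  have h2 := picard_lim_tail kH mv0 v0H n xi t.
  have h3 := cnorm_triangle_common (vb n xi t) (w xi t) (voo xi t).
  have U0 : 0 <= lam ^+ n.+1 * Ub n xi t by rewrite mulr_ge0 ?exprn_ge0// U_ge0.
  rewrite -lerBrDr in h2; apply: scaled_triangle (ltW c0p) h3 _ h2.
  by apply: le_trans h1; rewrite lerDl.
have lim0 : lam ^+ n.+1 * (2 * H xi) + (Uoo xi t - Ub n xi t) @[n --> \oo] --> (0 : R).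
  rewrite -(addr0 0); apply: cvgD.
    rewrite -(mul0r (2 * H xi)); apply: cvgM; last exact: cvg_cst.
    rewrite (cvg_shiftS (fun n => lam ^+ n)); apply: cvg_expr.
    by rewrite ger0_norm.
  rewrite -(subrr (Uoo xi t)); apply: cvgB; first exact: cvg_cst.
  exact: U_cvg.
have : c0 d * cnorm (w xi t - voo xi t) <= 0.
  by apply: (cvgr_to_ge lim0); exact: nearW.
rewrite pmulr_rle0// => h; apply/eqP; rewrite -subr_eq0; apply/eqP/cnorm_eq0/eqP.
by rewrite eq_le h cnorm_ge0.
Qed.

End picard_fixed_point.

(** * Decay *)

Section decay.
Context {R : realType}.

(** The tangent to the exponential at [k * z] lies below it at [z] and at 0; the
    claim is the combination of the two inequalities with weights [k] and
    [1 - k]. *)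
Lemma expR_interpolation (k z : R) : 0 <= k <= 1 ->
  expR (k * z) <= 1 - k + k * expR z.
Proof.
move=> /andP[k0 k1].
have h1 : expR (k * z) * (1 + (1 - k) * z) <= expR z.
  have -> : expR z = expR (k * z) * expR ((1 - k) * z) by rewrite -expRD; congr expR; ring.
  by rewrite ler_pM2l ?expR_gt0// expR_ge1Dx.
have h2 : expR (k * z) * (1 - k * z) <= 1.
  have := expR_ge1Dx (- (k * z)); rewrite expRN => h.
  have := ler_wpM2l (expR_ge0 (k * z)) h.
  by rewrite divff// gt_eqF// expR_gt0.
have {}h1 := ler_wpM2l k0 h1.
have k1' : 0 <= 1 - k by rewrite subr_ge0.
have {}h2 := ler_wpM2l k1' h2.
have := lerD h1 h2; rewrite mulr1 => h.
rewrite addrC; apply: le_trans h.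
by rewrite le_eqVlt; apply/orP; left; apply/eqP; ring.
Qed.

Lemma sqrt_subadditive (s t : R) : 0 <= s <= t ->
  Num.sqrt t <= Num.sqrt (t - s) + Num.sqrt s.
Proof.
move=> /andP[s0 st].
rewrite -(@ler_pXn2r _ 2)// ?nnegrE ?addr_ge0 ?sqrtr_ge0//.
rewrite sqrrD !sqr_sqrtr ?subr_ge0// ?(le_trans s0)//.
have : 0 <= Num.sqrt (t - s) * Num.sqrt s by rewrite mulr_ge0 ?sqrtr_ge0.
lra.
Qed.

(** For [k = 1] the supersolution is [2 * expR (- decay_log - |xi| * sqrt t) * H],
    and the largest data that it tolerates are [2 * expR (- leaf_log) * H]; note
    that [expR leaf_log = 8 * expR (3 / 4)]. *)
Definition decay_log : R := ln 4 + 1 / 2.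
Definition leaf_log : R := ln 8 + 3 / 4.

Lemma expR_decay_log : expR (- decay_log + 1 / 2) = 4^-1.
Proof.
rewrite /decay_log (_ : - (ln 4 + 1 / 2) + 1 / 2 = - ln 4 :> R); last by ring.
by rewrite expRN lnK// posrE.
Qed.

Lemma expR_decay_leaf_log : expR (decay_log - leaf_log + 4^-1) = 2^-1.
Proof.
rewrite /decay_log /leaf_log.
have -> : ln 8 = ln 4 + ln 2 :> R.
  by rewrite -lnM ?posrE//; congr ln; rewrite -natrM.
rewrite (_ : _ + 4^-1 = - ln 2 :> R); last by field.
by rewrite expRN lnK// posrE.
Qed.

Lemma decay_log_ge0 : 0 <= decay_log.
Proof. by rewrite addr_ge0 ?divr_ge0// ln_ge0// ler1n. Qed.

Definition decay_rate (k x t : R) : R := expR (- (k * (decay_log + x * Num.sqrt t))).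

Lemma decay_rate_ge0 (k x t : R) : 0 <= decay_rate k x t.
Proof. exact: expR_ge0. Qed.

(** The factor of the data, [expR (- k * leaf_log)], is interpolated relative to
    [decay_rate k x t]; then [x * sqrt t - t * x ^+ 2 <= 1 / 4]. *)
Lemma decay_source (k x t : R) : 0 <= k <= 1 -> 0 <= x -> 0 < t ->
  expR (- (k * leaf_log)) * expR (- t * x ^+ 2) <=
  decay_rate k x t * ((1 - k) * expR (- t * x ^+ 2) + k / 2).
Proof.
move=> k01 x0 t0; have /andP[k0 k1] := k01.
have s2 : Num.sqrt t ^+ 2 = t by rewrite sqr_sqrtr// ltW.
set q := Num.sqrt t in s2 *.
have -> : expR (- (k * leaf_log)) = decay_rate k x t * expR (k * (decay_log - leaf_log + x * q)).
  by rewrite -expRD; congr expR; rewrite -/q; ring.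
rewrite -mulrA ler_pM2l ?expR_gt0//.
apply: le_trans (ler_wpM2r (expR_ge0 _) (expR_interpolation _ k01)) _.
rewrite mulrDl lerD2l -mulrA ler_wpM2l// -expR_decay_leaf_log -expRD ler_expR.
have := sqr_ge0 (x * q - 2^-1).
have -> : (x * q - 2^-1) ^+ 2 = x ^+ 2 * q ^+ 2 - x * q + 4^-1 by field.
rewrite s2; lra.
Qed.

(** The same interpolation inside the time integral, where [sqrt t] is split
    along [t - s] and [s], and [x * sqrt s <= 1 / 2 + s * x ^+ 2 / 2] is absorbed by
    half of the heat factor. *)
Lemma decay_interaction (k x s t : R) : 0 <= k <= 1 -> 0 <= x -> 0 < s < t ->
  expR (- s * x ^+ 2) * (decay_rate k x (t - s) * expR (- (k * decay_log))) <=
  decay_rate k x t *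
    ((1 - k) * expR (- s * x ^+ 2) + k / 4 * expR (- s * (x ^+ 2 / 2))).
Proof.
move=> k01 x0 /andP[s0 st]; have /andP[k0 k1] := k01.
have s2 : Num.sqrt s ^+ 2 = s by rewrite sqr_sqrtr// ltW.
have sub : Num.sqrt t <= Num.sqrt (t - s) + Num.sqrt s.
  by apply: sqrt_subadditive; rewrite !ltW.
set q := Num.sqrt s in s2 sub.
pose z := - decay_log + x * Num.sqrt t - x * Num.sqrt (t - s).
have -> : decay_rate k x (t - s) * expR (- (k * decay_log)) = decay_rate k x t * expR (k * z).
  by rewrite -!expRD; congr expR; rewrite /z; ring.
rewrite mulrCA ler_pM2l ?expR_gt0//.
apply: le_trans (ler_wpM2l (expR_ge0 _) (expR_interpolation _ k01)) _.
rewrite mulrDr mulrC lerD2l mulrCA -mulrA ler_wpM2l//.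
rewrite -expR_decay_log -!expRD ler_expR /z.
have h : x * Num.sqrt t <= x * Num.sqrt (t - s) + x * q by rewrite -mulrDr ler_wpM2l.
have := sqr_ge0 (x * q - 1); have -> : (x * q - 1) ^+ 2 = x ^+ 2 * q ^+ 2 - 2 * (x * q) + 1 by ring.
rewrite s2; lra.
Qed.

Context {d : nat}.
Local Notation X := ('rV[R]_d).
Local Notation leb := (@lebesgue_measure R).
Implicit Types (xi eta : X) (t tau : R).
Variables (H : X -> R) (kH : conv_kernel H).

Let mH : measurable_fun setT H. Proof. by case: kH. Qed.
Let H0 : H 0 = 0. Proof. by case: kH. Qed.
Let H_ge0 xi : 0 <= H xi. Proof. by case: kH. Qed.

Lemma jmeas_decay (k c : R) : jmeas (fun xi t => c * decay_rate k (enorm xi) t * H xi).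
Proof.
apply: measurable_funM; last exact: (measurableT_comp mH measurable_fst).
apply: measurable_funM; first exact: measurable_cst.
rewrite /decay_rate; apply: (measurableT_comp (@measurable_expR R)).
apply: measurable_funN.
apply: measurable_funM; first exact: measurable_cst.
apply: measurable_funD; first exact: measurable_cst.
apply: measurable_funM; first exact: (measurableT_comp measurable_enorm measurable_fst).
exact: (measurableT_comp (continuous_measurable_fun (@sqrt_continuous R)) measurable_snd).
Qed.

Lemma decay_rate_le1 (k x t : R) : 0 <= k -> 0 <= x -> decay_rate k x t <= 1.
Proof.
move=> k0 x0; rewrite /decay_rate -expR0 ler_expR oppr_le0 mulr_ge0//.
by rewrite addr_ge0 ?decay_log_ge0// mulr_ge0// sqrtr_ge0.
Qed.

(** The exponential weights multiply to at most the weight at [xi], by the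
    triangle inequality. *)
Lemma selfconv_decay (k c : R) xi tau : 0 <= k -> xi != 0 ->
  (selfconv (fun eta tau => c * decay_rate k (enorm eta) tau * H eta)%R xi tau <=
   (c ^+ 2 * (decay_rate k (enorm xi) tau * expR (- (k * decay_log))) *
     (enorm xi * H xi))%:E)%E.
Proof.
move=> k0 xi0; set b := _ * expR _.
have b0 : 0 <= b by rewrite mulr_ge0 ?expR_ge0 ?decay_rate_ge0.
have mY := jmeas_decay k c.
have mHH : measurable_fun setT (fun eta => H eta * H (xi - eta)).
  by apply: measurable_funM => //; exact: (measurableT_comp mH (measurable_rV_subC _)).
have HH0 eta : [set: X] eta -> (0 <= (H eta * H (xi - eta))%:E)%E.
  by rewrite lee_fin mulr_ge0.
have cb0 : (0 <= (c ^+ 2 * b)%:E)%E by rewrite lee_fin mulr_ge0 ?sqr_ge0.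
have mHHe : measurable_fun setT (fun eta => (H eta * H (xi - eta))%:E).
  exact/measurable_EFinP.
have [_ _ _ /(_ xi xi0) hconv] := kH; rewrite EFinM -hconv.
rewrite -(ge0_integralZl _ measurableT mHHe HH0 cb0).
have YY eta : c * decay_rate k (enorm eta) tau * H eta *
    (c * decay_rate k (enorm (xi - eta)) tau * H (xi - eta)) =
    c ^+ 2 * (decay_rate k (enorm eta) tau * decay_rate k (enorm (xi - eta)) tau) *
    (H eta * H (xi - eta)) by ring.
apply: ge0_le_integral => //.
- move=> eta _; rewrite YY lee_fin; apply: mulr_ge0; last exact: mulr_ge0.
  apply: mulr_ge0; first exact: sqr_ge0.
  by apply: mulr_ge0; exact: decay_rate_ge0.
- apply/measurable_EFinP.
  exact: (@measurable_conv_integrand _ _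
    (fun eta tau => c * decay_rate k (enorm eta) tau * H eta)%R xi tau mY).
- by apply: emeasurable_funM => //; exact: measurable_cst.
move=> eta _; rewrite YY -EFinM lee_fin; apply: ler_wpM2r; first exact: mulr_ge0.
apply: ler_wpM2l; first exact: sqr_ge0.
rewrite /b /decay_rate -!expRD ler_expR.
have := ler_wpM2r (sqrtr_ge0 tau) (enorm_split xi eta).
move: (enorm xi) (enorm eta) (enorm (xi - eta)) (Num.sqrt tau) => p q r u.
move=> /(ler_wpM2l k0); lra.
Qed.

(** Write [p = heat xi t].  By the two interpolations the source is at most the
    fraction [(1 - k) * p + k / 2] of the right-hand side, and the interaction at
    most the fraction [(1 - k) * (1 - p) + k / 2]; these add up to 1. *)
Lemma decay_supersolution (k lam : R) xi t : 0 <= k <= 1 -> 0 <= lam <= 1 -> 0 < t ->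
  ((2 * lam * expR (- (k * leaf_log)) * heat xi t * H xi)%:E +
   interaction (fun eta tau => 2 * lam * decay_rate k (enorm eta) tau * H eta)%R xi t <=
   (2 * lam * decay_rate k (enorm xi) t * H xi)%:E)%E.
Proof.
move=> k01 /andP[lam0 lam1] t0; have /andP[k0 k1] := k01.
have [->|xi0] := eqVneq xi 0; first by rewrite interaction_at0 H0 !mulr0 adde0.
set x := enorm xi; have x0 : 0 <= x by exact: enorm_ge0.
set c := 2 * lam; have c0 : 0 <= c by rewrite mulr_ge0.
set r := decay_rate k x t; have r0 : 0 <= r by exact: expR_ge0.
(* Amplitudes of the two parts of the interpolated integrand: the heat factor, and
   the half heat factor left after absorbing [x * sqrt s]. *)
pose A := 2^-1 * c ^+ 2 * H xi * r * (1 - k).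
pose B := 2^-1 * c ^+ 2 * H xi * r * (k / 2).
have A0 : 0 <= A by rewrite !mulr_ge0 ?sqr_ge0 ?subr_ge0.
have B0 : 0 <= B by rewrite !mulr_ge0 ?sqr_ge0.
have mexp (y : R) (D : set R) : measurable_fun (D : set (measurableTypeR R))
    (fun s => (y * expR (- s * y))%:E).
  apply/measurable_EFinP; apply: measurable_funTS; apply: measurable_funM => //.
  apply: (measurableT_comp (@measurable_expR R)); exact: measurable_funM.
have exp0 (y s : R) : 0 <= y -> (0 <= (y * expR (- s * y))%:E)%E.
  by move=> y0; rewrite lee_fin mulr_ge0 ?expR_ge0.
have x20 : 0 <= x ^+ 2 by exact: sqr_ge0.
have x220 : 0 <= x ^+ 2 / 2 by exact: divr_ge0.
have mI : measurable (`]0, t[%classic : set (measurableTypeR R)) by [].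
have Qle : (interaction (fun eta tau => c * decay_rate k (enorm eta) tau * H eta)%R xi t <=
    A%:E * (1 - expR (- t * x ^+ 2))%:E + B%:E * (1 - expR (- t * (x ^+ 2 / 2)))%:E)%E.
  rewrite -!integral_exp//.
  rewrite -(ge0_integralZl _ mI (mexp (x ^+ 2) _) (fun s _ => exp0 _ s x20)) ?lee_fin//.
  rewrite -(ge0_integralZl _ mI (mexp (x ^+ 2 / 2) _) (fun s _ => exp0 _ s x220)) ?lee_fin//.
  have mZ (C y : R) : measurable_fun (`]0, t[%classic : set (measurableTypeR R))
      (fun s => C%:E * (y * expR (- s * y))%:E)%E.
    by apply: emeasurable_funM => //; exact: measurable_cst.
  rewrite -ge0_integralD//; last 2 first.
  - by move=> s _; apply: mule_ge0; [rewrite lee_fin|exact: exp0].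
  - by move=> s _; apply: mule_ge0; [rewrite lee_fin|exact: exp0].
  apply: ge0_le_integral => //.
  - move=> s _; apply: mule_ge0; first by rewrite lee_fin divr_ge0// damp_ge0.
    by apply: selfconv_ge0 => eta; rewrite !mulr_ge0// decay_rate_ge0.
  - by apply: measurable_interaction_integrand; exact: jmeas_decay.
  - by apply: emeasurable_funD.
  move=> s /= sI; have st : 0 < s < t by move: sI; rewrite in_itv.
  have := lee_wpmul2l (_ : 0 <= (damp xi s / 2)%:E)%E
    (selfconv_decay c (t - s) k0 xi0).
  rewrite lee_fin divr_ge0 ?damp_ge0// => /(_ isT) h; apply: le_trans h _.
  rewrite -!EFinM -EFinD lee_fin /damp /heat -/x.
  have := decay_interaction k01 x0 st; rewrite -/r.
  have cH : 0 <= 2^-1 * c ^+ 2 * H xi * x ^+ 2 by rewrite !mulr_ge0 ?sqr_ge0.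
  move=> /(ler_wpM2l cH).
  set u := expR (- s * x ^+ 2); set u2 := expR (- s * (x ^+ 2 / 2)).
  set g := decay_rate k x (t - s) * _.
  rewrite (_ : u * x / 2 * (c ^+ 2 * g * (x * H xi)) =
    2^-1 * c ^+ 2 * H xi * x ^+ 2 * (u * g)); last by field.
  move=> h; apply: le_trans h _.
  by rewrite le_eqVlt; apply/orP; left; apply/eqP; rewrite /A /B; field.
apply: le_trans (leeD (lexx _) Qle) _; rewrite -!EFinM -!EFinD lee_fin.
have := decay_source k01 x0 t0; rewrite -/r => src.
rewrite /heat -/x; set p := expR (- t * x ^+ 2) in src *.
have p1 : p <= 1 by have := heat_le1 xi (ltW t0).
have p2 := expR_ge0 (- t * (x ^+ 2 / 2)).
have cH : 0 <= c * H xi by rewrite mulr_ge0.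
have {}src := ler_wpM2l cH src.
apply: (@le_trans _ _ (c * H xi * (r * ((1 - k) * p + k / 2)) +
    c * H xi * (r * ((1 - k) * (1 - p) + k / 2)))); last first.
  by rewrite le_eqVlt; apply/orP; left; apply/eqP; field.
apply: lerD.
  by apply: le_trans src; rewrite le_eqVlt; apply/orP; left; apply/eqP; ring.
have clam : 2^-1 * c ^+ 2 = lam * c by rewrite /c; field.
rewrite /A /B clam.
have -> : lam * c * H xi * r * (1 - k) * (1 - p) +
    lam * c * H xi * r * (k / 2) * (1 - expR (- t * (x ^+ 2 / 2))) =
    lam * (c * H xi * (r * ((1 - k) * (1 - p) +
      k / 2 * (1 - expR (- t * (x ^+ 2 / 2)))))) by ring.
apply: le_trans (ler_piMl _ lam1) _.
  apply: mulr_ge0 => //; apply: mulr_ge0 => //; apply: addr_ge0.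
    by apply: mulr_ge0; rewrite subr_ge0.
  apply: mulr_ge0; first exact: divr_ge0.
  rewrite subr_ge0 -[leRHS]expR0 ler_expR mulNr oppr_le0.
  by apply: mulr_ge0 => //; exact: ltW.
apply: ler_wpM2l => //; apply: ler_wpM2l => //; rewrite lerD2l.
by rewrite ler_piMr ?divr_ge0// gerBl.
Qed.

End decay.

(** * Dependence of the right-hand side on the fields *)

Section almost_everywhere.
Context d (T : measurableType d) (R : realType) (mu : {measure set T -> \bar R}).
Implicit Types P : T -> Prop.

Lemma ae_all P1 : (forall x, P1 x) -> {ae mu, forall x, P1 x}.
Proof. by move=> h; exact: aeW. Qed.

Lemma ae_mono P1 P2 : {ae mu, forall x, P1 x} -> (forall x, P1 x -> P2 x) ->
  {ae mu, forall x, P2 x}.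
Proof. by move=> h P12; apply: filterS h. Qed.

Lemma ae_mono2 P1 P2 P3 : {ae mu, forall x, P1 x} -> {ae mu, forall x, P2 x} ->
  (forall x, P1 x -> P2 x -> P3 x) -> {ae mu, forall x, P3 x}.
Proof. by move=> h k P123; apply: filterS2 h k. Qed.

End almost_everywhere.

Section locality.
Context {R : realType} {d : nat}.
Local Notation X := ('rV[R]_d).
Local Notation L := (@lebesgue_rV R d).
Local Notation leb := (@lebesgue_measure R).
Implicit Types (xi eta : X) (t tau : R).
Local Open Scope complex_scope.

Lemma FNS_rhs_data (v0 v0' : X -> 'rV[R[i]]_d) (v : X -> R -> 'rV[R[i]]_d) xi t :
  v0 xi = v0' xi -> FNS_rhs v0 v xi t = FNS_rhs v0' v xi t.
Proof. by move=> e; rewrite /FNS_rhs e. Qed.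

Lemma FNS_rhs_local (v0 : X -> 'rV[R[i]]_d) (v w : X -> R -> 'rV[R[i]]_d) xi t :
  (forall eta tau, 0 < tau < t -> v eta tau = w eta tau) ->
  FNS_rhs v0 v xi t = FNS_rhs v0 w xi t.
Proof.
move=> vw.
have E : Cintegral leb `]0, t[ (fun s => (damp xi s)%:C *: inner v xi (t - s)) =
         Cintegral leb `]0, t[ (fun s => (damp xi s)%:C *: inner w xi (t - s)).
  apply: eq_Cintegral => s; rewrite inE => /in_lag st.
  apply: (congr1 (fun z => (damp xi s)%:C *: z)).
  by apply: eq_Cintegral => eta _; rewrite !vw.
exact: (congr1 (fun z => (heat xi t)%:C *: v0 xi + (c0 d)%:C *: z) E).
Qed.

(** The integrals over times and frequencies ignore null sets; those in
    [xi - eta] and in [t - s] are handled by reflection invariance. *)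
Lemma FNS_rhs_ae (v0 : X -> 'rV[R[i]]_d) (v w : X -> R -> 'rV[R[i]]_d) xi t :
  jCmeas v -> jCmeas w ->
  {ae leb, forall tau, 0 < tau < t -> {ae L, forall eta, v eta tau = w eta tau}} ->
  FNS_rhs v0 v xi t = FNS_rhs v0 w xi t.
Proof.
move=> mv mw vw.
have mI : measurable (`]0, t[%classic : set (measurableTypeR R)) by [].
have E : Cintegral leb `]0, t[ (fun s => (damp xi s)%:C *: inner v xi (t - s)) =
         Cintegral leb `]0, t[ (fun s => (damp xi s)%:C *: inner w xi (t - s)).
  apply: (ae_eq_Cintegral mI).
  - by apply: Cmeasurable_sub; exact: Cmeasurable_damped_inner.
  - by apply: Cmeasurable_sub; exact: Cmeasurable_damped_inner.
  apply: (ae_mono (ae_time_subC t vw)) => s vws /in_lag st.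
  apply: (congr1 (fun z => (damp xi s)%:C *: z)).
  apply: (ae_eq_Cintegral measurableT).
  - exact: Cmeasurable_inner_integrand.
  - exact: Cmeasurable_inner_integrand.
  have h1 := vws st; have h2 := ae_subC xi h1.
  by apply: (ae_mono2 h1 h2) => eta e1 e2 _; rewrite e1 e2.
exact: (congr1 (fun z => (heat xi t)%:C *: v0 xi + (c0 d)%:C *: z) E).
Qed.

Lemma Cmeasurable_indic d' (T : measurableType d') (E : set T) (f : T -> 'rV[R[i]]_d) :
  measurable E -> Cmeasurable setT f ->
  Cmeasurable setT (fun x => (\1_E x : R)%:C *: f x).
Proof. by move=> mE mf; apply: CmeasurableZR => //; exact: measurable_indic. Qed.

Lemma scale_indic_in d' (T : measurableType d') (E : set T) x (a : 'rV[R[i]]_d) :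
  E x -> (\1_E x : R)%:C *: a = a.
Proof. by move=> Ex; rewrite indicE mem_set//; exact: scale1r. Qed.

Lemma scale_indic_notin d' (T : measurableType d') (E : set T) x (a : 'rV[R[i]]_d) :
  ~ E x -> (\1_E x : R)%:C *: a = 0.
Proof. by move=> Ex; rewrite indicE memNset//; exact: scale0r. Qed.

Lemma measurable_cnorm_le d' (T : measurableType d') (f : T -> 'rV[R[i]]_d) (g : T -> R) :
  Cmeasurable setT f -> measurable_fun setT g ->
  measurable [set x | c0 d * cnorm (f x) <= g x].
Proof.
move=> mf mg; have mt : measurable [set true] by [].
have mcf : measurable_fun setT (fun x => c0 d * cnorm (f x)).
  by apply: measurable_funM; [exact: measurable_cst|exact: measurable_cnorm].
by have := measurable_fun_ler mcf mg measurableT mt; rewrite setTI.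
Qed.

Lemma measurable_time (T : \bar R) : measurable (time T : set (measurableTypeR R)).
Proof.
rewrite (_ : time T = `]0, +oo[%classic `&` [set t : R | (t%:E < T)%E]).
  apply: measurableI => //.
  have mt : measurable [set` `]-oo, T[%O] by exact: emeasurable_itv.
  have := @EFin_measurable R setT measurableT _ mt; rewrite setTI.
  congr measurable; apply/seteqP; split => t /=; by rewrite in_itv.
apply/seteqP; split => t /=; rewrite in_itv/= andbT.
- by [].
- by [].
Qed.

Lemma jCmeas_extend (T : \bar R) (w : X -> R -> 'rV[R[i]]_d) :
  Cmeasurable (setT `*` (time T : set (measurableTypeR R)))
    (fun p : X * measurableTypeR R => w p.1 p.2) ->
  jCmeas (fun xi t => if t \in time T then w xi t else 0).
Proof.
move=> mw j; have [m1 m2] := mw j.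
have mD : measurable (setT `*` (time T : set (measurableTypeR R)) : set (X * measurableTypeR R)).
  by apply: measurableX => //; exact: measurable_time.
have memD (p : X * measurableTypeR R) :
    (p \in setT `*` (time T : set (measurableTypeR R))) = (p.2 \in time T).
  apply/idP/idP => /set_mem; first by move=> [_ h]; exact: mem_set.
  by move=> h; apply: mem_set; split.
split.
  rewrite (_ : (fun _ => _) =
    (fun p : X * measurableTypeR R => complex.Re (w p.1 p.2 ord0 j)) \_
      (setT `*` (time T : set (measurableTypeR R)))).
    exact/(measurable_restrictT _ mD).
  by apply/funext => p; rewrite patchE memD; case: ifP => // _; rewrite mxE.
rewrite (_ : (fun _ => _) =
  (fun p : X * measurableTypeR R => complex.Im (w p.1 p.2 ord0 j)) \_
    (setT `*` (time T : set (measurableTypeR R)))).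
  exact/(measurable_restrictT _ mD).
by apply/funext => p; rewrite patchE memD; case: ifP => // _; rewrite mxE.
Qed.

End locality.

(** * Solutions in the majorization space *)

Section kernel_extension.
Context {R : realType} {d : nat}.
Local Notation X := ('rV[R]_d).
Local Notation L := (@lebesgue_rV R d).
Implicit Types (xi eta : X).
Variables (h : X -> R) (sh : standard_majorizing_kernel h).

Definition extend_kernel xi : R := if xi == 0 then 0 else h xi.

Lemma extend_kernelE xi : xi != 0 -> extend_kernel xi = h xi.
Proof. by rewrite /extend_kernel => /negbTE ->. Qed.

Lemma extend_kernel_gt0 xi : xi != 0 -> 0 < extend_kernel xi.
Proof. by move=> xi0; rewrite extend_kernelE//; case: sh => _ h0 _; exact: h0. Qed.

Lemma extend_kernel_conv : conv_kernel extend_kernel.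
Proof.
have [mh h0 hh] := sh.
have m0 : measurable [set~ (0 : X)] by apply: measurableC; exact: measurable_rV1.
split.
- rewrite (_ : extend_kernel = h \_ [set~ 0]); first exact/(measurable_restrictT _ m0).
  apply/funext => xi; rewrite patchE /extend_kernel; have [->|xi0] := eqVneq xi 0.
    by rewrite memNset//= => /(_ erefl).
  by rewrite mem_set//=; exact/eqP.
- by rewrite /extend_kernel eqxx.
- move=> xi; have [->|xi0] := eqVneq xi 0; first by rewrite /extend_kernel eqxx.
  exact/ltW/extend_kernel_gt0.
move=> xi xi0; rewrite (extend_kernelE xi0) -hh// [RHS]integral_mkcond.
apply: eq_integral => eta _; rewrite patchE.
have [->|eta0] := eqVneq eta 0.
  by rewrite /extend_kernel eqxx mul0r memNset//= => -[] /eqP.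
have [->|etaxi] := eqVneq eta xi.
  by rewrite /extend_kernel subrr eqxx mulr0 memNset//= => -[_]; rewrite eqxx.
by rewrite mem_set//= !extend_kernelE// subr_eq0 eq_sym.
Qed.

End kernel_extension.

Section solution.
Context {R : realType} {d : nat}.
Local Notation X := ('rV[R]_d).
Local Notation L := (@lebesgue_rV R d).
Local Notation leb := (@lebesgue_measure R).
Implicit Types (xi eta : X) (t tau : R).
Local Open Scope complex_scope.
Hypothesis d0 : (0 < d)%N.
Variables (h : X -> R) (sh : standard_majorizing_kernel h).

Local Notation H := (extend_kernel h).

Let kH : conv_kernel H. Proof. exact: extend_kernel_conv. Qed.
Let H_ge0 xi : 0 <= H xi. Proof. by case: kH. Qed.
Let mH : measurable_fun setT H. Proof. by case: kH. Qed.
Let c0p : 0 < c0 d :> R. Proof. exact: c0_gt0. Qed.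
Let h_gt0 xi : xi != 0 -> 0 < h xi. Proof. by move=> x0; case: sh => _ h0 _; exact: h0. Qed.

Lemma Fh_norm_ge0 (f : X -> 'rV[R[i]]_d) : (0 <= Fh_norm h f)%E.
Proof.
apply: ess_sup_gee; first exact: lebesgue_rVT_gt0.
apply: (ae_mono (ae_neq0 d0)) => xi xi0.
by rewrite lee_fin divr_ge0 ?(ltW (h_gt0 xi0))// mulr_ge0 ?cnorm_ge0// ltW.
Qed.

Lemma Fh_norm_leP (f : X -> 'rV[R[i]]_d) (M : R) :
  (Fh_norm h f <= M%:E)%E <-> {ae L, forall xi, c0 d * cnorm (f xi) <= M * H xi}.
Proof.
split=> [/ess_supP fM|fM].
  apply: (ae_mono2 (ae_neq0 d0) fM) => xi xi0.
  by rewrite lee_fin ler_pdivrMr ?h_gt0// extend_kernelE.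
apply/ess_supP; apply: (ae_mono2 (ae_neq0 d0) fM) => xi xi0 hx.
by rewrite lee_fin ler_pdivrMr ?h_gt0// -extend_kernelE.
Qed.

Lemma Fh_infty_norm_leP (T : \bar R) (v : X -> R -> 'rV[R[i]]_d) (M : R) : 0 <= M ->
  (Fh_infty_norm h T v <= M%:E)%E <->
  {ae leb, forall t, time T t -> {ae L, forall xi, c0 d * cnorm (v xi t) <= M * H xi}}.
Proof.
move=> M0; split=> [/ess_supP vM|vM].
  apply: (ae_mono vM) => t + tT; rewrite patchE mem_set//.
  by move=> /Fh_norm_leP.
apply/ess_supP; apply: (ae_mono vM) => t vt; rewrite patchE.
by case: ifPn => [/set_mem tT|_]; [exact/Fh_norm_leP/vt|rewrite lee_fin].
Qed.

Lemma Fh_of_bound (f : X -> 'rV[R[i]]_d) (M : R) : Cmeasurable setT f ->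
  (forall xi, c0 d * cnorm (f xi) <= M * H xi) -> Fh h f.
Proof.
move=> mf fM; have fM' xi : cnorm (f xi) <= M / c0 d * H xi by exact: cnorm_le_c0.
split; first exact: (kernel_L1loc kH d0 (extend_kernel_gt0 sh) mf fM').
apply: (@le_lt_trans _ _ (M / c0 d)%:E); last exact: ltry.
apply/ess_supP; apply: (ae_mono (ae_neq0 d0)) => xi xi0.
by rewrite lee_fin ler_pdivrMr ?h_gt0// -(extend_kernelE h xi0).
Qed.

(** A modification of [f] that obeys the bound [g] everywhere, and agrees with [f]
    wherever [f] does. *)
Definition truncate d' (T : measurableType d') (f : T -> 'rV[R[i]]_d) (g : T -> R) x :=
  (\1_[set x | c0 d * cnorm (f x) <= g x] x : R)%:C *: f x.

Lemma truncate_id d' (T : measurableType d') (f : T -> 'rV[R[i]]_d) (g : T -> R) x :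
  c0 d * cnorm (f x) <= g x -> truncate f g x = f x.
Proof. exact: scale_indic_in. Qed.

Lemma truncate_bound d' (T : measurableType d') (f : T -> 'rV[R[i]]_d) (g : T -> R) x :
  0 <= g x -> c0 d * cnorm (truncate f g x) <= g x.
Proof.
move=> g0; have [fg|fg] := leP (c0 d * cnorm (f x)) (g x).
  by rewrite truncate_id.
have -> : truncate f g x = 0.
  by apply: scale_indic_notin => /= fg'; move: fg; rewrite ltNge fg'.
by rewrite cnorm0 mulr0.
Qed.

Lemma Cmeasurable_truncate d' (T : measurableType d') (f : T -> 'rV[R[i]]_d) (g : T -> R) :
  Cmeasurable setT f -> measurable_fun setT g -> Cmeasurable setT (truncate f g).
Proof. by move=> mf mg; apply: Cmeasurable_indic => //; exact: measurable_cnorm_le. Qed.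

Variables (v0 : X -> 'rV[R[i]]_d) (a : R).
Hypotheses (mv0 : Cmeasurable setT v0) (a0 : 0 <= a) (a2 : a <= 2).
Hypothesis v0a : (Fh_norm h v0 <= a%:E)%E.

Definition data : X -> 'rV[R[i]]_d := truncate v0 (fun xi => a * H xi).
Definition solution : X -> R -> 'rV[R[i]]_d := picard_lim data.

Let mdata : Cmeasurable setT data.
Proof.
by apply: Cmeasurable_truncate => //; apply: measurable_funM => //; exact: measurable_cst.
Qed.

Let data_le xi : c0 d * cnorm (data xi) <= a * H xi.
Proof. by apply: truncate_bound; rewrite mulr_ge0. Qed.

Let data_le2 xi : c0 d * cnorm (data xi) <= 2 * H xi.
Proof. by apply: le_trans (data_le xi) _; rewrite ler_wpM2r. Qed.

Let data_ae : {ae L, forall xi, v0 xi = data xi}.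
Proof.
by move/Fh_norm_leP : v0a => hv; apply: (ae_mono hv) => xi hx; rewrite /data truncate_id.
Qed.

Let msolution : jCmeas solution.
Proof. exact: (jCmeas_picard_lim kH mdata data_le2). Qed.

Let solution_le xi t : 0 < t -> c0 d * cnorm (solution xi t) <= a * H xi.
Proof. exact: (picard_lim_le_const kH mdata data_le2 a0 a2 data_le). Qed.

Lemma solution_norm (T : \bar R) : (Fh_infty_norm h T solution <= a%:E)%E.
Proof.
apply/Fh_infty_norm_leP => //; apply: ae_all => t [t0 _].
by apply: ae_all => xi; exact: solution_le.
Qed.

Lemma solution_FNS : FNS_solution v0 +oo%E solution.
Proof.
apply: ae_all => t [t0 _]; apply: (ae_mono data_ae) => xi v0E.
by rewrite (FNS_rhs_data _ _ v0E); exact: (picard_lim_fixed kH mdata data_le2).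
Qed.

Lemma Cmeasurable_at (v : X -> R -> 'rV[R[i]]_d) t : jCmeas v -> Cmeasurable setT (v^~ t).
Proof. by move=> mv; apply: (jCmeas_comp mv) => //; exact: measurable_cst. Qed.

Lemma solution_Fh_infty : Fh_infty h +oo%E solution.
Proof.
split.
- exact: Cmeasurable_sub.
- apply: ae_all => t [t0 _]; apply: (Fh_of_bound (M := a)); first exact: Cmeasurable_at.
  by move=> xi; exact: solution_le.
- by apply: le_lt_trans (solution_norm _) _; exact: ltry.
Qed.

Lemma solution_decay (k : R) : 0 <= k <= 1 ->
  let mu := (8 * expR (3 / 4)) `^ k in mu * a < 2 ->
  ae_xt +oo%E (fun xi t =>
    cnorm (solution xi t) <= 2 / c0 d * (mu * a / (2 - mu * a)) *
      expR (- (k * enorm xi * Num.sqrt t)) * h xi).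
Proof.
move=> k01 mu mua; have /andP[k0 k1] := k01.
have muE : mu = expR (k * leaf_log).
  rewrite /mu /powR gt_eqF ?mulr_gt0 ?expR_gt0//; congr (expR (k * _)).
  by rewrite lnM ?posrE ?expR_gt0// expRK.
have mu0 : 0 < mu by rewrite muE expR_gt0.
pose lam := mu * a / 2.
have lam0 : 0 <= lam by rewrite divr_ge0// mulr_ge0// ltW.
have lam1 : lam <= 1 by rewrite ler_pdivrMr// mul1r ltW.
have lama : 2 * lam * expR (- (k * leaf_log)) = a.
  rewrite expRN -muE /lam; field.
  by rewrite gt_eqF.
have lam01 : 0 <= lam <= 1 by rewrite lam0.
have dec xi t (t0 : 0 < t) : c0 d * cnorm (solution xi t) <=
    2 * lam * decay_rate k (enorm xi) t * H xi.
  apply: (picard_supersolution kH mdata data_le2 (a := a) (K := 2)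
    (Y := fun xi t => 2 * lam * decay_rate k (enorm xi) t * H xi)) => //.
  - exact: jmeas_decay.
  - move=> eta tau tau0.
    have r0 := decay_rate_ge0 k (enorm eta) tau.
    have r1 := decay_rate_le1 tau k0 (enorm_ge0 eta).
    apply/andP; split; first by rewrite mulr_ge0// mulr_ge0// mulr_ge0.
    rewrite ler_wpM2r// -mulrA ler_piMr// mulr_ile1//.
  - move=> eta tau tau0; have := decay_supersolution kH eta k01 lam01 tau0.
    by rewrite lama.
apply: ae_all => t [t0 _]; apply: (ae_mono (ae_neq0 d0)) => xi xi0.
have := dec xi t t0; rewrite (extend_kernelE h xi0) => dx.
have hx := h_gt0 xi0.
set e := expR (- (k * enorm xi * Num.sqrt t)).
have re : decay_rate k (enorm xi) t <= e.
  rewrite ler_expR lerN2 mulrDr -mulrA lerDr mulr_ge0// decay_log_ge0//.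
have e0 : 0 <= e by exact: expR_ge0.
have gain : 2 * lam <= 2 * (mu * a / (2 - mu * a)).
  have den : 0 < 2 - mu * a by rewrite subr_gt0.
  have ma : 0 <= mu * a by rewrite mulr_ge0// ltW.
  rewrite ler_pM2l// /lam ler_wpM2l// lef_pV2 ?posrE//.
  by rewrite gerBl.
rewrite -(ler_pM2l c0p); apply: le_trans dx _.
have cancel z : c0 d * (2 / c0 d * z * e * h xi) = 2 * z * e * h xi.
  by field; rewrite gt_eqF.
rewrite cancel.
rewrite ler_wpM2r ?(ltW hx)//; apply: ler_pM => //.
- by rewrite mulr_ge0.
- exact: decay_rate_ge0.
Qed.

Lemma solution_unique (T : \bar R) (w : X -> R -> 'rV[R[i]]_d) : a < 2 ->
  Fh_infty h T w -> FNS_solution v0 T w -> (Fh_infty_norm h T w < 2%:E)%E ->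
  ae_xt T (fun xi t => w xi t = solution xi t).
Proof.
move=> a_lt2 [mw _ _] solw normw.
(* A common bound [M < 2] for the data, the solution and [w]. *)
have [M [aM M2 wM]] : exists M : R, [/\ a <= M, M < 2 & (Fh_infty_norm h T w <= M%:E)%E].
  exists (Num.max a (fine (Fh_infty_norm h T w))); split.
  - by rewrite le_max lexx.
  - rewrite gt_max a_lt2/=; move: normw.
    by case: (Fh_infty_norm h T w) => [r| |]//=; rewrite lte_fin.
  - move: normw; case: (Fh_infty_norm h T w) => [r| |]//=.
      by move=> _; rewrite lee_fin le_max lexx orbT.
    by move=> _; exact: leNye.
have M0 : 0 <= M by exact: le_trans aM.
pose wT xi t := if t \in time T then w xi t else 0.
have mwT : jCmeas wT by exact: jCmeas_extend.
(* [w1] is jointly measurable and obeys the bound of [w] everywhere; [w2], the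
   right-hand side at [w1], moreover satisfies the equation everywhere, and both
   agree with [w] almost everywhere. *)
pose tr : X * measurableTypeR R -> 'rV[R[i]]_d :=
  truncate (fun p => wT p.1 p.2) (fun p => M * H p.1).
pose w1 xi t := tr (xi, t).
have mw1 : jCmeas w1.
  have trE : (fun p : X * measurableTypeR R => tr (p.1, p.2)) = tr.
    by apply/funext => -[].
  have mtr : Cmeasurable setT tr.
    apply: Cmeasurable_truncate => //; apply: measurable_funM; first exact: measurable_cst.
    exact: (measurableT_comp mH measurable_fst).
  by move: mtr; rewrite -trE.
have w1M xi t : c0 d * cnorm (w1 xi t) <= M * H xi.
  exact: (@truncate_bound _ _ (fun p : X * measurableTypeR R => wT p.1 p.2)
    (fun p => M * H p.1) (xi, t) (mulr_ge0 M0 (H_ge0 xi))).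
have down t tau : time T t -> 0 < tau < t -> time T tau.
  move=> [t0 tT] /andP[tau0 taut]; split => //.
  by apply: lt_trans tT; rewrite lte_fin.
have wTE xi t : time T t -> wT xi t = w xi t by move=> tT; rewrite /wT mem_set.
have ww1 : {ae leb, forall t, time T t -> {ae L, forall xi, wT xi t = w1 xi t}}.
  move/(Fh_infty_norm_leP _ _ M0) : wM => wM; apply: (ae_mono wM) => t wt tT.
  apply: (ae_mono (wt tT)) => xi wx.
  by rewrite /w1 /tr truncate_id//= wTE.
pose w2 := FNS_rhs data w1.
have mw2 : jCmeas w2 by exact: jCmeas_rhs.
have rhs_w1 xi t : time T t -> FNS_rhs data w xi t = w2 xi t.
  move=> tT; transitivity (FNS_rhs data wT xi t).
    by apply: FNS_rhs_local => eta tau /(down _ _ tT) tauT; rewrite wTE.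
  apply: FNS_rhs_ae => //; apply: (ae_mono ww1) => tau wtau /(down _ _ tT) tauT.
  exact: wtau.
have ww2 : {ae leb, forall t, time T t -> {ae L, forall xi, w xi t = w2 xi t}}.
  apply: (ae_mono solw) => t wt tT; apply: (ae_mono2 data_ae (wt tT)) => xi v0E ->.
  by rewrite (FNS_rhs_data _ _ v0E); exact: rhs_w1.
have w2E xi t : time T t -> w2 xi t = FNS_rhs data w2 xi t.
  move=> tT; apply: FNS_rhs_ae => //.
  apply: (ae_mono2 ww1 ww2) => tau e1 e2 /(down _ _ tT) tauT.
  apply: (ae_mono2 (e1 tauT) (e2 tauT)) => eta <- <-; exact: wTE.
have w2M xi t : 0 < t -> c0 d * cnorm (w2 xi t) <= M * H xi.
  move=> t0; have hb : ((c0 d * cnorm (w2 xi t))%:E <=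
     (heat xi t * (c0 d * cnorm (data xi)))%:E +
     (1 * 1)%:E * interaction (fun eta _ => M * H eta)%R xi t)%E.
    apply: (rhs_bound kH data (K := M)) => //; first exact: jmeas_kernel.
      by move=> eta tau _; rewrite lexx mulr_ge0.
    by move=> eta tau _; rewrite mul1r; exact: w1M.
  rewrite -lee_fin; apply: le_trans hb _.
  rewrite mulr1 mul1e interaction_kernel// -EFinD lee_fin.
  have p0 := heat_gt0 xi t; have p1 := heat_le1 xi (ltW t0).
  have := ler_wpM2l (ltW p0) (le_trans (data_le xi) (ler_wpM2r (H_ge0 xi) aM)).
  set u := c0 d * _; move: (heat xi t) p0 p1 => p p0 p1 hu.
  apply: le_trans (lerD hu (lexx _)) _.
  have -> : p * (M * H xi) + M ^+ 2 / 2 * (1 - p) * H xi =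
    (p * M + M ^+ 2 / 2 * (1 - p)) * H xi by ring.
  rewrite ler_wpM2r//.
  have : 0 <= M * (2 - M) * (1 - p) by rewrite !mulr_ge0// subr_ge0// ltW.
  nra.
clearbody w2.
have w2v xi t : time T t -> w2 xi t = solution xi t.
  move=> tT; have [t0 _] := tT.
  have MM : 2 * (M / 2) = M by field.
  have lam0 : 0 <= M / 2 by exact: divr_ge0.
  have lam1 : M / 2 < 1 by rewrite ltr_pdivrMr// mul1r.
  have dataM eta : c0 d * cnorm (data eta) <= 2 * (M / 2) * H eta.
    by rewrite MM; apply: le_trans (data_le eta) _; rewrite ler_wpM2r.
  have w2b eta tau : 0 < tau <= t -> c0 d * cnorm (w2 eta tau) <= 2 * (M / 2) * H eta.
    by move=> /andP[tau0 _]; rewrite MM; exact: w2M.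
  have w2fix eta tau : 0 < tau <= t -> w2 eta tau = FNS_rhs data w2 eta tau.
    move=> /andP[tau0]; rewrite le_eqVlt => /predU1P[->|taut]; first exact: w2E.
    by apply: w2E; apply: (down _ _ tT); rewrite tau0.
  have tt : 0 < t <= t by rewrite t0 lexx.
  exact: (picard_lim_unique kH mdata data_le2 lam0 lam1 mw2 dataM w2b w2fix xi tt).
apply: (ae_mono ww2) => t wt tT; apply: (ae_mono (wt tT)) => xi ->.
exact: w2v.
Qed.

End solution.

(** After taking logarithms [mu * a < 2] reads
    [k * (3 / 4) * (1 + 4 * ln 2) < ln 2 - ln a]; for [a = 0] it is trivial. *)
Lemma decay_threshold (R : realType) (a k : R) : 0 <= a -> a < 2 ->
  (k%:E < Order.min 1 (4%:E * ((ln 2)%:E - lne a%:E) / (3 * (1 + 4 * ln 2))%:E))%E ->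
  k < 1 /\ (8 * expR (3 / 4)) `^ k * a < 2.
Proof.
move=> a0 a2; rewrite lt_min => /andP[k1 kln]; split; first by rewrite lte_fin in k1.
move: a0 kln; rewrite le_eqVlt => /predU1P[<- _|a0]; first by rewrite mulr0.
have ln20 : 0 < ln 2 :> R by rewrite ln_gt0// ltr1n.
have den : 0 < 3 * (1 + 4 * ln 2) :> R by rewrite mulr_gt0// addr_gt0// mulr_gt0.
rewrite lne_EFin// inver gt_eqF// -EFinB -!EFinM lte_fin ltr_pdivlMr// => kln.
have ln8 : ln 8 = 3 * ln 2 :> R.
  have -> : 8 = 2 ^+ 3 :> R by rewrite -natrX.
  by rewrite lnXn// mulr_natl.
rewrite /powR gt_eqF ?mulr_gt0 ?expR_gt0// lnM ?posrE ?expR_gt0// expRK ln8.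
rewrite -[X in _ * X < _](lnK a0) -[ltRHS]lnK ?posrE// -expRD ltr_expR.
lra.
Qed.

Theorem proposition4p1 (R : realType) (d : nat) (hd : (3 <= d)%N) :
  exists C : R, 0 < C /\
  forall (h : 'rV[R]_d -> R) (v0 : 'rV[R]_d -> 'rV[R[i]]_d),
    standard_majorizing_kernel h -> Fh h v0 ->
    ((Fh_norm h v0 <= 2%:E)%E ->
      exists v : 'rV[R]_d -> R -> 'rV[R[i]]_d,
        [/\ Fh_infty h +oo%E v, FNS_solution v0 +oo%E v &
            (Fh_infty_norm h +oo%E v <= 2%:E)%E]) /\
    ((Fh_norm h v0 < 2%:E)%E ->
      exists v : 'rV[R]_d -> R -> 'rV[R[i]]_d,
        [/\ [/\ Fh_infty h +oo%E v, FNS_solution v0 +oo%E v &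
                (Fh_infty_norm h +oo%E v <= 2%:E)%E],
            forall kappa : R, 0 < kappa ->
              (kappa%:E < Order.min 1
                 (4%:E * ((ln 2)%:E - lne (Fh_norm h v0)) /
                  (3 * (1 + 4 * ln 2))%:E))%E ->
              let mu := (8 * expR (3 / 4)) `^ kappa in
              let a := fine (Fh_norm h v0) in
              ae_xt +oo%E (fun xi t =>
                cnorm (v xi t) <=
                C * (mu * a / (2 - mu * a)) *
                expR (- (kappa * enorm xi * Num.sqrt t)) * h xi) &
            forall T : \bar R, (0 <= T)%E ->
              (Fh_infty_norm h T v < 2%:E)%E /\
              forall w : 'rV[R]_d -> R -> 'rV[R[i]]_d,
                Fh_infty h T w -> FNS_solution v0 T w ->
                (Fh_infty_norm h T w < 2%:E)%E ->
                ae_xt T (fun xi t => w xi t = v xi t)]).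
Proof.
exists (2 / c0 d); split; first by rewrite divr_gt0// c0_gt0.
move=> h v0 sh [[mv0 _] _]; have d0 : (0 < d)%N by exact: leq_trans hd.
have norm_fine (b : R) : (Fh_norm h v0 <= b%:E)%E ->
    Fh_norm h v0 = (fine (Fh_norm h v0))%:E.
  move=> nb; rewrite fineK// ge0_fin_numE; last exact: Fh_norm_ge0.
  by apply: le_lt_trans nb _; exact: ltry.
split=> [v02|v02].
  have normE := norm_fine _ v02; have n0 := Fh_norm_ge0 d0 sh v0.
  set a := fine _ in normE; rewrite normE !lee_fin in v02 n0.
  have na : (Fh_norm h v0 <= a%:E)%E by rewrite normE.
  exists (solution h v0 a); split.
  - exact: solution_Fh_infty.
  - exact: solution_FNS.
  - by apply: le_trans (solution_norm d0 sh mv0 n0 v02 _) _; rewrite lee_fin.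
have normE := norm_fine _ (ltW v02); have n0 := Fh_norm_ge0 d0 sh v0.
set a := fine _ in normE *; rewrite normE lte_fin in v02; rewrite normE lee_fin in n0.
have na : (Fh_norm h v0 <= a%:E)%E by rewrite normE.
have a2 := ltW v02.
exists (solution h v0 a); split.
- split.
  + exact: solution_Fh_infty.
  + exact: solution_FNS.
  + by apply: le_trans (solution_norm d0 sh mv0 n0 a2 _) _; rewrite lee_fin.
- move=> kappa kappa0; rewrite normE => kappa_lt mu.
  have [k1 mua] := decay_threshold n0 v02 kappa_lt.
  by apply: solution_decay => //; rewrite !ltW.
move=> T _; split; last by move=> w; exact: solution_unique.
by apply: le_lt_trans (solution_norm d0 sh mv0 n0 a2 _) _; rewrite lte_fin.
Qed.
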